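(* Let $\Gamma=(\gamma_n)$ be a finite or infinite sequence of distinct complex numbers, with at least two terms, and let $v=(v_n)$ be a sequence of positive numbers with the same index set such that $\sum_n\frac{v_n}{1+|\gamma_n|^2}<\infty$ and $(\Gamma,v)^*\neq\emptyset$. An orthogonal basis of reproducing kernels for $\mathscr{H}(\Gamma,v)$ means an orthogonal basis of the form $(k_\lambda)_{\lambda\in\Lambda}$, where $\Lambda$ is a sequence of distinct points in $(\Gamma,v)^*$. (1) If the space $\mathscr{H}(\Gamma,v)$ has an orthogonal basis of reproducing kernels, then $\Gamma$ is a subset of a straight line or a circle. (2) Suppose that $\Gamma$ is a subset of the real line. Then the orthogonal bases of reproducing kernels for $\mathscr{H}(\Gamma,v)$ are precisely the systems $(k_\lambda)_{\lambda\in\Lambda(\alpha)}$ with $\alpha$ a real number for which the discrete Hilbert transform $H_v(\Gamma,\Lambda(\alpha)):\ell^2_v\to\ell^2_{w(\alpha)}$ is unitary; and, for real $\alpha$, this transform is unitary if and only if $(\alpha-\varphi(z))^{-1}$ is a purely atomic Herglotz function in the upper half-plane. Here $\varphi(z)=\sum_n v_n\big(\frac{1}{\gamma_n-z}-\frac{\gamma_n}{1+\gamma_n^2}\big)$. (3) The analogous result holds when $\Gamma$ is a subset of the unit circle: the orthogonal bases of reproducing kernels for $\mathscr{H}(\Gamma,v)$ are precisely the systems $(k_\lambda)_{\lambda\in\Lambda(\alpha)}$ with $\alpha$ a real number for which $H_v(\Gamma,\Lambda(\alpha)):\ell^2_v\to\ell^2_{w(\alpha)}$ is unitary; and, for real $\alpha$,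 this transform is unitary if and only if $(\alpha-\varphi(z))^{-1}$ is a purely atomic Herglotz function in the open unit disk. Here $\varphi(z)=\frac{i}{2}\sum_n v_n\frac{\gamma_n+z}{\gamma_n-z}$.
   Context: Set $$(\Gamma,v)^*=\Big\{z\in\mathbb{C}:\ \sum_n\frac{v_n}{|z-\gamma_n|^2}<\infty\Big\},$$ where points of $\Gamma$ are understood not to belong to $(\Gamma,v)^*$, and $\ell^2_v=\{(a_n):\sum_n|a_n|^2v_n<\infty\}$. The space $\mathscr{H}(\Gamma,v)$ consists of all functions on $(\Gamma,v)^*$ of the form $$f(z)=\sum_n\frac{a_nv_n}{z-\gamma_n}\quad\text{with}\quad \|f\|_{\mathscr{H}(\Gamma,v)}^2=\sum_n|a_n|^2v_n<\infty;$$ it is understood that $f$ determines the coefficients $(a_n)$, so that the norm is well defined and $\mathscr{H}(\Gamma,v)$ is a Hilbert space isometric to $\ell^2_v$. The reproducing kernel of $\mathscr{H}(\Gamma,v)$ at a point $z\in(\Gamma,v)^*$ is $$k_z(\zeta)=\sum_n\frac{v_n}{(\overline{z}-\overline{\gamma_n})(\zeta-\gamma_n)}.$$ In parts (2) and (3), the respective function $\varphi$ is considered on $(\Gamma,v)^*$, where the series defining it converges absolutely; this set contains the open upper half-plane when $\Gamma\subset\mathbb{R}$ and the open unit disk when $\Gamma$ is a subset of the unit circle. For real $\alpha$, $$\Lambda(\alpha)=\{\lambda\in(\Gamma,v)^*:\ \varphi(\lambda)=\alpha\},$$ which is an at most countable set $(\lambda_j)$, and $w(\alpha)=(w_j)$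 is the weight sequence $w_j=\big(\sum_n\frac{v_n}{|\lambda_j-\gamma_n|^2}\big)^{-1}$. The discrete Hilbert transform $H_v(\Gamma,\Lambda(\alpha))$ is the map $$(a_n)_n\mapsto\Big(\sum_n\frac{a_nv_n}{\lambda_j-\gamma_n}\Big)_j,$$ and $\ell^2_{w(\alpha)}=\{(b_j):\sum_j|b_j|^2w_j<\infty\}$. A Herglotz function in the upper half-plane is a holomorphic function $\psi$ there whose imaginary part is positive; it can be written as $$\psi(z)=b+cz+\int_{-\infty}^{\infty}\Big(\frac{1}{t-z}-\frac{t}{1+t^2}\Big)\,d\mu(t),$$ where $b$ is a real constant, $c\ge0$ is a constant, and $\mu$ is a nonnegative measure on the real line with $\int_{-\infty}^\infty\frac{d\mu(t)}{1+t^2}<\infty$. It is called purely atomic if $c=0$ and $\mu$ is a purely atomic measure. A Herglotz function in the open unit disk is a holomorphic function $\psi$ there whose imaginary part is positive; it can be written as $$\psi(z)=b+i\int_0^{2\pi}\frac{e^{it}+z}{e^{it}-z}\,d\mu(t),$$ where $b$ is a real constant and $\mu$ is a nonnegative measure on the circle. It is called purely atomic if $\mu$ is a purely atomic measure.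
   Formalization: If Γ has exactly two terms, the description of the orthogonal bases in (2) and (3) is asserted only for Λ on the real line (resp. unit circle); otherwise it is false, e.g. Γ=(0,1), v=(1,1), Λ={i,(3-i)/5}. *)

(* Defs.v *)
From HB Require Import structures.
From mathcomp Require Import all_boot all_order all_algebra.
From mathcomp Require Import complex.
From mathcomp Require Import all_classical all_reals all_analysis.

Set Implicit Arguments.
Unset Strict Implicit.
Unset Printing Implicit Defensive.
Import Order.TTheory GRing.Theory Num.Theory.
Import numFieldNormedType.Exports.
Local Open Scope classical_set_scope.
Local Open Scope complex_scope.
Local Open Scope ring_scope.

Notation Re := complex.Re.
Notation Im := complex.Im.
(* modulus of a complex number, as an element of R (whereas `|z| lives in R[i]) *)
Notation cabs := ComplexField.Normc.normc.

(** Absolutely convergent sums over a set of indices. *)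

Definition rsum (R : realType) (T : choiceType) (S : set T) (f : T -> R) : R :=
  fine (\esum_(t in S) (EFin \o f)^\+ t - \esum_(t in S) (EFin \o f)^\- t)%E.

Definition csum (R : realType) (T : choiceType) (S : set T) (f : T -> R[i])
  : R[i] :=
  rsum S (fun t => Re (f t)) +i* rsum S (fun t => Im (f t)).

(** Weighted l^2 spaces; only the values on the index set S matter. *)

Definition l2norm2 (R : realType) (T : choiceType) (S : set T) (u : T -> R)
    (a : T -> R[i]) : \bar R :=
  (\esum_(t in S) (cabs (a t) ^+ 2 * u t)%:E)%E.

Definition l2 (R : realType) (T : choiceType) (S : set T) (u : T -> R)
    (a : T -> R[i]) : Prop :=
  (l2norm2 S u a < +oo)%E.

Definition l2dot (R : realType) (T : choiceType) (S : set T) (u : T -> R)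
    (a b : T -> R[i]) : R[i] :=
  csum S (fun t => a t * conjc (b t) * (u t)%:C).

Definition unitary_l2 (R : realType) (T T' : choiceType)
    (S : set T) (u : T -> R) (S' : set T') (u' : T' -> R)
    (F : (T -> R[i]) -> (T' -> R[i])) : Prop :=
  [/\ forall a, l2 S u a -> l2 S' u' (F a),
      forall a b, l2 S u a -> l2 S u b ->
        l2dot S' u' (F a) (F b) = l2dot S u a b &
      forall b, l2 S' u' b ->
        exists2 a, l2 S u a & forall t, S' t -> F a t = b t].

(** The space H(Gamma, v).  Its elements are functions on (Gamma, v)^*; they
    are represented by total functions whose values elsewhere are ignored. *)

Definition star (R : realType) (I : countType) (gamma : I -> R[i]) (v : I -> R)
  : set R[i] :=
  [set z | (forall n, z != gamma n) /\
    (\esum_(n in [set: I]) (v n / cabs (z - gamma n) ^+ 2)%:E < +oo)%E].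

(* a |-> (z |-> sum_n a_n v_n / (z - gamma_n)); restricted to z in a set Lambda
   this is the discrete Hilbert transform H_v(Gamma, Lambda) *)
Definition hilbert_transform (R : realType) (I : countType) (gamma : I -> R[i])
    (v : I -> R) (a : I -> R[i]) (z : R[i]) : R[i] :=
  csum [set: I] (fun n => a n * (v n)%:C / (z - gamma n)).

Definition has_coefs (R : realType) (I : countType) (gamma : I -> R[i])
    (v : I -> R) (f : R[i] -> R[i]) (a : I -> R[i]) : Prop :=
  l2 [set: I] v a /\
  forall z, star gamma v z -> f z = hilbert_transform gamma v a z.

Definition Hspace (R : realType) (I : countType) (gamma : I -> R[i])
    (v : I -> R) : set (R[i] -> R[i]) :=
  [set f | exists a, has_coefs gamma v f a].

Definition coefs_determined (R : realType) (I : countType) (gamma : I -> R[i])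
    (v : I -> R) : Prop :=
  forall f a b, has_coefs gamma v f a -> has_coefs gamma v f b -> a = b.

Definition Hcoefs (R : realType) (I : countType) (gamma : I -> R[i])
    (v : I -> R) (f : R[i] -> R[i]) : I -> R[i] :=
  xget (fun=> 0) [set a | has_coefs gamma v f a].

Definition Hnorm2 (R : realType) (I : countType) (gamma : I -> R[i])
    (v : I -> R) (f : R[i] -> R[i]) : \bar R :=
  l2norm2 [set: I] v (Hcoefs gamma v f).

Definition Hdot (R : realType) (I : countType) (gamma : I -> R[i])
    (v : I -> R) (f g : R[i] -> R[i]) : R[i] :=
  l2dot [set: I] v (Hcoefs gamma v f) (Hcoefs gamma v g).

Definition rkernel (R : realType) (I : countType) (gamma : I -> R[i])
    (v : I -> R) (z zeta : R[i]) : R[i] :=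
  csum [set: I] (fun n =>
    (v n)%:C / ((conjc z - conjc (gamma n)) * (zeta - gamma n))).

(* orthogonal basis (e_t), t in S: nonzero pairwise orthogonal vectors whose
   finite linear combinations are dense *)
Definition H_orthogonal_basis (R : realType) (I : countType)
    (gamma : I -> R[i]) (v : I -> R)
    (T : choiceType) (S : set T) (e : T -> (R[i] -> R[i])) : Prop :=
  [/\ forall t, S t -> Hspace gamma v (e t) /\ (0 < Hnorm2 gamma v (e t))%E,
      forall s t, S s -> S t -> s != t -> Hdot gamma v (e s) (e t) = 0 &
      forall f, Hspace gamma v f -> forall eps : R, 0 < eps ->
        exists (r : seq T) (c : T -> R[i]),
          (forall t, t \in r -> S t) /\
          (Hnorm2 gamma v (fun z => f z - \sum_(t <- r) c t * e t z)%R
             < eps%:E)%E].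

(* A sequence Lambda of distinct points is given by its (countable) range. *)
Definition rkernel_basis (R : realType) (I : countType)
    (gamma : I -> R[i]) (v : I -> R) (Lambda : set R[i]) : Prop :=
  [/\ countable Lambda, Lambda `<=` star gamma v &
      H_orthogonal_basis gamma v Lambda (rkernel gamma v)].

(** Lines, circles, half-plane, disk. *)

Definition straight_line (R : realType) (p d : R[i]) : set R[i] :=
  [set p + t%:C * d | t in [set: R]].

Definition circle (R : realType) (c : R[i]) (r : R) : set R[i] :=
  [set z | cabs (z - c) = r].

Definition real_line (R : realType) : set R[i] := [set z | Im z = 0].

Definition unit_circle (R : realType) : set R[i] := [set z | cabs z = 1].

Definition upper_half_plane (R : realType) : set R[i] := [set z | 0 < Im z].

Definition unit_disk (R : realType) : set R[i] := [set z | cabs z < 1].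

Arguments real_line : clear implicits.
Arguments unit_circle : clear implicits.
Arguments upper_half_plane : clear implicits.
Arguments unit_disk : clear implicits.

(** The functions phi, the sets Lambda(alpha) and the weights w(alpha). *)

Definition phi_line (R : realType) (I : countType) (gamma : I -> R[i])
    (v : I -> R) (z : R[i]) : R[i] :=
  csum [set: I] (fun n =>
    (v n)%:C * ((gamma n - z)^-1 - gamma n / (1 + gamma n ^+ 2))).

Definition phi_circle (R : realType) (I : countType) (gamma : I -> R[i])
    (v : I -> R) (z : R[i]) : R[i] :=
  'i%C / 2 * csum [set: I] (fun n =>
    (v n)%:C * ((gamma n + z) / (gamma n - z))).

Definition level_set (R : realType) (I : countType) (gamma : I -> R[i])
    (v : I -> R) (phi : R[i] -> R[i]) (alpha : R) : set R[i] :=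
  [set l | star gamma v l /\ phi l = alpha%:C].

Definition weight (R : realType) (I : countType) (gamma : I -> R[i])
    (v : I -> R) (l : R[i]) : R :=
  (fine (\esum_(n in [set: I]) (v n / cabs (l - gamma n) ^+ 2)%:E))^-1.

Definition unitary_transform (R : realType) (I : countType)
    (gamma : I -> R[i]) (v : I -> R) (phi : R[i] -> R[i]) (alpha : R) : Prop :=
  unitary_l2 [set: I] v (level_set gamma v phi alpha) (weight gamma v)
    (hilbert_transform gamma v).

(** Herglotz functions. *)

(* The type of psi is cast to numFieldType so that complex differentiability
   refers to the normed space structure of R[i] over itself. *)
Definition holomorphic_on (R : realType) (D : set R[i]) (psi : R[i] -> R[i])
  : Prop :=
  forall z, D z ->
    derivable (psi : (R[i] : numFieldType) -> (R[i] : numFieldType)) z 1.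

Definition herglotz (R : realType) (D : set R[i]) (psi : R[i] -> R[i]) : Prop :=
  holomorphic_on D psi /\ forall z, D z -> 0 < Im (psi z).

Definition cintegral (R : realType)
    (mu : {measure set (measurableTypeR R) -> \bar R})
    (D : set R) (f : R -> R[i]) : R[i] :=
  Rintegral mu D (fun t => Re (f t)) +i* Rintegral mu D (fun t => Im (f t)).

(* mu is, on the subsets of D, the sum of its point masses *)
Definition purely_atomic (R : realType)
    (mu : {measure set (measurableTypeR R) -> \bar R}) (D : set R) : Prop :=
  forall A : set (measurableTypeR R), measurable A -> A `<=` D ->
    mu A = (\esum_(t in A) mu [set t])%E.

Definition herglotz_repr_line (R : realType) (psi : R[i] -> R[i])
    (b c : R) (mu : {measure set (measurableTypeR R) -> \bar R}) : Prop :=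
  [/\ 0 <= c,
      (\int[mu]_t ((1 + t ^+ 2)^-1)%:E < +oo)%E &
      forall z, upper_half_plane R z ->
        psi z = b%:C + c%:C * z +
          cintegral mu [set: R] (fun t =>
            (t%:C - z)^-1 - (t / (1 + t ^+ 2))%:C)].

Definition purely_atomic_herglotz_line (R : realType) (psi : R[i] -> R[i])
  : Prop :=
  herglotz (upper_half_plane R) psi /\
  exists (b c : R) (mu : {measure set (measurableTypeR R) -> \bar R}),
    [/\ herglotz_repr_line psi b c mu, c = 0 & purely_atomic mu [set: R]].

Definition expi (R : realType) (t : R) : R[i] := cos t +i* sin t.

(* A measure on the circle is a measure on [0, 2 pi[ (half-open, so that the
   point 1 is counted once); mu outside this interval is irrelevant. *)
Definition angles (R : realType) : set R := `[0, 2 * pi[%classic.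

Arguments angles : clear implicits.

Definition herglotz_repr_disk (R : realType) (psi : R[i] -> R[i])
    (b : R) (mu : {measure set (measurableTypeR R) -> \bar R}) : Prop :=
  (mu (angles R) < +oo)%E /\
  forall z, unit_disk R z ->
    psi z = b%:C + 'i%C * cintegral mu (angles R) (fun t =>
      (expi t + z) / (expi t - z)).

Definition purely_atomic_herglotz_disk (R : realType) (psi : R[i] -> R[i])
  : Prop :=
  herglotz (unit_disk R) psi /\
  exists (b : R) (mu : {measure set (measurableTypeR R) -> \bar R}),
    herglotz_repr_disk psi b mu /\ purely_atomic mu (angles R).

(* With exactly two points in Gamma there are orthogonal bases of kernels that
   are not of the form Lambda(alpha): for Gamma = {0, 1} and v = (1, 1) the
   kernels at i and (3 - i)/5 are orthogonal, whereas phi is real only on the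
   real line.  In general, two nonreal points may form such a basis, but with
   three points or more Lambda has to lie on the line (circle). *)
Definition three_terms (I : eqType) : Prop :=
  exists i j k : I, [/\ i != j, i != k & j != k].

(* Main.v *)
Require Import Defs.
From HB Require Import structures.
From mathcomp Require Import all_boot all_order all_algebra.
From mathcomp Require Import complex finmap.
From mathcomp Require Import all_classical all_reals all_analysis measurable_realfun.
From mathcomp Require Import ring lra.
Set Implicit Arguments.
Unset Strict Implicit.
Unset Printing Implicit Defensive.
Import Order.TTheory GRing.Theory Num.Theory.
Import numFieldNormedType.Exports.
Local Open Scope classical_set_scope.
Local Open Scope complex_scope.
Local Open Scope ring_scope.

Local Notation Re := complex.Re.
Local Notation Im := complex.Im.

(** Evaluation at z is the inner product with the vector e_z = (1/(z - gamma_n)^* )_n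
    of l^2_v, so an orthogonal basis of kernels is a total orthogonal family of such
    vectors; by Bessel and Riesz-Fischer this is also what unitarity of the discrete
    Hilbert transform means.

    (1) For z, w in Lambda, the vector e_z (z - gamma)/(w - gamma) has the modulus of
    e_w and is orthogonal to all kernels but the one at w, hence is a unimodular
    multiple of e_w. This makes the argument of (z - gamma_n)/(w - gamma_n) constant
    modulo pi, which puts Gamma on a line or a circle.

    (2), (3) Both cases rest on an identity
      kap(z, w) <e_z, e_w> = phi(w) - phi(z)^*
    with kap(z, w) affine in w and vanishing for z = w exactly on the curve. Hence
    kernels at points of the curve are orthogonal if and only if phi takes the same
    real value there. If the kernels of Lambda(alpha) form a basis, Parseval's
    identity for e_z and e_u is the difference of the atomic representation of
    (alpha - phi)^-1 at the two points. Conversely, letting z approach an atom of the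
    representing measure from inside the domain shows that the atom lies in
    Lambda(alpha) and that its mass is at most the weight w there. The representation
    then turns Bessel's inequality for e_z into an equality, for every z in the domain,
    and these e_z are total. *)

(** One kind of sum, [transform], serves twice: over Gamma with masses v it is phi, and over the
    atoms of the representing measure it is the integral in the Herglotz representation. The
    imaginary part of the representation therefore compares two positive sums, the square norm of
    e_z and the masses of the atoms seen from z. The behaviour at an atom t of mass m follows from
    this comparison. At distance y from t, the single term m / y^2 forces phi(z) to within 2 y / m
    of alpha, and it keeps the square norm of e_z below 4 / ((2 - y)^2 m), which tends to 1 / m. A
    point of Gamma at t would make that norm blow up; away from Gamma, finite partial sums pass to
    the limit and give the bound 1 / m for the norm of e_t. Limits occur only as inequalities valid
    for all small y or e, and series are handled through finite sets with small tails. The sums may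
    run over uncountable parameter sets; countability is then deduced from Bessel's inequality or
    from integrability. *)

Section ComplexModulus.
Variable R : realType.
Implicit Types (z w : R[i]) (x : R).

Lemma cabs_ge0 z : 0 <= cabs z.
Proof. by case: z => a b /=; exact: sqrtr_ge0. Qed.

Lemma cabs_sqr z : cabs z ^+ 2 = Re z ^+ 2 + Im z ^+ 2.
Proof. by case: z => a b /=; rewrite sqr_sqrtr// addr_ge0// sqr_ge0. Qed.

Lemma mulcJ z : z * conjc z = (cabs z ^+ 2)%:C.
Proof. by rewrite cabs_sqr; case: z => a b; simpc; congr (_ +i* _); ring. Qed.

Lemma mulJc z : conjc z * z = (cabs z ^+ 2)%:C.
Proof. by rewrite mulrC mulcJ. Qed.

Lemma cabsM z w : cabs (z * w) = cabs z * cabs w.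
Proof. exact: ComplexField.Normc.normcM. Qed.

Lemma cabsV z : cabs z^-1 = (cabs z)^-1.
Proof. exact: ComplexField.Normc.normcV. Qed.

Lemma cabs_div z w : cabs (z / w) = cabs z / cabs w.
Proof. by rewrite cabsM cabsV. Qed.

Lemma cabsN z : cabs (- z) = cabs z.
Proof. exact: normcN. Qed.

Lemma cabsB z w : cabs (z - w) = cabs (w - z).
Proof. by rewrite -cabsN opprB. Qed.

Lemma cabsJ z : cabs (conjc z) = cabs z.
Proof. by case: z => a b /=; rewrite sqrrN. Qed.

Lemma conjcM z w : conjc (z * w) = conjc z * conjc w.
Proof. exact: rmorphM. Qed.
Lemma conjcD z w : conjc (z + w) = conjc z + conjc w.
Proof. exact: rmorphD. Qed.
Lemma conjcB z w : conjc (z - w) = conjc z - conjc w.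
Proof. exact: rmorphB. Qed.
Lemma conjcV z : conjc z^-1 = (conjc z)^-1.
Proof. exact: fmorphV. Qed.

Lemma real_complexM (x y : R) : (x * y)%:C = x%:C * y%:C.
Proof. exact: rmorphM. Qed.
Lemma real_complexD (x y : R) : (x + y)%:C = x%:C + y%:C.
Proof. exact: rmorphD. Qed.
Lemma real_complexB (x y : R) : (x - y)%:C = x%:C - y%:C.
Proof. exact: rmorphB. Qed.
Lemma real_complexV (x : R) : (x^-1)%:C = (x%:C)^-1.
Proof. exact: fmorphV. Qed.
Lemma real_complexX (x : R) n : (x ^+ n)%:C = x%:C ^+ n.
Proof. exact: rmorphXn. Qed.
Lemma real_complex_nat n : (n%:R : R)%:C = n%:R.
Proof. exact: rmorph_nat. Qed.
Lemma real_complex_eq0 (x : R) : (x%:C == 0) = (x == 0).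
Proof. by rewrite -[0]/(0%:C) (inj_eq (@complexI R)). Qed.

Lemma cabs0 : cabs (0 : R[i]) = 0.
Proof. exact: ComplexField.Normc.normc0. Qed.

Lemma cabs_eq0 z : (cabs z == 0) = (z == 0).
Proof.
by apply/eqP/eqP => [/ComplexField.Normc.eq0_normc //|->]; exact: cabs0.
Qed.

Lemma cabs_gt0 z : (0 < cabs z) = (z != 0).
Proof. by rewrite lt0r cabs_eq0 cabs_ge0 andbT. Qed.

Lemma cabs_real x : cabs x%:C = `|x|.
Proof. by rewrite /= expr0n /= addr0 sqrtr_sqr. Qed.

Lemma cabs_nneg x : 0 <= x -> cabs x%:C = x.
Proof. by rewrite cabs_real => /ger0_norm. Qed.

Lemma le_cabsD z w : cabs (z + w) <= cabs z + cabs w.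
Proof. exact: le_normcD. Qed.

Lemma le_cabs_dist z w t : cabs (z - w) <= cabs (z - t) + cabs (t - w).
Proof. by rewrite (_ : z - w = (z - t) + (t - w)) ?le_cabsD//; ring. Qed.

Lemma le_Re_cabs z : `|Re z| <= cabs z.
Proof.
rewrite -(@ler_pXn2r _ 2)// ?nnegrE ?normr_ge0 ?cabs_ge0//.
by rewrite cabs_sqr real_normK ?num_real// lerDl sqr_ge0.
Qed.

Lemma le_Im_cabs z : `|Im z| <= cabs z.
Proof.
rewrite -(@ler_pXn2r _ 2)// ?nnegrE ?normr_ge0 ?cabs_ge0//.
by rewrite cabs_sqr real_normK ?num_real// lerDr sqr_ge0.
Qed.

Lemma cabs_sqrD z w : cabs (z + w) ^+ 2 <= 2 * cabs z ^+ 2 + 2 * cabs w ^+ 2.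
Proof.
rewrite (@le_trans _ _ ((cabs z + cabs w) ^+ 2))//.
  by rewrite lerXn2r ?nnegrE ?cabs_ge0 ?addr_ge0 ?cabs_ge0 ?le_cabsD.
by rewrite -subr_ge0 (_ : _ - _ = (cabs z - cabs w) ^+ 2) ?sqr_ge0//; ring.
Qed.

Lemma eq_complexP z w : Re z = Re w -> Im z = Im w -> z = w.
Proof. by case: z w => a b [c d] /= -> ->. Qed.

Lemma ReD z w : Re (z + w) = Re z + Re w. Proof. by case: z w => ? ? []. Qed.
Lemma ImD z w : Im (z + w) = Im z + Im w. Proof. by case: z w => ? ? []. Qed.
Lemma ReM z w : Re (z * w) = Re z * Re w - Im z * Im w.
Proof. by case: z w => ? ? []. Qed.
Lemma ImM z w : Im (z * w) = Re z * Im w + Im z * Re w.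
Proof. by case: z w => ? ? []. Qed.
Lemma ReN z : Re (- z) = - Re z. Proof. by case: z. Qed.
Lemma ImN z : Im (- z) = - Im z. Proof. by case: z. Qed.
Lemma ReJ z : Re (conjc z) = Re z. Proof. by case: z. Qed.
Lemma ImJ z : Im (conjc z) = - Im z. Proof. by case: z. Qed.

Lemma real_complexP z : Im z = 0 -> z = (Re z)%:C.
Proof. by case: z => a b /= ->. Qed.

Lemma conj_id_real z : conjc z = z -> Im z = 0.
Proof. by case: z => a b [/eqP]; rewrite eq_sym -subr_eq0 opprK -mulr2n mulrn_eq0 => /eqP. Qed.

Lemma Re_realM x z : Re (x%:C * z) = x * Re z.
Proof. by rewrite ReM /= mul0r subr0. Qed.
Lemma Im_realM x z : Im (x%:C * z) = x * Im z.
Proof. by rewrite ImM /= mul0r addr0. Qed.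

End ComplexModulus.

(** * Absolutely convergent real and complex sums *)

Section Sums.
Variables (R : realType) (T : choiceType).
Implicit Types (S : set T) (f g : T -> R) (F G : T -> R[i]).

(** [fine] sends a divergent sum to 0, so [nnsummable] has to accompany any estimate from above of a
    larger sum. *)
Definition nnsum S f : R := fine (\esum_(t in S) (f t)%:E).

Definition nnsummable S f : Prop := (\esum_(t in S) (f t)%:E < +oo)%E.

Lemma nnsumE S f : (forall t, S t -> 0 <= f t) -> nnsummable S f ->
  (\esum_(t in S) (f t)%:E = (nnsum S f)%:E)%E.
Proof.
move=> f0 sf; rewrite fineK// ge0_fin_numE//.
by apply: esum_ge0 => t St; rewrite lee_fin f0.
Qed.

Lemma nnsum_ge0 S f : (forall t, S t -> 0 <= f t) -> 0 <= nnsum S f.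
Proof. by move=> f0; apply/fine_ge0/esum_ge0 => t St; rewrite lee_fin f0. Qed.

Lemma eq_nnsum S f g : (forall t, S t -> f t = g t) -> nnsum S f = nnsum S g.
Proof. by move=> fg; congr fine; apply: eq_esum => t /fg ->. Qed.

Lemma eq_nnsummable S f g : (forall t, S t -> f t = g t) ->
  nnsummable S f -> nnsummable S g.
Proof.
by move=> fg; rewrite /nnsummable; under eq_esum do [rewrite fg//].
Qed.

Lemma le_nnsummable S f g : (forall t, S t -> f t <= g t) ->
  nnsummable S g -> nnsummable S f.
Proof.
by move=> fg; apply: le_lt_trans; apply: le_esum => t St; rewrite lee_fin fg.
Qed.

Lemma le_nnsum S f g : (forall t, S t -> 0 <= f t <= g t) ->
  nnsummable S g -> nnsum S f <= nnsum S g.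
Proof.
move=> fg sg; have fg1 t : S t -> f t <= g t by move=> /fg /andP[].
have f0 t : S t -> 0 <= f t by move=> /fg /andP[].
have g0 t : S t -> 0 <= g t by move=> St; rewrite (le_trans (f0 t St)) ?fg1.
rewrite -lee_fin -!nnsumE//; last exact: le_nnsummable sg.
by apply: le_esum => t St; rewrite lee_fin fg1.
Qed.

Lemma nnsummableD S f g : (forall t, S t -> 0 <= f t) ->
  (forall t, S t -> 0 <= g t) -> nnsummable S f -> nnsummable S g ->
  nnsummable S (fun t => f t + g t).
Proof.
move=> f0 g0 sf sg; rewrite /nnsummable; under eq_esum do rewrite EFinD.
by rewrite esumD ?lte_add_pinfty// => t St; rewrite lee_fin ?f0 ?g0.
Qed.

Lemma nnsumD S f g : (forall t, S t -> 0 <= f t) ->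
  (forall t, S t -> 0 <= g t) -> nnsummable S f -> nnsummable S g ->
  nnsum S (fun t => f t + g t) = nnsum S f + nnsum S g.
Proof.
move=> f0 g0 sf sg; apply: EFin_inj; rewrite EFinD -!nnsumE//.
- under eq_esum do rewrite EFinD.
  by rewrite esumD// => t St; rewrite lee_fin ?f0 ?g0.
- by move=> t St; rewrite addr_ge0 ?f0 ?g0.
- exact: nnsummableD.
Qed.

Lemma nnsummable_bound S f M :
  (forall A : set T, finite_set A -> A `<=` S -> \sum_(t \in A) f t <= M) ->
  (\esum_(t in S) (f t)%:E <= M%:E)%E.
Proof.
move=> h; apply: ge_ereal_sup => _ [A [finA AS] <-].
by rewrite fsumEFin// lee_fin h.
Qed.

Lemma nnsum_fin S f (A : set T) : (forall t, S t -> 0 <= f t) ->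
  nnsummable S f -> finite_set A -> A `<=` S -> \sum_(t \in A) f t <= nnsum S f.
Proof.
move=> f0 sf fA AS; rewrite -lee_fin -nnsumE// -fsumEFin//.
by apply: ereal_sup_ubound; exists A.
Qed.

Lemma nnsummableZ S f k : 0 <= k -> (forall t, S t -> 0 <= f t) ->
  nnsummable S f -> nnsummable S (fun t => k * f t).
Proof.
move=> k0 f0 sf; apply: (@le_lt_trans _ _ (k * nnsum S f)%:E); last exact: ltry.
apply: nnsummable_bound => A fA AS; rewrite -mulr_fsumr ler_wpM2l//.
exact: nnsum_fin.
Qed.

Lemma nnsum_le S f M : (forall t, S t -> 0 <= f t) ->
  (forall A : set T, finite_set A -> A `<=` S -> \sum_(t \in A) f t <= M) ->
  nnsum S f <= M.
Proof.
move=> f0 /nnsummable_bound h; rewrite -lee_fin -nnsumE//.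
by apply: le_lt_trans h _; exact: ltry.
Qed.

Lemma nnsumZ S f k : 0 <= k -> (forall t, S t -> 0 <= f t) ->
  nnsummable S f -> nnsum S (fun t => k * f t) = k * nnsum S f.
Proof.
move=> k0 f0 sf; apply/eqP; rewrite eq_le; apply/andP; split.
  apply: nnsum_le => [t St|A fA AS]; first by rewrite mulr_ge0 ?f0.
  by rewrite -mulr_fsumr ler_wpM2l//; exact: nnsum_fin.
have [->|kn0] := eqVneq k 0.
  by rewrite mul0r; apply: nnsum_ge0 => t _; rewrite mul0r.
have kp : 0 < k by rewrite lt_neqAle eq_sym kn0.
rewrite -ler_pdivlMl//; apply: nnsum_le => // A fA AS.
rewrite ler_pdivlMl// mulr_fsumr; apply: nnsum_fin => //.
- by move=> t St; rewrite mulr_ge0 ?f0.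
- exact: nnsummableZ.
Qed.

Lemma nnsummable_sub S S' f : S' `<=` S -> (forall t, S t -> 0 <= f t) ->
  nnsummable S f -> nnsummable S' f.
Proof.
move=> SS f0 sf; apply: (@le_lt_trans _ _ (nnsum S f)%:E); last exact: ltry.
by apply: nnsummable_bound => A fA AS; apply: nnsum_fin => // t /AS /SS.
Qed.

(** A finite set [A] whose partial sum comes within [e] of the supremum leaves at most [e] for any
    finite set disjoint from it. Later arguments use this in place of convergence of partial
    sums. *)
Lemma nnsum_tail S f e : (forall t, S t -> 0 <= f t) -> nnsummable S f ->
  0 < e -> exists A : set T, [/\ finite_set A, A `<=` S &
    nnsum (S `\` A) f <= e].
Proof.
move=> f0 sf e0.
have : ((nnsum S f - e)%:E < \esum_(t in S) (f t)%:E)%E.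
  by rewrite nnsumE// lte_fin gtrBl.
move=> /ereal_sup_gt[_ [A [fA AS] <-]]; rewrite fsumEFin// lte_fin => hA.
exists A; split => //; apply: nnsum_le => [t [/f0]//|B fB BS].
rewrite -(lerD2l (\sum_(t \in A) f t)) -fsbigU//=; last first.
  by move=> t [At /BS[]].
apply: (@le_trans _ _ (nnsum S f)); last by rewrite -lerBlDr ltW.
by apply: nnsum_fin => //; [rewrite finite_setU|move=> t [/AS//|/BS[]]].
Qed.

Lemma nnsumID S S' f : (forall t, S t -> 0 <= f t) -> nnsummable S f ->
  nnsum S f = nnsum (S `&` S') f + nnsum (S `\` S') f.
Proof.
move=> f0 sf; apply: EFin_inj; rewrite EFinD -!nnsumE//.
- by rewrite (esumID S')// => t St; rewrite lee_fin f0.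
- by move=> t [/f0].
- by apply: nnsummable_sub sf => // t [].
- by move=> t [/f0].
- by apply: nnsummable_sub sf => // t [].
Qed.

Lemma nnsum_term S f t : (forall t, S t -> 0 <= f t) -> nnsummable S f ->
  S t -> f t <= nnsum S f.
Proof.
move=> f0 sf St; rewrite -(fsbig_set1 (+%R) t f); apply: nnsum_fin => //.
by move=> ? ->.
Qed.

Lemma nnsum_fset (A : set T) f : finite_set A -> (forall t, A t -> 0 <= f t) ->
  nnsum A f = \sum_(t <- fset_set A) f t.
Proof.
move=> fA f0; rewrite /nnsum esum_fset//.
  by rewrite fsumEFin// fsbig_finite.
by move=> t; rewrite inE => At; rewrite lee_fin f0.
Qed.

Lemma nnsummable_fset (A : set T) f : finite_set A ->
  (forall t, A t -> 0 <= f t) -> nnsummable A f.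
Proof.
move=> fA f0; rewrite /nnsummable esum_fset//.
  by rewrite fsumEFin// ltry.
by move=> t; rewrite inE => At; rewrite lee_fin f0.
Qed.

Lemma eq_rsum S f g : (forall t, S t -> f t = g t) -> rsum S f = rsum S g.
Proof.
move=> fg; rewrite /rsum; congr (fine (_ - _)%E); apply: eq_esum => t St.
  by rewrite !funeposE /= fg.
by rewrite !funenegE /= fg.
Qed.

Lemma rsumB S f g : (forall t, S t -> 0 <= f t) ->
  (forall t, S t -> 0 <= g t) -> nnsummable S f -> nnsummable S g ->
  rsum S (fun t => f t - g t) = nnsum S f - nnsum S g.
Proof.
move=> f0 g0 sf sg.
have sabs h : (forall t, S t -> 0 <= h t) -> nnsummable S h ->
    summable S (EFin \o h).
  move=> h0; apply: le_lt_trans; apply: le_esum => t St /=.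
  by rewrite ger0_norm ?h0.
have := @esumB R T S (EFin \o f) (EFin \o g) (sabs _ f0 sf) (sabs _ g0 sg).
by rewrite /rsum => ->; rewrite /= ?nnsumE.
Qed.

Lemma nnsum0 S : nnsum S (fun=> 0) = 0.
Proof. by rewrite /nnsum esum1. Qed.

Lemma nnsummable0 S : nnsummable S (fun=> 0).
Proof. by rewrite /nnsummable esum1. Qed.

Lemma rsum_nnsum S f : (forall t, S t -> 0 <= f t) -> nnsummable S f ->
  rsum S f = nnsum S f.
Proof.
move=> f0 sf.
have := @rsumB S f (fun=> 0) f0 (fun _ _ => lexx _) sf (nnsummable0 S).
by rewrite nnsum0 subr0 => <-; apply: eq_rsum => t _; rewrite subr0.
Qed.

Definition rsummable S f : Prop := nnsummable S (fun t => `|f t|).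

Definition pospart f t := Num.max (f t) 0.
Definition negpart f t := Num.max (- f t) 0.

Lemma pospart_ge0 f t : 0 <= pospart f t.
Proof. by rewrite /pospart le_max lexx orbT. Qed.
Lemma negpart_ge0 f t : 0 <= negpart f t.
Proof. by rewrite /negpart le_max lexx orbT. Qed.
Lemma pospartB f t : f t = pospart f t - negpart f t.
Proof. by rewrite /pospart /negpart; case: (leP (f t)) => h;
  case: (leP (- f t)) => h'; lra. Qed.
Lemma pospart_le f t : pospart f t <= `|f t|.
Proof. by rewrite /pospart ge_max ler_norm normr_ge0. Qed.
Lemma negpart_le f t : negpart f t <= `|f t|.
Proof. by rewrite /negpart ge_max -normrN ler_norm normr_ge0. Qed.

Lemma summable_pospart S f : rsummable S f -> nnsummable S (pospart f).
Proof. by apply: le_nnsummable => t _; exact: pospart_le. Qed.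

Lemma summable_negpart S f : rsummable S f -> nnsummable S (negpart f).
Proof. by apply: le_nnsummable => t _; exact: negpart_le. Qed.

Lemma rsum_posneg S f : rsummable S f ->
  rsum S f = nnsum S (pospart f) - nnsum S (negpart f).
Proof.
move=> sf; rewrite -rsumB//.
- by apply: eq_rsum => t _; exact: pospartB.
- by move=> *; exact: pospart_ge0.
- by move=> *; exact: negpart_ge0.
- exact: summable_pospart.
- exact: summable_negpart.
Qed.

Lemma rsummableN S f : rsummable S f -> rsummable S (fun t => - f t).
Proof. by apply: eq_nnsummable => t _; rewrite normrN. Qed.

Lemma rsummableZ S k f : rsummable S f -> rsummable S (fun t => k * f t).
Proof.
move=> /(@nnsummableZ _ _ `|k|) => h.
by apply: eq_nnsummable (h _ _) => // t _; rewrite normrM.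
Qed.

(** Negation exchanges the two parts. If one of them is infinite, both differences are infinite and
    [fine] makes both sides 0, so the identity survives divergence; hence so do those for negation
    and conjugation of [csum]. *)
Lemma rsumN S f : rsum S (fun t => - f t) = - rsum S f.
Proof.
have posN : ((fun t => (- f t)%:E) ^\+)%E = ((EFin \o f)^\-)%E.
  by apply/funext => t; rewrite funeposE funenegE.
have negN : ((fun t => (- f t)%:E) ^\-)%E = ((EFin \o f)^\+)%E.
  by apply/funext => t; rewrite funeposE funenegE /= opprK.
rewrite /rsum; have -> : EFin \o (fun t => - f t) = fun t => (- f t)%:E by [].
rewrite posN negN.
set a := \esum_(_ in S) _; set b := \esum_(_ in S) _.
have : (0 <= a)%E by apply: esum_ge0.
have : (0 <= b)%E by apply: esum_ge0.
by case: a => [a| |]; case: b => [b| |] //= _ _; rewrite ?opprB ?oppr0.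
Qed.

Lemma rsumD S f g : rsummable S f -> rsummable S g ->
  rsum S (fun t => f t + g t) = rsum S f + rsum S g.
Proof.
move=> sf sg; rewrite (rsum_posneg sf) (rsum_posneg sg).
have [pf nf] := (summable_pospart sf, summable_negpart sf).
have [pg ng] := (summable_pospart sg, summable_negpart sg).
have p0 h t : S t -> 0 <= pospart h t by move=> _; exact: pospart_ge0.
have n0 h t : S t -> 0 <= negpart h t by move=> _; exact: negpart_ge0.
rewrite addrACA -opprD -(nnsumD (p0 f) (p0 g) pf pg).
rewrite -(nnsumD (n0 f) (n0 g) nf ng) -rsumB.
- by apply: eq_rsum => t _; rewrite [f t]pospartB [g t]pospartB; ring.
- by move=> t St; rewrite addr_ge0 ?p0.
- by move=> t St; rewrite addr_ge0 ?n0.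
- by apply: nnsummableD => //; exact: p0.
- by apply: nnsummableD => //; exact: n0.
Qed.

Lemma le_norm_rsum S f : rsummable S f -> `|rsum S f| <= nnsum S (fun t => `|f t|).
Proof.
move=> sf; rewrite rsum_posneg//.
have h1 : nnsum S (pospart f) <= nnsum S (fun t => `|f t|).
  by apply: le_nnsum => // t _; rewrite pospart_ge0 pospart_le.
have h2 : nnsum S (negpart f) <= nnsum S (fun t => `|f t|).
  by apply: le_nnsum => // t _; rewrite negpart_ge0 negpart_le.
have p0 : 0 <= nnsum S (pospart f) by apply: nnsum_ge0 => *; exact: pospart_ge0.
have n0 : 0 <= nnsum S (negpart f) by apply: nnsum_ge0 => *; exact: negpart_ge0.
by rewrite ler_norml; lra.
Qed.

Lemma rsumZ_ge0 S k f : 0 <= k -> rsummable S f ->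
  rsum S (fun t => k * f t) = k * rsum S f.
Proof.
move=> k0 sf; rewrite (rsum_posneg sf) mulrBr.
have [pf nf] := (summable_pospart sf, summable_negpart sf).
have p0 t : S t -> 0 <= pospart f t by move=> _; exact: pospart_ge0.
have n0 t : S t -> 0 <= negpart f t by move=> _; exact: negpart_ge0.
rewrite -(nnsumZ k0 p0 pf) -(nnsumZ k0 n0 nf) -rsumB.
- by apply: eq_rsum => t _; rewrite [f t]pospartB mulrBr.
- by move=> t St; rewrite mulr_ge0 ?p0.
- by move=> t St; rewrite mulr_ge0 ?n0.
- exact: nnsummableZ.
- exact: nnsummableZ.
Qed.

Lemma rsumZ S k f : rsummable S f -> rsum S (fun t => k * f t) = k * rsum S f.
Proof.
move=> sf; have [k0|/ltW k0] := leP 0 k; first exact: rsumZ_ge0.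
rewrite -[LHS]opprK -rsumN -[k in RHS]opprK mulNr; congr (- _).
rewrite -rsumZ_ge0 ?oppr_ge0//.
by apply: eq_rsum => t _; rewrite mulNr.
Qed.

Definition csummable S F : Prop := nnsummable S (fun t => cabs (F t)).

Lemma csummable_Re S F : csummable S F -> rsummable S (fun t => Re (F t)).
Proof. by apply: le_nnsummable => t _; exact: le_Re_cabs. Qed.

Lemma csummable_Im S F : csummable S F -> rsummable S (fun t => Im (F t)).
Proof. by apply: le_nnsummable => t _; exact: le_Im_cabs. Qed.

Lemma eq_csum S F G : (forall t, S t -> F t = G t) -> csum S F = csum S G.
Proof. by move=> FG; congr (_ +i* _); apply: eq_rsum => t /FG ->. Qed.

Lemma le_csummable S F g : (forall t, S t -> cabs (F t) <= g t) ->
  nnsummable S g -> csummable S F.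
Proof. exact: le_nnsummable. Qed.

Lemma eq_csummable S F G : (forall t, S t -> F t = G t) ->
  csummable S F -> csummable S G.
Proof. by move=> FG; apply: eq_nnsummable => t /FG ->. Qed.

Lemma csummableD S F G : csummable S F -> csummable S G ->
  csummable S (fun t => F t + G t).
Proof.
move=> sf sg; apply: le_nnsummable (nnsummableD _ _ sf sg) => t _.
- exact: le_cabsD.
- exact: cabs_ge0.
- exact: cabs_ge0.
Qed.

Lemma csummableZ S k F : csummable S F -> csummable S (fun t => k * F t).
Proof.
move=> sF; apply: eq_nnsummable (nnsummableZ (cabs_ge0 k) _ sF) => [t _|t _].
  by rewrite cabsM.
exact: cabs_ge0.
Qed.

Lemma csummableN S F : csummable S F -> csummable S (fun t => - F t).
Proof. by apply: eq_nnsummable => t _; rewrite cabsN. Qed.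

Lemma csummableJ S F : csummable S F -> csummable S (fun t => conjc (F t)).
Proof. by apply: eq_nnsummable => t _; rewrite cabsJ. Qed.

Lemma csumD S F G : csummable S F -> csummable S G ->
  csum S (fun t => F t + G t) = csum S F + csum S G.
Proof.
move=> sF sG; apply: eq_complexP; rewrite ?ReD ?ImD /=.
  rewrite -(rsumD (csummable_Re sF) (csummable_Re sG)).
  by apply: eq_rsum => t _; rewrite ReD.
rewrite -(rsumD (csummable_Im sF) (csummable_Im sG)).
by apply: eq_rsum => t _; rewrite ImD.
Qed.

Lemma csumN S F : csum S (fun t => - F t) = - csum S F.
Proof.
apply: eq_complexP; rewrite ?ReN ?ImN /= -rsumN;
  by apply: eq_rsum => t _; rewrite ?ReN ?ImN.
Qed.

Lemma csumB S F G : csummable S F -> csummable S G ->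
  csum S (fun t => F t - G t) = csum S F - csum S G.
Proof. by move=> sF sG; rewrite csumD ?csumN//; exact: csummableN. Qed.

Lemma csumJ S F : csum S (fun t => conjc (F t)) = conjc (csum S F).
Proof.
apply: eq_complexP; rewrite ?ReJ ?ImJ /= -?rsumN;
  by apply: eq_rsum => t _; rewrite ?ReJ ?ImJ.
Qed.

Lemma csumZ S k F : csummable S F -> csum S (fun t => k * F t) = k * csum S F.
Proof.
move=> sF; have sR := csummable_Re sF; have sI := csummable_Im sF.
apply: eq_complexP; rewrite ?ReM ?ImM /=.
  rewrite -(rsumZ _ sR) -(rsumZ _ sI) -rsumN.
  rewrite -(rsumD (rsummableZ _ sR) (rsummableN (rsummableZ _ sI))).
  by apply: eq_rsum => t _; rewrite ReM.
rewrite -(rsumZ _ sR) -(rsumZ _ sI).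
rewrite -(rsumD (rsummableZ _ sI) (rsummableZ _ sR)).
by apply: eq_rsum => t _; rewrite ImM.
Qed.

Lemma csumZr S k F : csummable S F -> csum S (fun t => F t * k) = csum S F * k.
Proof.
by move=> sF; rewrite mulrC -csumZ//; apply: eq_csum => t _; rewrite mulrC.
Qed.

Lemma csum0 S : csum S (fun=> 0 : R[i]) = 0.
Proof.
rewrite /csum /= rsum_nnsum//; first by rewrite nnsum0.
exact: nnsummable0.
Qed.

Lemma csummable0 S : csummable S (fun=> 0).
Proof. by apply: eq_nnsummable (nnsummable0 S) => t _; rewrite cabs0. Qed.

Lemma csum_real S f : csum S (fun t => (f t)%:C) = (rsum S f)%:C.
Proof.
congr (_ +i* _) => /=; rewrite rsum_nnsum//; first by rewrite nnsum0.
exact: nnsummable0.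
Qed.

Lemma csum_nneg S f : (forall t, S t -> 0 <= f t) -> nnsummable S f ->
  csum S (fun t => (f t)%:C) = (nnsum S f)%:C.
Proof. by move=> f0 sf; rewrite csum_real rsum_nnsum. Qed.

(* Rotating the sum onto the positive half-line reduces to the real case. *)
Lemma le_cabs_csum S F : csummable S F ->
  cabs (csum S F) <= nnsum S (fun t => cabs (F t)).
Proof.
move=> sF; have [->|s0] := eqVneq (csum S F) 0.
  by rewrite cabs0; apply: nnsum_ge0 => *; exact: cabs_ge0.
set s := csum S F; have as0 : cabs s != 0 by rewrite cabs_eq0.
pose u := conjc s / (cabs s)%:C.
have u1 : cabs u = 1.
  by rewrite cabs_div cabsJ cabs_nneg ?cabs_ge0// divff.
have us : u * s = (cabs s)%:C.
  rewrite /u mulrAC mulJc expr2 rmorphM /= mulfK//.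
  by rewrite -[0]/(0%:C) (inj_eq (@complexI R)).
have -> : cabs s = rsum S (fun t => Re (u * F t)).
  by transitivity (Re (csum S (fun t => u * F t))) => //; rewrite csumZ// us.
apply: le_trans (ler_norm _) _.
have suF : csummable S (fun t => u * F t) by exact: csummableZ.
apply: le_trans (le_norm_rsum (csummable_Re suF)) _.
apply: le_nnsum sF => t _; rewrite normr_ge0/=.
by rewrite (le_trans (le_Re_cabs _))// cabsM u1 mul1r.
Qed.

Lemma csummable_sum S (A : eqType) (r : seq A) (F : A -> T -> R[i]) :
  (forall i, i \in r -> csummable S (F i)) ->
  csummable S (fun t => \sum_(i <- r) F i t).
Proof.
elim: r => [|i r IH] h.
  by apply: eq_csummable (csummable0 S) => t _; rewrite big_nil.
apply: (@eq_csummable S (fun t => F i t + \sum_(i <- r) F i t)).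
  by move=> t _; rewrite big_cons.
apply: csummableD; first by apply: h; rewrite mem_head.
by apply: IH => j jr; apply: h; rewrite in_cons jr orbT.
Qed.

Lemma csum_sum S (A : eqType) (r : seq A) (F : A -> T -> R[i]) :
  (forall i, i \in r -> csummable S (F i)) ->
  csum S (fun t => \sum_(i <- r) F i t) = \sum_(i <- r) csum S (F i).
Proof.
elim: r => [|i r IH] h.
  by rewrite big_nil -[RHS](csum0 S); apply: eq_csum => t _; rewrite big_nil.
have hr j : j \in r -> csummable S (F j).
  by move=> jr; apply: h; rewrite in_cons jr orbT.
rewrite big_cons -IH// -csumD.
- by apply: eq_csum => t _; rewrite big_cons.
- by apply: h; rewrite mem_head.
- exact: csummable_sum.
Qed.

Lemma nnsum_restrict S S' f : (forall t, S t -> 0 <= f t) ->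
  S' `<=` S -> (forall t, S t -> ~ S' t -> f t = 0) ->
  (\esum_(t in S) (f t)%:E = \esum_(t in S') (f t)%:E)%E.
Proof.
move=> f0 SS h; rewrite (esumID S')//.
rewrite [X in (_ + X)%E]esum1 ?adde0; last by move=> t [St /(h t St) ->].
by rewrite (setIidr SS).
Qed.

Lemma csum_restrict S S' F : S' `<=` S -> (forall t, S t -> ~ S' t -> F t = 0) ->
  csum S F = csum S' F.
Proof.
move=> SS h.
have rs f : (forall t, S t -> ~ S' t -> f t = 0) -> rsum S f = rsum S' f.
  move=> fh; rewrite /rsum; congr (fine (_ - _)%E).
    have E : (EFin \o f)^\+%E = fun t => (pospart f t)%:E.
      by apply/funext => t; rewrite funeposE /pospart EFin_max.
    rewrite E; apply: nnsum_restrict => // [t St|t St S't].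
      exact: pospart_ge0.
    by rewrite /pospart fh// maxxx.
  have E : (EFin \o f)^\-%E = fun t => (negpart f t)%:E.
    by apply/funext => t; rewrite funenegE /negpart EFin_max EFinN.
  rewrite E; apply: nnsum_restrict => // [t St|t St S't].
    exact: negpart_ge0.
  by rewrite /negpart fh// oppr0 maxxx.
by congr (_ +i* _); apply: rs => t St S't; rewrite h.
Qed.

Lemma csum_set1 t F : csum [set t] F = F t.
Proof.
have rs f : rsum [set t] f = f t.
  by rewrite /rsum !esum_set1//; have /(congr1 (@^~ t)) /= <- := funeposneg (EFin \o f).
by apply: eq_complexP; rewrite /= rs.
Qed.

Lemma csum_single S t F : S t -> (forall s, S s -> s != t -> F s = 0) ->
  csum S F = F t.
Proof.
move=> St h; rewrite (@csum_restrict S [set t]) ?csum_set1//.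
  by move=> _ ->.
by move=> s Ss /eqP; exact: h.
Qed.

Lemma csummable_single S t F : (forall s, S s -> s != t -> F s = 0) ->
  csummable S F.
Proof.
move=> h; apply: (@le_lt_trans _ _ (cabs (F t))%:E); last exact: ltry.
apply: nnsummable_bound => A fA AS.
rewrite (_ : \sum_(x \in A) _ = \sum_(x \in A `&` [set t]) cabs (F x)).
  have [tA|tA] := pselect (A t).
    by rewrite (_ : A `&` _ = [set t]) ?fsbig_set1//; apply/seteqP; split=> [s []|s ->].
  rewrite (_ : A `&` _ = set0) ?fsbig_set0 ?cabs_ge0//.
  by apply/seteqP; split=> s // [] As st; apply: tA; rewrite -st.
apply/esym/fsbig_widen; first by move=> s [].
move=> s [As /= /not_andP []]// /eqP st; rewrite h ?cabs0//; exact: AS.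
Qed.

End Sums.

(** * Reindexing along injections *)

Section SumsReindex.
Variables (R : realType) (T T' : choiceType).

Lemma csum_image (P : set T) (e : T -> T') (F : T' -> R[i]) :
  set_inj P e -> csum (e @` P) F = csum P (F \o e).
Proof.
move=> einj; congr (_ +i* _); rewrite /rsum !esum_image//;
  by congr (fine (_ - _)%E); apply: eq_esum => t _;
    rewrite ?funeposE ?funenegE.
Qed.

Lemma nnsummable_image (P : set T) (e : T -> T') (f : T' -> R) :
  set_inj P e -> nnsummable (e @` P) f <-> nnsummable P (f \o e).
Proof. by move=> einj; rewrite /nnsummable esum_image. Qed.

End SumsReindex.

(** * Weighted l^2 spaces and the Cauchy-Schwarz inequality *)

Section WeightedL2.
Variables (R : realType) (T : choiceType) (S : set T) (u : T -> R).
Hypothesis u_ge0 : forall t, S t -> 0 <= u t.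
Implicit Types (a b c : T -> R[i]).

Definition normsq a : R := nnsum S (fun t => cabs (a t) ^+ 2 * u t).

Lemma normsq_term_ge0 a t : S t -> 0 <= cabs (a t) ^+ 2 * u t.
Proof. by move=> St; rewrite mulr_ge0 ?u_ge0 ?sqr_ge0. Qed.

Lemma normsq_ge0 a : 0 <= normsq a.
Proof. by apply: nnsum_ge0; exact: normsq_term_ge0. Qed.

Lemma l2norm2E a : l2 S u a -> l2norm2 S u a = (normsq a)%:E.
Proof. by move=> la; apply: nnsumE => //; exact: normsq_term_ge0. Qed.

Lemma eq_l2 a b : (forall t, S t -> a t = b t) -> l2 S u a -> l2 S u b.
Proof. by move=> ab; apply: eq_nnsummable => t /ab ->. Qed.

Lemma l2Z k a : l2 S u a -> l2 S u (fun t => k * a t).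
Proof.
move=> la; have := nnsummableZ (sqr_ge0 (cabs k)) (@normsq_term_ge0 a) la.
by apply: eq_nnsummable => t _; rewrite cabsM exprMn mulrA.
Qed.

Lemma l2D a b : l2 S u a -> l2 S u b -> l2 S u (fun t => a t + b t).
Proof.
move=> la lb.
have la2 := nnsummableZ (ler0n R 2) (@normsq_term_ge0 a) la.
have lb2 := nnsummableZ (ler0n R 2) (@normsq_term_ge0 b) lb.
apply: le_nnsummable (nnsummableD _ _ la2 lb2) => t St.
- by have := cabs_sqrD (a t) (b t); have := u_ge0 St; nra.
- by rewrite mulr_ge0// normsq_term_ge0.
- by rewrite mulr_ge0// normsq_term_ge0.
Qed.

Lemma l2N a : l2 S u a -> l2 S u (fun t => - a t).
Proof. by apply: eq_nnsummable => t _; rewrite cabsN. Qed.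

Lemma l2B a b : l2 S u a -> l2 S u b -> l2 S u (fun t => a t - b t).
Proof. by move=> la lb; apply: l2D la (l2N lb). Qed.

Lemma l2_0 : l2 S u (fun=> 0).
Proof.
by apply: eq_nnsummable (nnsummable0 R S) => t _; rewrite cabs0 expr0n mul0r.
Qed.

Lemma l2_single a t : (forall s, S s -> s != t -> a s = 0) -> l2 S u a.
Proof.
move=> h; have : csummable S (fun s => (cabs (a s) ^+ 2 * u s)%:C).
  apply: (@csummable_single _ _ _ t) => s Ss /(h s Ss) ->.
  by rewrite cabs0 expr0n mul0r.
by apply: eq_nnsummable => s Ss; rewrite cabs_nneg// normsq_term_ge0.
Qed.

Lemma l2_sum (A : eqType) (r : seq A) (F : A -> T -> R[i]) :
  (forall i, i \in r -> l2 S u (F i)) -> l2 S u (fun t => \sum_(i <- r) F i t).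
Proof.
elim: r => [|i r IH] h.
  by apply: eq_l2 l2_0 => t _; rewrite big_nil.
apply: (@eq_l2 (fun t => F i t + \sum_(i <- r) F i t)).
  by move=> t _; rewrite big_cons.
apply: l2D; first by apply: h; rewrite mem_head.
by apply: IH => j jr; apply: h; rewrite in_cons jr orbT.
Qed.

Lemma l2dot_summable a b : l2 S u a -> l2 S u b ->
  csummable S (fun t => a t * conjc (b t) * (u t)%:C).
Proof.
move=> la lb; apply: le_nnsummable (nnsummableD _ _ la lb) => t St;
  do ?exact: normsq_term_ge0.
rewrite !cabsM cabsJ cabs_nneg ?u_ge0// -mulrDl ler_wpM2r ?u_ge0//.
have := sqr_ge0 (cabs (a t) - cabs (b t)); have := cabs_ge0 (a t).
have := cabs_ge0 (b t); nra.
Qed.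

Lemma eq_l2dot a a' b b' : (forall t, S t -> a t = a' t) ->
  (forall t, S t -> b t = b' t) -> l2dot S u a b = l2dot S u a' b'.
Proof. by move=> aa bb; apply: eq_csum => t St; rewrite aa ?bb. Qed.

Lemma l2dotDl a b c : l2 S u a -> l2 S u b -> l2 S u c ->
  l2dot S u (fun t => a t + b t) c = l2dot S u a c + l2dot S u b c.
Proof.
move=> la lb lc.
rewrite /l2dot -(csumD (l2dot_summable la lc) (l2dot_summable lb lc)).
by apply: eq_csum => t _; rewrite !mulrDl.
Qed.

Lemma l2dotZl k a b : l2 S u a -> l2 S u b ->
  l2dot S u (fun t => k * a t) b = k * l2dot S u a b.
Proof.
move=> la lb; rewrite /l2dot -(csumZ _ (l2dot_summable la lb)).
by apply: eq_csum => t _; rewrite !mulrA.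
Qed.

Lemma l2dotNl a b : l2dot S u (fun t => - a t) b = - l2dot S u a b.
Proof. by rewrite /l2dot -csumN; apply: eq_csum => t _; rewrite !mulNr. Qed.

Lemma l2dotBl a b c : l2 S u a -> l2 S u b -> l2 S u c ->
  l2dot S u (fun t => a t - b t) c = l2dot S u a c - l2dot S u b c.
Proof. by move=> la lb lc; rewrite l2dotDl ?l2dotNl//; exact: l2N. Qed.

Lemma l2dotC a b : l2dot S u b a = conjc (l2dot S u a b).
Proof.
rewrite /l2dot -csumJ; apply: eq_csum => t _.
by rewrite !conjcM conjc_real conjcK; ring.
Qed.

Lemma l2dotBr a b c : l2 S u a -> l2 S u b -> l2 S u c ->
  l2dot S u c (fun t => a t - b t) = l2dot S u c a - l2dot S u c b.
Proof.
by move=> la lb lc; rewrite l2dotC l2dotBl// conjcB -!l2dotC.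
Qed.

Lemma l2dotZr k a b : l2 S u a -> l2 S u b ->
  l2dot S u b (fun t => k * a t) = conjc k * l2dot S u b a.
Proof. by move=> la lb; rewrite l2dotC l2dotZl// conjcM -l2dotC. Qed.

Lemma l2dot_sum (A : eqType) (r : seq A) (F : A -> T -> R[i]) b :
  (forall i, i \in r -> l2 S u (F i)) -> l2 S u b ->
  l2dot S u (fun t => \sum_(i <- r) F i t) b = \sum_(i <- r) l2dot S u (F i) b.
Proof.
move=> lF lb; rewrite /l2dot -csum_sum; last first.
  by move=> i /lF lFi; exact: l2dot_summable.
by apply: eq_csum => t _; rewrite !mulr_suml.
Qed.

Lemma l2dotE a : l2 S u a -> l2dot S u a a = (normsq a)%:C.
Proof.
move=> la; rewrite -(csum_nneg (@normsq_term_ge0 a) la).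
by apply: eq_csum => t _; rewrite mulcJ -real_complexM.
Qed.

Lemma cauchy_schwarz a b : l2 S u a -> l2 S u b ->
  cabs (l2dot S u a b) ^+ 2 <= normsq a * normsq b.
Proof.
move=> la lb; set d := l2dot S u a b.
set A := normsq a; set B := normsq b.
(* This is the square norm of a - s d b: the factor [d] makes both cross terms real. Its minimum, at
   s = 1 / B, is the claim. *)
have key (s : R) : 0 <= A - 2 * s * cabs d ^+ 2 + s ^+ 2 * cabs d ^+ 2 * B.
  pose k := s%:C * d.
  have lkb := l2Z k lb; have lc := l2B la lkb.
  have := normsq_ge0 (fun t => a t - k * b t).
  have : (normsq (fun t => a t - k * b t))%:C =
      (A - 2 * s * cabs d ^+ 2 + s ^+ 2 * cabs d ^+ 2 * B)%:C.
    rewrite -l2dotE// l2dotBl// !l2dotBr// !l2dotZl// !l2dotZr//.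
    rewrite !l2dotE// (l2dotC a b) -/d -/A -/B.
    have := mulcJ d; move: (cabs d ^+ 2) => q dq.
    rewrite real_complexD real_complexB !real_complexM -dq.
    by rewrite /k conjcM conjc_real real_complex_nat; ring.
  by move=> [->].
move: (cabs d ^+ 2) key => q key.
have [B0|B0] := eqVneq B 0.
  rewrite B0 mulr0 leNgt; apply/negP => q0.
  (* For B = 0 the expression is affine in s, and this value of s would make it equal to -1. *)
  have := key ((A + 1) / (2 * q)); rewrite B0 mulr0 addr0.
  rewrite (_ : 2 * _ * _ = A + 1); last by field; rewrite gt_eqF.
  by rewrite opprD addrA subrr sub0r oppr_ge0 leNgt ltr01.
have Bp : 0 < B by rewrite lt_neqAle eq_sym B0 normsq_ge0.
have := key B^-1.
rewrite (_ : _ + _ = A - q / B); last by field.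
by rewrite subr_ge0 ler_pdivrMr.
Qed.

End WeightedL2.

(** * Sums with finite support *)

Section FiniteSupport.
Variables (R : realType) (T : choiceType) (S : set T).

Lemma csum_finsupp (F : T -> R[i]) (A : set T) : finite_set A -> A `<=` S ->
  (forall t, S t -> ~ A t -> F t = 0) ->
  csum S F = \sum_(t <- fset_set A) F t.
Proof.
move=> fA AS h.
transitivity (csum S (fun t => \sum_(s <- fset_set A) if t == s then F s else 0)).
  apply: eq_csum => t St; have [At|At] := pselect (A t).
    rewrite (bigD1_seq t)/= ?fset_uniq ?in_fset_set ?mem_set//.
    rewrite eqxx big1_seq ?addr0// => s /andP[st _].
    by rewrite eq_sym (negbTE st).
  rewrite h// big1_seq// => s /andP[_]; rewrite in_fset_set// inE => As.
  by case: eqVneq => // ts; rewrite ts in At.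
have hs s : csummable S (fun t => if t == s then F s else 0).
  by apply: (@csummable_single _ _ _ s) => t _ /negbTE ->.
rewrite csum_sum//; apply: eq_big_seq => s; rewrite in_fset_set// inE => As.
rewrite (@csum_single _ _ _ s) ?eqxx//; first exact: AS.
by move=> t _ /negbTE ->.
Qed.

End FiniteSupport.

(** * Orthogonal families: Bessel, Riesz-Fischer, Parseval *)

Section OrthogonalFamily.
Variables (R : realType) (T T' : choiceType) (S : set T) (u : T -> R).
Variables (S' : set T') (e : T' -> T -> R[i]).
Hypothesis u_gt0 : forall t, S t -> 0 < u t.
Hypothesis le2 : forall j, S' j -> l2 S u (e j).
Hypothesis e_gt0 : forall j, S' j -> 0 < normsq S u (e j).
Implicit Types (a b c : T -> R[i]).

Let u_ge0 t : S t -> 0 <= u t. Proof. by move=> /u_gt0/ltW. Qed.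

Definition pairwise_orthogonal :=
  forall j k, S' j -> S' k -> j != k -> l2dot S u (e j) (e k) = 0.

Definition total_family :=
  forall a, l2 S u a -> (forall j, S' j -> l2dot S u a (e j) = 0) ->
  forall t, S t -> a t = 0.

Definition dense_family :=
  forall a, l2 S u a -> forall eps : R, 0 < eps ->
    exists (r : seq T') (c : T' -> R[i]), (forall j, j \in r -> S' j) /\
      normsq S u (fun t => a t - \sum_(j <- r) c j * e j t) < eps.

(** The vectors e_j are not normalised; this weight on the coefficients compensates. For kernel
    vectors it becomes the weight sequence w. *)
Definition wt j : R := (normsq S u (e j))^-1.
Definition coefs a (j : T') : R[i] := l2dot S u a (e j).

Lemma wt_gt0 j : S' j -> 0 < wt j.
Proof. by move=> Sj; rewrite invr_gt0 e_gt0. Qed.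

Let wt_ge0 j : S' j -> 0 <= wt j. Proof. by move=> /wt_gt0/ltW. Qed.

(** If a is orthogonal to the family and y is in its span, then |a|^2 = <a, a - y>, so
    Cauchy-Schwarz gives |a|^2 <= |a - y|^2, which can be made arbitrarily small. *)
Lemma dense_total : dense_family -> total_family.
Proof.
move=> de a la ha t St.
have N0 : normsq S u a <= 0.
  apply/ler_addgt0Pr => eps e0; rewrite add0r.
  have [r [c [rS lt_eps]]] := de a la eps e0.
  have lf j : j \in r -> l2 S u (fun t => c j * e j t).
    by move=> /rS Sj; apply: l2Z => //; exact: le2.
  have ly := l2_sum u_ge0 lf.
  have := cauchy_schwarz u_ge0 la (l2B u_ge0 la ly).
  rewrite l2dotBr// [l2dot _ _ a (fun t => \sum_(_ <- _) _)]l2dotC l2dot_sum//.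
  rewrite big1_seq; last first.
    move=> j /andP[_ jr]; rewrite l2dotZl//; last by apply: le2; exact: rS.
    by rewrite l2dotC (ha _ (rS _ jr)) conjc0 mulr0.
  rewrite conjc0 subr0 l2dotE// cabs_nneg ?normsq_ge0//.
  set N := normsq S u a; set D := normsq _ _ _ in lt_eps *.
  have : 0 <= N by exact: normsq_ge0.
  have : 0 <= D by exact: normsq_ge0.
  nra.
have := nnsum_term (@normsq_term_ge0 _ _ _ _ u_ge0 a) la St.
move=> /le_trans /(_ N0); rewrite pmulr_lle0 ?u_gt0//.
by rewrite exprn_even_le0 //= cabs_eq0 => /eqP.
Qed.

Hypothesis e_orth : pairwise_orthogonal.

Definition proj (r : seq T') a t : R[i] :=
  \sum_(j <- r) ((wt j)%:C * coefs a j) * e j t.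

Lemma l2_proj r a : (forall j, j \in r -> S' j) -> l2 S u (proj r a).
Proof. by move=> rS; apply: l2_sum => // j /rS Sj; apply: l2Z => //; exact: le2. Qed.

Lemma dot_proj r a b : (forall j, j \in r -> S' j) -> l2 S u b ->
  l2dot S u (proj r a) b =
  \sum_(j <- r) (wt j)%:C * coefs a j * l2dot S u (e j) b.
Proof.
move=> rS lb; rewrite /proj l2dot_sum//; last first.
  by move=> j /rS Sj; apply: l2Z => //; exact: le2.
by apply: eq_big_seq => j /rS Sj; rewrite l2dotZl//; exact: le2.
Qed.

Lemma normsq_proj r a : uniq r -> (forall j, j \in r -> S' j) -> l2 S u a ->
  normsq S u (fun t => a t - proj r a t) =
  normsq S u a - \sum_(j <- r) cabs (coefs a j) ^+ 2 * wt j.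
Proof.
move=> ur rS la; have lp := l2_proj a rS; have lap := l2B u_ge0 la lp.
have pe k : k \in r -> l2dot S u (proj r a) (e k) = coefs a k.
  move=> kr; rewrite dot_proj//; last by apply: le2; exact: rS.
  rewrite (bigD1_seq k)//= big1_seq ?addr0; last first.
    by move=> j /andP[jk jr]; rewrite (e_orth (rS _ jr) (rS _ kr) jk) mulr0.
  rewrite l2dotE//; last by apply: le2; exact: rS.
  rewrite mulrAC -real_complexM /wt mulVf ?mul1r// gt_eqF// e_gt0//; exact: rS.
have app : l2dot S u (fun t => a t - proj r a t) (proj r a) = 0.
  rewrite l2dotC dot_proj// big1_seq ?conjc0// => k /andP[_ kr].
  rewrite l2dotC l2dotBl//; last by apply: le2; exact: rS.
  by rewrite pe// subrr conjc0 mulr0.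
apply: (@complexI R); rewrite -l2dotE// l2dotBr// app subr0 l2dotBl//.
rewrite l2dotE// real_complexB; congr (_ - _); rewrite dot_proj// rmorph_sum /=.
apply: eq_bigr => j _; rewrite [l2dot _ _ (e j) a]l2dotC -mulrA mulcJ.
by rewrite -real_complexM mulrC.
Qed.

Lemma bessel_fin a (A : set T') : l2 S u a -> finite_set A -> A `<=` S' ->
  \sum_(j \in A) cabs (coefs a j) ^+ 2 * wt j <= normsq S u a.
Proof.
move=> la fA AS; rewrite fsbig_finite//=.
have rS j : j \in fset_set A -> S' j by rewrite in_fset_set// inE => /AS.
have := normsq_ge0 u_ge0 (fun t => a t - proj (fset_set A) a t).
by rewrite normsq_proj ?fset_uniq// subr_ge0.
Qed.

Lemma l2_coefs a : l2 S u a -> l2 S' wt (coefs a).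
Proof.
move=> la; apply: (@le_lt_trans _ _ (normsq S u a)%:E); last exact: ltry.
by apply: nnsummable_bound => A fA AS; exact: bessel_fin.
Qed.

Lemma bessel a : l2 S u a -> normsq S' wt (coefs a) <= normsq S u a.
Proof.
move=> la; apply: nnsum_le => [j Sj|A fA AS].
  exact: (normsq_term_ge0 wt_ge0).
exact: bessel_fin.
Qed.

Lemma coefsB a b j : S' j -> l2 S u a -> l2 S u b ->
  coefs (fun t => a t - b t) j = coefs a j - coefs b j.
Proof. by move=> Sj la lb; rewrite /coefs l2dotBl//; exact: le2. Qed.

Let single t : T -> R[i] := fun s => if s == t then 1 else 0.

(** Bessel's inequality for the unit vector at [t] puts j -> e_j(t) in the l^2 space of the weights,
    and its product with [b] is then summable. *)
Lemma family_summable (b : T' -> R[i]) t : S t -> l2 S' wt b ->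
  csummable S' (fun j => (wt j)%:C * b j * e j t).
Proof.
move=> St lb.
have ls : l2 S u (single t).
  by apply: (@l2_single _ _ _ _ u_ge0 _ t) => s _ /negbTE; rewrite /single => ->.
have cs j : S' j -> cabs (coefs (single t) j) = cabs (e j t) * u t.
  move=> Sj; rewrite /coefs /l2dot (@csum_single _ _ _ t)//.
    by rewrite /single eqxx mul1r cabsM cabsJ cabs_nneg// u_ge0.
  by move=> s _ /negbTE st; rewrite /single st !mul0r.
have lc := l2_coefs ls.
have ut := u_gt0 St.
have lc2 := nnsummableZ (ltW (exprn_gt0 2 (divr_gt0 ltr01 ut)))
  (normsq_term_ge0 wt_ge0 (coefs (single t))) lc.
apply: le_nnsummable (nnsummableD _ _ lb lc2) => [j Sj|j Sj|j Sj].
- rewrite cs// !cabsM cabs_nneg ?wt_ge0// -!mulrA -mulrCA.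
  rewrite (_ : _ + _ = (cabs (b j) ^+ 2 + cabs (e j t) ^+ 2) * wt j); last first.
    by field; rewrite gt_eqF.
  rewrite mulrCA mulrC ler_wpM2r ?wt_ge0//.
  have := sqr_ge0 (cabs (b j) - cabs (e j t)); have := cabs_ge0 (b j).
  have := cabs_ge0 (e j t); nra.
- exact: (normsq_term_ge0 wt_ge0).
- by rewrite mulr_ge0 ?sqr_ge0// (normsq_term_ge0 wt_ge0).
Qed.

(** The Riesz-Fischer vector of [b], as a pointwise sum. It is the adjoint of [coefs] applied to
    [b], and its norm is estimated by duality. *)
Definition synthesis (b : T' -> R[i]) t : R[i] := csum S' (fun j => (wt j)%:C * b j * e j t).

Lemma dot_synthesis_fin (b : T' -> R[i]) c (A : set T) : l2 S' wt b -> finite_set A ->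
  A `<=` S -> (forall t, S t -> ~ A t -> c t = 0) ->
  l2dot S u (synthesis b) c = l2dot S' wt b (coefs c).
Proof.
move=> lb fA AS cA; have rS t : t \in fset_set A -> S t.
  by rewrite in_fset_set// inE => /AS.
rewrite /l2dot (csum_finsupp fA)//; last first.
  by move=> t St /(cA t St) ->; rewrite conjc0 mulr0 mul0r.
pose G t j := conjc (c t) * (u t)%:C * ((wt j)%:C * b j * e j t).
transitivity (\sum_(t <- fset_set A) csum S' (G t)).
  apply: eq_big_seq => t /rS St; rewrite /G csumZ; last exact: family_summable.
  by rewrite /synthesis; ring.
rewrite -csum_sum; last first.
  by move=> t /rS St; apply: csummableZ; exact: family_summable.
apply: eq_csum => j Sj; rewrite /coefs /l2dot (csum_finsupp fA)//; last first.
  by move=> t St /(cA t St) ->; rewrite !mul0r.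
rewrite rmorph_sum /= mulr_sumr mulr_suml; apply: eq_bigr => t _.
by rewrite /G !conjcM conjcK conjc_real; ring.
Qed.

Let trunc (A : set T) a t : R[i] := if t \in A then a t else 0.

Let trunc0 (A : set T) a t : S t -> ~ A t -> trunc A a t = 0.
Proof. by move=> _ At; rewrite /trunc memNset. Qed.

Let l2_trunc (A : set T) a : finite_set A -> A `<=` S -> l2 S u (trunc A a).
Proof.
move=> fA AS; have rS t : t \in fset_set A -> S t.
  by rewrite in_fset_set// inE => /AS.
have ls t : l2 S u (fun s => if s == t then a t else 0).
  by apply: (@l2_single _ _ _ _ u_ge0 _ t) => s _ /negbTE ->.
have := @l2_sum R T S u u_ge0 _ (fset_set A)
  (fun t s => if s == t then a t else 0) (fun t _ => ls t).
apply: eq_l2 => t _; rewrite /trunc; case: ifPn => At.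
  rewrite (bigD1_seq t)/= ?fset_uniq ?in_fset_set//.
  rewrite eqxx big1_seq ?addr0// => s /andP[st _].
  by rewrite eq_sym (negbTE st).
rewrite big1_seq// => s /andP[_]; rewrite in_fset_set// => As.
by case: eqVneq => // ts; rewrite ts As in At.
Qed.

(** Testing against the truncation x of the vector itself to a finite set gives N = |x|^2 = <b,
    coefs x>. Cauchy-Schwarz and Bessel yield N^2 <= B N, hence N <= B for every finite set. *)
Lemma l2_synthesis_bound (b : T' -> R[i]) : l2 S' wt b ->
  (l2norm2 S u (synthesis b) <= (normsq S' wt b)%:E)%E.
Proof.
move=> lb; apply: nnsummable_bound => A fA AS.
have lt := l2_trunc (synthesis b) fA AS.
set N := (\sum_(t \in A) _); pose x := trunc A (synthesis b).
have NE : normsq S u x = N.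
  apply: (@complexI R); rewrite -l2dotE// /l2dot (csum_finsupp fA)//; last first.
    by move=> t St At; rewrite /x trunc0// !mul0r.
  rewrite /N fsbig_finite//= rmorph_sum /=; apply: eq_big_seq => t.
  by rewrite in_fset_set// /x /trunc => ->; rewrite mulcJ -real_complexM.
have xE : l2dot S u (synthesis b) x = N%:C.
  rewrite -NE -l2dotE//; apply: eq_csum => t _; rewrite /x /trunc.
  by case: ifPn => // _; rewrite conjc0 !mulr0 !mul0r.
have := cauchy_schwarz wt_ge0 lb (l2_coefs lt).
rewrite -(dot_synthesis_fin lb fA AS (@trunc0 A _)) -/x xE cabs_nneg; last first.
  by rewrite -NE normsq_ge0.
have := bessel lt; rewrite -/x NE.
set B := normsq _ wt b; set C := normsq _ wt _.
have : 0 <= N by rewrite -NE normsq_ge0.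
have : 0 <= B by exact: (normsq_ge0 wt_ge0).
have : 0 <= C by exact: (normsq_ge0 wt_ge0).
nra.
Qed.

Lemma l2_synthesis (b : T' -> R[i]) : l2 S' wt b -> l2 S u (synthesis b).
Proof. by move=> /l2_synthesis_bound/le_lt_trans; apply; exact: ltry. Qed.

(** Extension by continuity from finitely supported c: the difference D of the two sides vanishes on
    truncations and satisfies |D x|^2 <= 4 B |x|^2. *)
Lemma dot_synthesis (b : T' -> R[i]) c : l2 S' wt b -> l2 S u c ->
  l2dot S u (synthesis b) c = l2dot S' wt b (coefs c).
Proof.
move=> lb lc; have ls := l2_synthesis lb.
set B := normsq S' wt b.
have Bs : normsq S u (synthesis b) <= B.
  by rewrite -lee_fin -l2norm2E//; exact: l2_synthesis_bound.
have B0 : 0 <= B by exact: (normsq_ge0 wt_ge0).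
pose D x := l2dot S u (synthesis b) x - l2dot S' wt b (coefs x).
have Dle x : l2 S u x -> cabs (D x) ^+ 2 <= 4 * B * normsq S u x.
  move=> lx; rewrite /D; apply: le_trans (cabs_sqrD _ _) _; rewrite cabsN.
  have := cauchy_schwarz u_ge0 ls lx.
  have := cauchy_schwarz wt_ge0 lb (l2_coefs lx).
  have := bessel lx; have : 0 <= normsq S u x by exact: normsq_ge0.
  rewrite -/B; set X := normsq S u x; set Y := normsq S u _ in Bs *.
  set Z := normsq _ _ _; nra.
suff : cabs (D c) ^+ 2 <= 0.
  by move=> h; apply/eqP; rewrite -subr_eq0 -cabs_eq0 -sqrf_eq0 eq_le h sqr_ge0.
apply/ler_addgt0Pr => eps e0; rewrite add0r.
have e1 : 0 < eps / (4 * B + 1) by rewrite divr_gt0// ltr_wpDl// mulr_ge0.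
have [A [fA AS tail]] := nnsum_tail (normsq_term_ge0 u_ge0 c) lc e1.
have lt := l2_trunc c fA AS; have lct := l2B u_ge0 lc lt.
have -> : D c = D (fun t => c t - trunc A c t).
  have E1 := dot_synthesis_fin lb fA AS (@trunc0 A c).
  have E2 := l2dotBr u_ge0 lc lt ls.
  have E3 : l2dot S' wt b (coefs (fun t => c t - trunc A c t)) =
      l2dot S' wt b (coefs c) - l2dot S' wt b (coefs (trunc A c)).
    rewrite -(l2dotBr wt_ge0 (l2_coefs lc) (l2_coefs lt) lb).
    by apply: eq_l2dot => // j Sj; rewrite coefsB.
  have cancel (x y z : R[i]) : x - y = (x - z) - (y - z) by ring.
  by rewrite /D E3 E2 E1; exact: cancel.
apply: le_trans (Dle _ lct) _.
have : normsq S u (fun t => c t - trunc A c t) <= eps / (4 * B + 1).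
  apply: le_trans tail; rewrite /normsq /nnsum le_eqVlt; apply/orP; left.
  apply/eqP; congr fine.
  rewrite (@nnsum_restrict _ _ S (S `\` A))//.
  - by apply: eq_esum => t [St At]; rewrite (trunc0 c St At) subr0.
  - by move=> t St; rewrite mulr_ge0 ?sqr_ge0 ?u_ge0.
  - move=> t St /not_andP[//|/contrapT At].
    by rewrite /trunc mem_set// subrr cabs0 expr0n mul0r.
rewrite ler_pdivlMr; last by rewrite ltr_wpDl// mulr_ge0.
by have := normsq_ge0 u_ge0 (fun t => c t - trunc A c t); nra.
Qed.

Lemma coefs_synthesis (b : T' -> R[i]) k : l2 S' wt b -> S' k -> coefs (synthesis b) k = b k.
Proof.
move=> lb Sk; rewrite /coefs dot_synthesis//; last exact: le2.
rewrite /l2dot (@csum_single _ _ _ k)//.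
  rewrite /coefs l2dotE ?conjc_real; [|exact: u_ge0|exact: le2].
  by rewrite -mulrA -real_complexM mulfV ?mulr1// gt_eqF// e_gt0.
by move=> j Sj jk; rewrite /coefs e_orth 1?eq_sym// conjc0 mulr0 mul0r.
Qed.

Lemma total_unitary : total_family -> unitary_l2 S u S' wt coefs.
Proof.
move=> tot; split; first exact: l2_coefs.
  move=> a b la lb; have lFa := l2_coefs la; have ls := l2_synthesis lFa.
  have as0 t : S t -> a t = synthesis (coefs a) t.
    move=> St; apply/eqP; rewrite -subr_eq0; apply/eqP; move: t St.
    apply: tot; first exact: l2B.
    by move=> j Sj; rewrite -/(coefs _ j) coefsB// coefs_synthesis// subrr.
  rewrite -dot_synthesis//; apply: eq_l2dot => // t St; by rewrite -as0.
move=> b lb; exists (synthesis b); first exact: l2_synthesis.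
by move=> j; exact: coefs_synthesis.
Qed.

(** Equality in Bessel's inequality makes x a limit of its finite projections, and a is orthogonal
    to each of these. *)
Lemma orthogonal_of_parseval a x : l2 S u a -> l2 S u x ->
  normsq S u x <= normsq S' wt (coefs x) ->
  (forall j, S' j -> l2dot S u a (e j) = 0) -> l2dot S u a x = 0.
Proof.
move=> la lx nx ha; apply/eqP; rewrite -cabs_eq0 -sqrf_eq0 eq_le sqr_ge0 andbT.
apply/ler_addgt0Pr => eps e0; rewrite add0r.
have e1 : 0 < eps / (normsq S u a + 1).
  by rewrite divr_gt0// ltr_wpDl// normsq_ge0.
have lc := l2_coefs lx.
have [A [fA AS tail]] := nnsum_tail (normsq_term_ge0 wt_ge0 _) lc e1.
have rS j : j \in fset_set A -> S' j by rewrite in_fset_set// inE => /AS.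
have lp := l2_proj x rS; have lxp := l2B u_ge0 lx lp.
have -> : l2dot S u a x = l2dot S u a (fun t => x t - proj (fset_set A) x t).
  rewrite l2dotBr// [l2dot _ _ a (proj _ _)]l2dotC dot_proj// big1_seq.
    by rewrite conjc0 subr0.
  by move=> j /andP[_ jr]; rewrite l2dotC (ha _ (rS _ jr)) conjc0 mulr0.
apply: le_trans (cauchy_schwarz u_ge0 la lxp) _.
have : normsq S u (fun t => x t - proj (fset_set A) x t) <=
    eps / (normsq S u a + 1).
  rewrite normsq_proj ?fset_uniq//; apply: le_trans tail.
  rewrite lerBlDr addrC; apply: le_trans nx _.
  rewrite {1}/normsq (nnsumID A (normsq_term_ge0 wt_ge0 _) lc) (setIidr AS) lerD2r.
  by rewrite nnsum_fset// => j /AS Sj; exact: (normsq_term_ge0 wt_ge0).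
rewrite ler_pdivlMr; last by rewrite ltr_wpDl// normsq_ge0.
have := normsq_ge0 u_ge0 a.
have := normsq_ge0 u_ge0 (fun t => x t - proj (fset_set A) x t).
by nra.
Qed.

End OrthogonalFamily.

(** * Unitarity of the coefficient map gives orthogonality and density *)

Section UnitaryOrthogonal.
Variables (R : realType) (T T' : choiceType) (S : set T) (u : T -> R).
Variables (S' : set T') (e : T' -> T -> R[i]).
Hypothesis u_gt0 : forall t, S t -> 0 < u t.
Hypothesis le2 : forall j, S' j -> l2 S u (e j).
Hypothesis e_gt0 : forall j, S' j -> 0 < normsq S u (e j).
Hypothesis eU : unitary_l2 S u S' (wt S u e) (coefs S u e).

Let u_ge0 t : S t -> 0 <= u t. Proof. by move=> /u_gt0/ltW. Qed.
Let wt_ge0 j : S' j -> 0 <= wt S u e j.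
Proof. by move=> Sj; rewrite invr_ge0 normsq_ge0. Qed.

(** Let a be the preimage of the unit sequence at k. The isometry turns <e_j, e_k> w_k into <e_j,
    a>, the conjugate of the entry at j of that sequence, which is 0. *)
Lemma unitary_orthogonal : pairwise_orthogonal S u S' e.
Proof.
move=> j k Sj Sk jk; have [_ Uiso Usurj] := eU.
pose d (i : T') : R[i] := if i == k then 1 else 0.
have ld : l2 S' (wt S u e) d.
  by apply: (@l2_single _ _ _ _ wt_ge0 _ k) => s _ /negbTE; rewrite /d => ->.
have [a la ad] := Usurj d ld.
have := Uiso _ _ (le2 Sj) la.
rewrite /l2dot (@csum_single _ _ _ k)//; last first.
  by move=> s Ss sk; rewrite ad// /d (negbTE sk) conjc0 mulr0 mul0r.
rewrite ad// /d eqxx conjc1 mulr1 -/(l2dot S u (e j) a) [in RHS]l2dotC.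
rewrite -/(coefs S u e a j) ad// /d (negbTE jk) conjc0 => /eqP.
rewrite mulf_eq0 => /orP[/eqP//|/eqP [/eqP]].
by rewrite invr_eq0 gt_eqF// e_gt0.
Qed.

Lemma unitary_normsq a : l2 S u a ->
  normsq S' (wt S u e) (coefs S u e a) = normsq S u a.
Proof.
move=> la; have [Ul2 Uiso _] := eU.
by apply: (@complexI R); rewrite -!l2dotE ?Uiso//; exact: Ul2.
Qed.

Lemma unitary_dense : dense_family S u S' e.
Proof.
move=> a la eps e0; have [Ul2 _ _] := eU.
have e2 : 0 < eps / 2 by rewrite divr_gt0.
have lc := Ul2 _ la.
have [A [fA AS tail]] := nnsum_tail (normsq_term_ge0 wt_ge0 _) lc e2.
have rS j : j \in fset_set A -> S' j by rewrite in_fset_set// inE => /AS.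
exists (fset_set A), (fun j => (wt S u e j)%:C * coefs S u e a j); split => //.
rewrite [normsq _ _ _](normsq_proj u_gt0 le2 e_gt0 unitary_orthogonal
  (fset_uniq _) rS la).
rewrite -unitary_normsq// /normsq.
rewrite (nnsumID A (normsq_term_ge0 wt_ge0 _) lc) (setIidr AS).
rewrite nnsum_fset//; last by move=> j /AS Sj; exact: (normsq_term_ge0 wt_ge0).
rewrite addrAC subrr add0r; apply: le_lt_trans tail _.
by rewrite ltr_pdivrMr// ltr_pMr// ltr1n.
Qed.

Lemma unitary_total : total_family S u S' e.
Proof. exact: dense_total unitary_dense. Qed.

End UnitaryOrthogonal.

(** The support is covered by finite sets A_k whose complements carry a sum of at most 1 / (k +
    1). *)
Lemma nnsummable_countable (R : realType) (T : choiceType) (S : set T)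
    (f : T -> R) : (forall t, S t -> 0 <= f t) -> nnsummable S f ->
  countable [set t | S t /\ f t != 0].
Proof.
move=> f0 sf.
have /choice[A hA] (k : nat) : exists B : set T, [/\ finite_set B, B `<=` S &
    nnsum (S `\` B) f <= k.+1%:R^-1].
  by apply: nnsum_tail.
apply: (@sub_countable _ _ _ (\bigcup_k A k)); last first.
  apply: bigcup_countable => // k _; apply: finite_set_countable.
  by have [] := hA k.
apply: subset_card_le => t [St ft]; apply: contrapT => nAt.
have fp : 0 < f t by rewrite lt_neqAle eq_sym ft f0.
suff : f t <= 0 by rewrite leNgt fp.
apply/ler_addgt0Pr => e e0; rewrite add0r.
have [k /ltW ke] := ltr_add_invr e0; rewrite add0r in ke.
apply: le_trans ke; have [_ _] := hA k; apply: le_trans.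
apply: nnsum_term.
- by move=> s [/f0].
- by apply: nnsummable_sub sf => // s [].
- by split => // Akt; apply: nAt; exists k.
Qed.

(** * Kernel vectors, bases of kernels and the discrete Hilbert transform *)

Section KernelVectors.
Variables (R : realType) (I : countType) (gamma : I -> R[i]) (v : I -> R).
Hypothesis v_gt0 : forall n, 0 < v n.
Hypothesis two_terms : exists i j : I, i != j.
Implicit Types (z : R[i]) (Lambda : set R[i]).

Let v_gt0S n : [set: I] n -> 0 < v n. Proof. by move=> _. Qed.
Let v_ge0 n : [set: I] n -> 0 <= v n. Proof. by move=> _; exact: ltW. Qed.

Definition kvec z n : R[i] := (conjc (z - gamma n))^-1.

Lemma conjc_kvec z n : conjc (kvec z n) = (z - gamma n)^-1.
Proof. by rewrite /kvec conjcV conjcK. Qed.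

Lemma cabs_kvec z n : cabs (kvec z n) = (cabs (z - gamma n))^-1.
Proof. by rewrite cabsV cabsJ. Qed.

Lemma kvec_neq0 z n : star gamma v z -> kvec z n != 0.
Proof.
by move=> [zn _]; rewrite -cabs_eq0 cabs_kvec invr_eq0 cabs_eq0 subr_eq0.
Qed.

Lemma normsq_kvecE z n :
  cabs (kvec z n) ^+ 2 * v n = v n / cabs (z - gamma n) ^+ 2.
Proof. by rewrite cabs_kvec exprVn mulrC. Qed.

Lemma l2_kvec z : star gamma v z -> l2 [set: I] v (kvec z).
Proof. by move=> [_]; apply: eq_nnsummable => n _; rewrite normsq_kvecE. Qed.

Lemma normsq_kvec_gt0 z : star gamma v z -> 0 < normsq [set: I] v (kvec z).
Proof.
move=> sz; have [i _] := two_terms.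
apply: lt_le_trans (nnsum_term (normsq_term_ge0 v_ge0 _) (l2_kvec sz)
  (Logic.I : [set: I] i)).
by rewrite mulr_gt0// exprn_gt0// cabs_gt0 kvec_neq0.
Qed.

Lemma hilbert_transformE :
  hilbert_transform gamma v = coefs [set: I] v kvec.
Proof.
apply/funext => a; apply/funext => z; apply: eq_csum => n _.
by rewrite conjc_kvec; ring.
Qed.

Lemma weightE : weight gamma v = wt [set: I] v kvec.
Proof.
apply/funext => z; congr (_^-1); congr fine; apply: eq_esum => n _.
by rewrite normsq_kvecE.
Qed.

Lemma rkernelE z : rkernel gamma v z = hilbert_transform gamma v (kvec z).
Proof.
apply/funext => w; apply: eq_csum => n _.
by rewrite /kvec conjcB invfM; ring.
Qed.

Definition orthogonal_kernels Lambda :=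
  pairwise_orthogonal [set: I] v Lambda kvec.
Definition total_kernels Lambda := total_family [set: I] v Lambda kvec.

(** The coefficients of a coordinate vector, v_i / (z - gamma_i), are nonzero at every z in
    [Lambda], yet their weighted squares are summable by Bessel. *)
Lemma orthogonal_countable Lambda : Lambda `<=` star gamma v ->
  orthogonal_kernels Lambda -> countable Lambda.
Proof.
move=> Ls orth; have [i _] := two_terms.
pose d n : R[i] := if n == i then 1 else 0.
have ld : l2 [set: I] v d.
  by apply: (@l2_single _ _ _ _ v_ge0 _ i) => s _ /negbTE; rewrite /d => ->.
have le2 j : Lambda j -> l2 [set: I] v (kvec j) by move=> /Ls/l2_kvec.
have egt0 j : Lambda j -> 0 < normsq [set: I] v (kvec j).
  by move=> /Ls/normsq_kvec_gt0.
have := nnsummable_countable _ (l2_coefs v_gt0S le2 egt0 orth ld).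
have w0 j : Lambda j -> 0 <= wt [set: I] v kvec j.
  by move=> Lj; apply/ltW/wt_gt0; last exact: Lj.
move=> /(_ (normsq_term_ge0 w0 _)).
rewrite (_ : [set t | _] = Lambda)//; apply/seteqP; split => [z []//|z Lz].
split => //; rewrite mulf_neq0//; last by rewrite gt_eqF// (@wt_gt0 _ _ _ _ _ _ _ egt0).
rewrite expf_neq0// cabs_eq0 /coefs /l2dot (@csum_single _ _ _ i)//.
  rewrite /d eqxx mul1r mulf_neq0//; first by rewrite conjc_eq0 kvec_neq0//; exact: Ls.
  by rewrite real_complex_eq0 gt_eqF.
by move=> s _ /negbTE si; rewrite /d si !mul0r.
Qed.

Lemma unitary_kernelsP Lambda : Lambda `<=` star gamma v ->
  unitary_l2 [set: I] v Lambda (weight gamma v) (hilbert_transform gamma v) <->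
  orthogonal_kernels Lambda /\ total_kernels Lambda.
Proof.
move=> Ls; rewrite hilbert_transformE weightE.
have le2 j : Lambda j -> l2 [set: I] v (kvec j) by move=> /Ls/l2_kvec.
have egt0 j : Lambda j -> 0 < normsq [set: I] v (kvec j).
  by move=> /Ls/normsq_kvec_gt0.
split => [U|[orth tot]]; last exact: total_unitary.
by split; [exact: unitary_orthogonal|exact: unitary_total].
Qed.

(** * From functions in H(Gamma, v) to coefficient sequences *)

Section Basis.
Hypothesis coefs_ok : coefs_determined gamma v.

Lemma HcoefsE f a : has_coefs gamma v f a -> Hcoefs gamma v f = a.
Proof.
move=> fa; apply: (coefs_ok _ fa).
by rewrite /Hcoefs; case: xgetP => [b -> //|/(_ a)].
Qed.

Lemma has_coefs_kernel z : star gamma v z ->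
  has_coefs gamma v (rkernel gamma v z) (kvec z).
Proof. by move=> sz; split; [exact: l2_kvec|move=> w _; rewrite rkernelE]. Qed.

Lemma has_coefs_lincomb f a (r : seq R[i]) (c : R[i] -> R[i]) :
  has_coefs gamma v f a -> (forall z, z \in r -> star gamma v z) ->
  has_coefs gamma v (fun w => f w - \sum_(z <- r) c z * rkernel gamma v z w)
    (fun n => a n - \sum_(z <- r) c z * kvec z n).
Proof.
move=> [la fa] rs.
have lk z : z \in r -> l2 [set: I] v (fun n => c z * kvec z n).
  by move=> /rs sz; apply: l2Z => //; exact: l2_kvec.
have ls := l2_sum v_ge0 lk.
split; first exact: l2B.
move=> w sw; rewrite fa// hilbert_transformE /coefs l2dotBl//; last exact: l2_kvec.
congr (_ - _); rewrite l2dot_sum//; last exact: l2_kvec.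
apply: eq_big_seq => z /rs sz; rewrite rkernelE hilbert_transformE /coefs.
by rewrite l2dotZl//; exact: l2_kvec.
Qed.

Lemma rkernel_basisP Lambda : rkernel_basis gamma v Lambda <->
  Lambda `<=` star gamma v /\
  unitary_l2 [set: I] v Lambda (weight gamma v) (hilbert_transform gamma v).
Proof.
split=> [[_ Ls [_ orth dense]]|[Ls U]].
  split => //; apply/unitary_kernelsP => //; split.
    move=> z w Lz Lw zw; have := orth _ _ Lz Lw zw.
    rewrite /Hdot (HcoefsE (has_coefs_kernel (Ls _ Lz))).
    by rewrite (HcoefsE (has_coefs_kernel (Ls _ Lw))).
  apply: dense_total => //.
    by move=> z /Ls/l2_kvec.
  move=> a la eps e0; pose f := hilbert_transform gamma v a.
  have fa : has_coefs gamma v f a by [].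
  have [r [c [rL]]] := dense f (ex_intro _ a fa) eps e0.
  have rs z : z \in r -> star gamma v z by move=> /rL/Ls.
  have hc := has_coefs_lincomb c fa rs.
  rewrite /Hnorm2 (HcoefsE hc) l2norm2E//; last by case: hc.
  by rewrite lte_fin => h; exists r, c.
have /unitary_kernelsP-/(_ Ls) [orth tot] := U.
have le2 j : Lambda j -> l2 [set: I] v (kvec j) by move=> /Ls/l2_kvec.
have egt0 j : Lambda j -> 0 < normsq [set: I] v (kvec j).
  by move=> /Ls/normsq_kvec_gt0.
split => //; first exact: orthogonal_countable.
split.
- move=> z Lz; have hk := has_coefs_kernel (Ls _ Lz).
  split; first by exists (kvec z).
  rewrite /Hnorm2 (HcoefsE hk) l2norm2E//; last exact: le2.
  by rewrite lte_fin egt0.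
- move=> z w Lz Lw zw; rewrite /Hdot (HcoefsE (has_coefs_kernel (Ls _ Lz))).
  rewrite (HcoefsE (has_coefs_kernel (Ls _ Lw))); exact: orth.
- move=> f [a fa] eps e0; have la : l2 [set: I] v a by case: fa.
  rewrite hilbert_transformE weightE in U.
  have [r [c [rL lt_eps]]] := unitary_dense v_gt0S le2 egt0 U la e0.
  have rs z : z \in r -> star gamma v z by move=> /rL/Ls.
  exists r, c; split => //; have hc := has_coefs_lincomb c fa rs.
  by rewrite /Hnorm2 (HcoefsE hc) l2norm2E ?lte_fin//; case: hc.
Qed.

End Basis.

(** An empty family is orthogonal to everything, and a single kernel annihilates a suitable nonzero
    combination of two coordinate vectors. *)
Lemma total_two_points Lambda : injective gamma -> Lambda `<=` star gamma v ->
  total_kernels Lambda -> exists z w, [/\ Lambda z, Lambda w & z != w].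
Proof.
move=> gamma_inj Ls tot; have [i [j ij]] := two_terms.
pose single (k n : I) : R[i] := if n == k then 1 else 0.
have ls k : l2 [set: I] v (single k).
  by apply: (@l2_single _ _ _ _ v_ge0 _ k) => s _ /negbTE; rewrite /single => ->.
have ds k z : l2dot [set: I] v (single k) (kvec z) = (z - gamma k)^-1 * (v k)%:C.
  rewrite /l2dot (@csum_single _ _ _ k)//; first by rewrite /single eqxx mul1r conjc_kvec.
  by move=> s _ /negbTE sk; rewrite /single sk !mul0r.
have [z Lz] : exists z, Lambda z.
  apply: contrapT => nL.
  have h w : Lambda w -> l2dot [set: I] v (single i) (kvec w) = 0.
    by move=> Lw; case: nL; exists w.
  have /eqP := tot _ (ls i) h i Logic.I.
  by rewrite /single eqxx oner_eq0.
apply: contrapT => nzw.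
pose a n := (z - gamma i) / (v i)%:C * single i n -
  (z - gamma j) / (v j)%:C * single j n.
have la : l2 [set: I] v a by apply: l2B => //; exact: l2Z.
have zg k : z - gamma k != 0.
  by rewrite subr_eq0; have [h _] := Ls _ Lz; exact: h.
have vC k : (v k)%:C != 0 by rewrite real_complex_eq0 gt_eqF.
have a0 w : Lambda w -> l2dot [set: I] v a (kvec w) = 0.
  move=> Lw; have <- : z = w.
    by apply/eqP; apply: contrapT => /negP zw; apply: nzw; exists z, w.
  have lz := l2_kvec (Ls _ Lz).
  rewrite l2dotBl ?l2dotZl ?ds//; try exact: l2Z.
  by field; rewrite !zg !vC.
have /eqP := tot a la a0 i (Logic.I : [set: I] i).
rewrite /a /single eqxx (negbTE ij) mulr1 mulr0 subr0.
by rewrite mulf_eq0 (negbTE (zg i)) invr_eq0 (negbTE (vC i)).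
Qed.

(* [kvec z] times the ratio [(z - gamma) / (w - gamma)] has the modulus of
   [kvec w] and, by partial fractions, is orthogonal to every kernel but the one
   at [w]: it is a multiple of [kvec w]. *)
Lemma kernel_ratio Lambda z w : Lambda `<=` star gamma v ->
  orthogonal_kernels Lambda -> total_kernels Lambda ->
  Lambda z -> Lambda w -> z != w ->
  exists c : R[i], cabs c = 1 /\ forall n,
    (z - gamma n) * conjc (w - gamma n) = c * (conjc (z - gamma n) * (w - gamma n)).
Proof.
move=> Ls orth tot Lz Lw zw.
have gn t n : Lambda t -> t - gamma n != 0.
  by move=> /Ls [h _]; rewrite subr_eq0 h.
have gJ t n : Lambda t -> conjc (t - gamma n) != 0.
  by move=> Lt; rewrite conjc_eq0 gn.
pose x n := kvec z n * (z - gamma n) / (w - gamma n).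
have lz := l2_kvec (Ls _ Lz); have lw := l2_kvec (Ls _ Lw).
have xw n : cabs (x n) = cabs (kvec w n).
  rewrite /x cabs_div cabsM !cabs_kvec mulVf ?mul1r//.
  by rewrite cabs_eq0 gn.
have lx : l2 [set: I] v x by apply: eq_nnsummable lw => n _; rewrite xw.
have x0 t : Lambda t -> t != w -> l2dot [set: I] v x (kvec t) = 0.
  move=> Lt tw; have lt := l2_kvec (Ls _ Lt).
  (* For t = z the factor z - gamma cancels and <e_z, e_w> = 0 remains. *)
  have [tz|tz] := eqVneq t z.
    rewrite -(orth _ _ Lz Lw zw) tz; apply: eq_csum => n _.
    by rewrite /x !conjc_kvec; field; rewrite !gn.
  (* The coefficients in (z - g) / ((w - g)(t - g)) = A / (w - g) + B / (t - g). *)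
  pose A := (z - w) / (t - w); pose B := (z - t) / (w - t).
  have tw0 : t - w != 0 by rewrite subr_eq0.
  have wt0 : w - t != 0 by rewrite subr_eq0 eq_sym.
  rewrite (_ : l2dot _ _ _ _ = csum [set: I] (fun n =>
    A * (kvec z n * conjc (kvec w n) * (v n)%:C) +
    B * (kvec z n * conjc (kvec t n) * (v n)%:C))).
    have s1 := l2dot_summable v_ge0 lz lw; have s2 := l2dot_summable v_ge0 lz lt.
    rewrite (csumD (csummableZ A s1) (csummableZ B s2)).
    rewrite (csumZ _ s1) (csumZ _ s2) -/(l2dot _ _ _ _) -/(l2dot _ _ (kvec z) (kvec t)).
    by rewrite (orth _ _ Lz Lw zw) (orth _ _ Lz Lt) ?mulr0 ?addr0// eq_sym.
  apply: eq_csum => n _; rewrite /x !conjc_kvec /A /B.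
  by field; rewrite !gn// tw0 wt0.
have nw := normsq_kvec_gt0 (Ls _ Lw).
pose c := l2dot [set: I] v x (kvec w) / (normsq [set: I] v (kvec w))%:C.
have xc n : x n = c * kvec w n.
  apply/eqP; rewrite -subr_eq0; apply/eqP; apply: (tot (fun n => x n - c * kvec w n)) => //.
    by apply: l2B => //; exact: l2Z.
  move=> t Lt; have lt := l2_kvec (Ls _ Lt).
  rewrite l2dotBl ?l2dotZl//; last exact: l2Z.
  have [->|tw] := eqVneq t w.
    rewrite l2dotE// /c divfK ?subrr//.
    by rewrite real_complex_eq0 gt_eqF.
  by rewrite x0// (orth _ _ Lw Lt) ?mulr0 ?subr0// eq_sym.
exists c; split.
  have [i _] := two_terms; have := xw i; rewrite xc cabsM => /eqP.
  rewrite -subr_eq0 -[X in _ - X]mul1r -mulrBl mulf_eq0 cabs_eq0.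
  by rewrite (negbTE (kvec_neq0 i (Ls _ Lw))) orbF subr_eq0 => /eqP.
move=> n; have := xc n; rewrite /x /kvec.
move: (gJ z n Lz) (gJ w n Lw) (gn w n Lw).
move: (w - gamma n) (conjc (w - gamma n)) (conjc (z - gamma n)) => r q p p0 q0 r0.
move=> /(congr1 (fun y => y * (p * q * r))) h.
rewrite (_ : _ * q = p^-1 * (z - gamma n) / r * (p * q * r)); last first.
  by field; rewrite p0 r0.
by rewrite h; field.
Qed.

End KernelVectors.

(** * The cross ratio condition describes a line or a circle *)

Section Concyclic.
Variables (R : realType) (z w c : R[i]).
Hypothesis zw : z != w.
Hypothesis c1 : cabs c = 1.

(* The cross ratio condition of [kernel_ratio]. *)
Definition concyclic_with (g : R[i]) : Prop :=
  (z - g) * conjc (w - g) = c * (conjc (z - g) * (w - g)).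

(** Here d / |d| is a square root of the conjugate of [c], so multiplying by [d] turns the cross
    ratio condition into a reality condition. The sum 1 + conj c bisects the angle and vanishes only
    for c = -1. *)
Lemma half_turn : exists d : R[i], d != 0 /\ conjc d = d * c.
Proof.
have cc : c * conjc c = 1 by rewrite mulcJ c1 expr1n.
have [cN|cN] := eqVneq c (-1).
  exists 'i; split; first by rewrite eq_complex /= oner_eq0 andbF.
  by rewrite cN; simpc.
exists (1 + conjc c); split.
  apply: contra cN => /eqP h; have := congr1 (@conjc R) h.
  by rewrite conjcD conjc1 conjc0 conjcK => /eqP; rewrite addrC addr_eq0.
by rewrite conjcD conjc1 conjcK mulrDl mul1r [conjc c * c]mulrC cc addrC.
Qed.

(** With d = p + i q, the condition says that d (z - g) conj(w - g) is real. Its imaginary part has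
    quadratic part q |g|^2 in g: the locus is the line through z and w if q = 0, and otherwise lies
    on a circle. *)
Lemma concyclic_line_or_circle :
  (exists p d : R[i], d != 0 /\
     forall g, concyclic_with g -> straight_line p d g) \/
  (exists p : R[i], forall g h, concyclic_with g -> concyclic_with h ->
     cabs (g - p) = cabs (h - p)).
Proof.
have [d [d0 dJ]] := half_turn.
have Im0 g : concyclic_with g -> Im (d * ((z - g) * conjc (w - g))) = 0.
  move=> cg; apply: conj_id_real; rewrite [in LHS]conjcM dJ cg.
  rewrite !conjcM !conjcK.
  have -> : conjc c * ((z - g) * conjc (w - g)) =
    conjc (z - g) * (w - g).
    rewrite cg mulrA [conjc c * c]mulrC mulcJ c1 expr1n mul1r.
    by rewrite mulrC.
  by ring.
case: d d0 dJ Im0 => p q d0 _ Im0; have [q0|q0] := eqVneq q 0.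
  left; exists z, (w - z); split; first by rewrite subr_eq0 eq_sym.
  move=> g /Im0; rewrite q0 => h.
  have p0 : p != 0 by move: d0; rewrite q0 eq_complex /= eqxx andbT.
  have hN : Im ((g - z) * conjc (w - z)) = 0.
    move: h; rewrite ImM /= mul0r addr0 => /eqP; rewrite mulf_eq0 (negbTE p0) /=.
    move=> /eqP; case: (z) (w) (g) => [z1 z2] [w1 w2] [g1 g2] /=; lra.
  have nz : (cabs (w - z) ^+ 2)%:C != 0.
    by rewrite real_complex_eq0 sqrf_eq0 cabs_eq0 subr_eq0 eq_sym.
  have E := real_complexP hN; set u := Re _ in E.
  exists (u / cabs (w - z) ^+ 2) => //.
  rewrite real_complexM real_complexV -E -mulcJ.
  rewrite -mulcJ in nz; move: nz; rewrite mulf_eq0 negb_or => /andP[n1 n2].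
  move: n1 n2; move: (w - z) (conjc (w - z)) => a b a0 b0.
  by field; rewrite a0 b0.
right; case: (z) (w) Im0 => [z1 z2] [w1 w2] Im0.
(* For g = x + i y the equation reads q |g|^2 - A x - B y + const = 0; completing the square gives
   the centre (A, B) / (2 q). *)
pose A := p * (z2 - w2) + q * (z1 + w1).
pose B := p * (w1 - z1) + q * (z2 + w2).
exists ((A / (2 * q)) +i* (B / (2 * q))).
have key g : concyclic_with g -> cabs (g - ((A / (2 * q)) +i* (B / (2 * q)))) ^+ 2 =
    (A ^+ 2 + B ^+ 2) / (4 * q ^+ 2) -
    (p * (z2 * w1 - z1 * w2) + q * (z1 * w1 + z2 * w2)) / q.
  move=> /Im0; case: g => x y; rewrite cabs_sqr /= => h.
  apply: (mulIf q0); rewrite mulrBl divfK//.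
  rewrite -[RHS]addr0 -h /A /B; field.
  by rewrite q0.
move=> g h cg ch; apply/eqP; rewrite -(@eqrXn2 _ 2)// ?cabs_ge0//.
by rewrite !key.
Qed.

End Concyclic.

Lemma quadratic_three_roots (F : fieldType) (a b e x y t : F) :
  x != y -> x != t -> y != t ->
  a * x ^+ 2 + b * x + e = 0 -> a * y ^+ 2 + b * y + e = 0 ->
  a * t ^+ 2 + b * t + e = 0 -> [/\ a = 0, b = 0 & e = 0].
Proof.
move=> xy xt yt hx hy ht.
have h1 : a * (x + y) + b = 0.
  apply: (@mulfI _ (x - y)); first by rewrite subr_eq0.
  rewrite mulr0; transitivity (a * x ^+ 2 + b * x + e - (a * y ^+ 2 + b * y + e)); first by ring.
  by rewrite hx hy subrr.
have h2 : a * (x + t) + b = 0.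
  apply: (@mulfI _ (x - t)); first by rewrite subr_eq0.
  rewrite mulr0; transitivity (a * x ^+ 2 + b * x + e - (a * t ^+ 2 + b * t + e)); first by ring.
  by rewrite hx ht subrr.
have a0 : a = 0.
  apply: (@mulfI _ (y - t)); first by rewrite subr_eq0.
  rewrite mulr0; transitivity (a * (x + y) + b - (a * (x + t) + b)); first by ring.
  by rewrite h1 h2 subrr.
have b0 : b = 0 by move: h1; rewrite a0 mul0r add0r.
by split => //; move: hx; rewrite a0 b0 !mul0r !add0r.
Qed.

(** * Three points of Gamma on the curve force Lambda onto the curve *)

Section ThreePoints.
Variables (R : realType) (z w c g1 g2 g3 : R[i]).
Hypotheses (zw : z != w) (c1 : cabs c = 1).
Hypotheses (g12 : g1 != g2) (g13 : g1 != g3) (g23 : g2 != g3).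
Hypotheses (h1 : concyclic_with z w c g1) (h2 : concyclic_with z w c g2).
Hypothesis h3 : concyclic_with z w c g3.

(** For real g the condition is a quadratic equation in g, so three solutions make all coefficients
    vanish. Then c = 1, z and w have equal imaginary parts, and the constant term gives Im w = 0
    because z and w differ. *)
Lemma concyclic_real : real_line R g1 -> real_line R g2 -> real_line R g3 ->
  Im w = 0.
Proof.
move=> r1 r2 r3.
have eqn g : concyclic_with z w c g -> real_line R g ->
    (1 - c) * g ^+ 2 + (c * (conjc z + w) - (z + conjc w)) * g +
    (z * conjc w - c * (conjc z * w)) = 0.
  move=> hg rg; have gJ : conjc g = g by rewrite (real_complexP rg) conjc_real.
  move: hg; rewrite /concyclic_with !conjcB gJ => /eqP.
  rewrite -subr_eq0 => /eqP <-; ring.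
have [] := quadratic_three_roots g12 g13 g23 (eqn _ h1 r1) (eqn _ h2 r2) (eqn _ h3 r3).
move=> /eqP; rewrite subr_eq0 => /eqP <-; rewrite !mul1r.
case: (z) (w) zw => [z1 z2] [w1 w2]; rewrite eq_complex /= => ne [_ e1] [_ e2].
have zw2 : z2 = w2 by lra.
have : w2 * (w1 - z1) = 0 by move: e2; rewrite zw2; lra.
move/eqP; rewrite mulf_eq0 => /orP[/eqP//|]; rewrite subr_eq0 => /eqP e.
by move: ne; rewrite e zw2 !eqxx.
Qed.

(** Multiplying by g and using g conj g = 1 makes the condition quadratic in g. Vanishing
    coefficients give z = c w and (c - 1)(|w|^2 - 1) = 0, and c = 1 would mean z = w. *)
Lemma concyclic_unit : unit_circle R g1 -> unit_circle R g2 ->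
  unit_circle R g3 -> cabs w = 1.
Proof.
move=> r1 r2 r3.
have eqn g : concyclic_with z w c g -> unit_circle R g ->
    (c * conjc z - conjc w) * g ^+ 2 +
    ((z * conjc w + 1) - c * (conjc z * w + 1)) * g + (c * w - z) = 0.
  move=> hg rg; have gJ : g * conjc g = 1 by rewrite mulcJ rg expr1n.
  move: hg; rewrite /concyclic_with !conjcB => /eqP; rewrite -subr_eq0 => /eqP.
  move=> /(congr1 (fun x => g * x)); rewrite mulr0 => <-.
  rewrite (_ : g * _ = (z - g) * (g * conjc w - g * conjc g) -
    c * ((g * conjc z - g * conjc g) * (w - g))); last by ring.
  by rewrite gJ; ring.
have [_] := quadratic_three_roots g12 g13 g23 (eqn _ h1 r1) (eqn _ h2 r2) (eqn _ h3 r3).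
move=> hb /eqP; rewrite subr_eq0 => /eqP zE.
have cc : c * conjc c = 1 by rewrite mulcJ c1 expr1n.
have : (c - 1) * (w * conjc w - 1) = 0.
  rewrite -[RHS]hb -zE conjcM.
  rewrite (_ : c * (conjc c * conjc w * w + 1) = (c * conjc c) * conjc w * w + c).
    by rewrite cc; ring.
  by ring.
move/eqP; rewrite mulf_eq0 => /orP[|].
  by rewrite subr_eq0 => /eqP cE; move: zw; rewrite -zE cE mul1r eqxx.
rewrite mulcJ subr_eq0 -[1]/(1%:C) (inj_eq (@complexI R)) sqrf_eq1.
by move=> /orP[/eqP//|/eqP h]; have := cabs_ge0 w; rewrite h ler0N1.
Qed.

End ThreePoints.

Lemma three_terms_injective (R : realType) (I : countType) (gamma : I -> R[i]) :
  injective gamma -> three_terms I -> exists i j k,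
  [/\ gamma i != gamma j, gamma i != gamma k & gamma j != gamma k].
Proof.
by move=> inj [i [j [k [ij ik jk]]]]; exists i, j, k; rewrite !(inj_eq inj).
Qed.

(** * A criterion for complex differentiability *)

Section ComplexDerivative.
Variable R : realType.

Lemma normc_cabs (z : R[i]) : `|z| = (cabs z)%:C.
Proof. by rewrite normc_def; case: z. Qed.

Lemma derivable_of_bound (f : R[i] -> R[i]) (z l : R[i]) (K r : R) : 0 < r ->
  (forall h, h != 0 -> cabs h < r ->
    cabs (h^-1 * (f (h + z) - f z) - l) <= K * cabs h) ->
  derivable (f : (R[i] : numFieldType) -> (R[i] : numFieldType)) z 1.
Proof.
move=> r0 hf; apply/cvg_ex; exists l; apply/cvgrPdist_le => /= eps eps0.
(* Positivity in [R[i]] includes being real, so the estimates can be made in [R]. *)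
have epsE : eps = (Re eps)%:C.
  by apply/real_complexP; move: eps0; rewrite ltcE /= => /andP[/eqP].
have e0 : 0 < Re eps by move: eps0; rewrite epsE ltcR.
pose del := Num.min r (Re eps / (`|K| + 1)).
have K1 : 0 < `|K| + 1 by rewrite ltr_wpDl.
have del0 : 0 < del by rewrite lt_min r0 divr_gt0.
have dC : 0 < del%:C by rewrite ltcR.
near=> h.
have h0 : h != 0 by near: h; exact: (@nbhs_dnbhs_neq (R[i] : numFieldType) 0).
have hd : cabs h < del.
  rewrite -ltcR -normc_cabs; near: h.
  exact: (@dnbhs0_lt (R[i] : numFieldType) (R[i] : numFieldType) _ dC).
have hr : cabs h < r by rewrite (lt_le_trans hd)// ge_min lexx.
have he : cabs h * (`|K| + 1) <= Re eps.
  by rewrite -ler_pdivlMr// ltW// (lt_le_trans hd)// ge_min lexx orbT.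
rewrite epsE normc_cabs lecR cabsB.
rewrite [h *: _](_ : _ = h); last exact: mulr1.
apply: le_trans (hf h h0 hr) _; apply: le_trans he.
rewrite mulrC ler_wpM2l ?cabs_ge0//.
by rewrite (le_trans (ler_norm _))// lerDl.
Unshelve. all: by end_near. Qed.

End ComplexDerivative.

(** The passage to the limit y -> 0+, in the form used for every approach to the boundary curve. *)
Lemma le_of_small (R : realType) (a b c : R) :
  (forall y, 0 < y < 1 -> a <= b + y * c) -> a <= b.
Proof.
move=> h; apply/ler_addgt0Pr => e e0.
pose d := `|c| + 1; have d0 : 0 < d by rewrite ltr_wpDl.
have dl : c <= d by rewrite (le_trans (ler_norm _))// lerDl.
pose y := Num.min (1 / 2) (e / d).
have y0 : 0 < y by rewrite lt_min !divr_gt0.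
have y1 : y < 1.
  by rewrite (@le_lt_trans _ _ (1 / 2))// ?ge_min ?lexx// ltr_pdivrMr// mul1r ltr1n.
have ye : y * d <= e by rewrite -ler_pdivlMr// ge_min lexx orbT.
apply: le_trans (h y _) _; first by rewrite y0.
by rewrite lerD2l (le_trans _ ye)// ler_wpM2l// ltW.
Qed.

(* The half-plane and the disk, treated simultaneously: [C] is the boundary curve
   and [D] the domain, [kap z w] is [w - z^*] for the line and [i (1 - z^* w)] for
   the circle, and [k g] is the Herglotz kernel with pole [g]. *)
Record herglotz_frame (R : realType) (C D : set R[i])
    (kap k : R[i] -> R[i] -> R[i]) : Prop := HerglotzFrame {
  kap_conj : forall z w, conjc (kap z w) = - kap w z;
  kap_diag : forall z, C z <-> kap z z = 0;
  kap_domain : forall z, D z -> 0 < Im (kap z z);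
  kap_curve : forall l z w, C l ->
    kap z l * kap l w = - ((w - l) * conjc (z - l));
  kap_affine : forall z, exists A B, forall w, kap z w = A + B * w;
  kernel_diff : forall g z w, C g -> z != g -> w != g ->
    k g w - conjc (k g z) = kap z w / ((w - g) * conjc (z - g));
  kernel_base : exists2 z0, D z0 & forall g, C g -> Re (k g z0) = 0;
  domain_dist : forall z, D z ->
    exists2 d, 0 < d & forall g, C g -> d <= cabs (z - g);
  approach : forall t y, C t -> 0 < y < 1 -> exists z, [/\ D z,
    cabs (z - t) = y, forall g, C g -> y <= cabs (z - g) &
    2 * y - y ^+ 2 <= Im (kap z z)] }.

(** * Herglotz sums over points of the curve with given masses *)

Section Transform.
Variables (R : realType) (C D : set R[i]) (kap k : R[i] -> R[i] -> R[i]).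
Hypothesis F : herglotz_frame C D kap k.
Variables (T : choiceType) (S : set T) (tau : T -> R[i]) (m : T -> R).
Hypothesis tauC : forall t, S t -> C (tau t).
Hypothesis m_ge0 : forall t, S t -> 0 <= m t.

Lemma kap_real z : Re (kap z z) = 0.
Proof.
by have := congr1 (@complex.Re R) (kap_conj F z z); rewrite ReJ ReN; lra.
Qed.

Lemma kap_imag z : kap z z = 'i * (Im (kap z z))%:C.
Proof. by have := kap_real z; case: (kap z z) => a b /= ->; simpc. Qed.

Lemma cabs_kapC z w : cabs (kap z w) = cabs (kap w z).
Proof. by rewrite -cabsJ (kap_conj F) cabsN. Qed.

(** The case w = z of [kap_curve]: its left side has modulus |kap l z|^2, since exchanging the
    arguments of kap preserves the modulus. *)
Lemma cabs_kap_curve l z : C l -> cabs (kap l z) = cabs (z - l).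
Proof.
move=> Cl; have := congr1 (@ComplexField.Normc.normc R) (kap_curve F z z Cl).
rewrite cabsN !cabsM cabsJ [cabs (kap z l)]cabs_kapC => /eqP.
by rewrite -!expr2 eqrXn2 ?cabs_ge0// => /eqP.
Qed.

Definition mass z t := m t / cabs (z - tau t) ^+ 2.
Definition admissible z :=
  (forall t, S t -> z != tau t) /\ nnsummable S (mass z).
(** This is phi for tau = gamma and m = v, and the integral in the Herglotz representation when the
    tau t are the atoms. *)
Definition transform z := csum S (fun t => (m t)%:C * k (tau t) z).
Definition tdot z w :=
  csum S (fun t => (m t)%:C / ((w - tau t) * conjc (z - tau t))).

Lemma mass_ge0 z t : S t -> 0 <= mass z t.
Proof. by move=> St; rewrite divr_ge0 ?m_ge0// sqr_ge0. Qed.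

Lemma tdot_summable z w : admissible z -> admissible w ->
  csummable S (fun t => (m t)%:C / ((w - tau t) * conjc (z - tau t))).
Proof.
move=> [zt sz] [wt sw].
apply: le_nnsummable (nnsummableD _ _ sz sw) => [t St|t St|t St];
  do ?exact: mass_ge0.
rewrite cabs_div !cabsM cabsJ cabs_nneg ?m_ge0// /mass -mulrDr.
rewrite ler_wpM2l ?m_ge0// invfM -!exprVn.
have := sqr_ge0 ((cabs (z - tau t))^-1 - (cabs (w - tau t))^-1).
have : 0 <= (cabs (z - tau t))^-1 by rewrite invr_ge0 cabs_ge0.
have : 0 <= (cabs (w - tau t))^-1 by rewrite invr_ge0 cabs_ge0.
nra.
Qed.

Lemma tdot_diag z : admissible z -> tdot z z = (nnsum S (mass z))%:C.
Proof.
move=> [zt sz]; rewrite -csum_nneg//; last exact: mass_ge0.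
by apply: eq_csum => t _; rewrite mulcJ /mass real_complexM real_complexV.
Qed.

(** At the base point the kernel is purely imaginary, so it equals half of kap z0 z0 / |z0 - tau|^2.
    Hence the kernel at z is a combination of the terms of tdot z0 z and tdot z0 z0. *)
Lemma transform_summable z z0 : admissible z -> admissible z0 ->
  (forall g, C g -> Re (k g z0) = 0) ->
  csummable S (fun t => (m t)%:C * k (tau t) z).
Proof.
move=> az az0 base; have [[zt sz] [z0t sz0]] := (az, az0).
have s1 := csummableZ (kap z0 z) (tdot_summable az0 az).
have s2 := csummableZ (- kap z0 z0 / 2) (tdot_summable az0 az0).
apply: eq_csummable (csummableD s1 s2) => t St.
have Ct := tauC St.
have E1 := kernel_diff F Ct (z0t t St) (zt t St).
have E0 := kernel_diff F Ct (z0t t St) (z0t t St).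
have kJ : conjc (k (tau t) z0) = - k (tau t) z0.
  by apply: eq_complexP; rewrite ?ReJ ?ImJ ?ReN ?ImN ?base ?oppr0.
rewrite kJ opprK in E1; rewrite kJ opprK in E0.
transitivity ((m t)%:C * (kap z0 z / ((z - tau t) * conjc (z0 - tau t)) -
    kap z0 z0 / ((z0 - tau t) * conjc (z0 - tau t)) / 2)); first by ring.
by rewrite -E1 -E0; congr (_ * _); field.
Qed.

Lemma transform_diff z w : (exists2 z0, admissible z0 &
    forall g, C g -> Re (k g z0) = 0) ->
  admissible z -> admissible w ->
  transform w - conjc (transform z) = kap z w * tdot z w.
Proof.
move=> [z0 az0 base] az aw.
have sz := transform_summable az az0 base.
have sw := transform_summable aw az0 base.
rewrite /transform -csumJ -csumB//; last exact: csummableJ.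
rewrite /tdot -csumZ; last exact: tdot_summable.
apply: eq_csum => t St; rewrite conjcM conjc_real -mulrBr.
have [[zt _] [wt _]] := (az, aw).
rewrite (kernel_diff F (tauC St) (zt t St) (wt t St)).
by rewrite mulrCA.
Qed.

Lemma Im_transform z : (exists2 z0, admissible z0 &
    forall g, C g -> Re (k g z0) = 0) ->
  admissible z -> 2 * Im (transform z) = Im (kap z z) * nnsum S (mass z).
Proof.
move=> base az; have := transform_diff base az az.
rewrite tdot_diag// => /(congr1 (@complex.Im R)).
rewrite ImD ImN ImJ opprK ImM /= mulr0 add0r => <-.
by rewrite mulr_natl.
Qed.

Lemma dist_admissible z d : 0 < d -> (forall t, S t -> d <= cabs (z - tau t)) ->
  nnsummable S (fun t => m t / (1 + cabs (tau t) ^+ 2)) -> admissible z.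
Proof.
move=> d0 hd ms; split=> [t St|].
  by rewrite -subr_eq0 -cabs_gt0 (lt_le_trans d0) ?hd.
(* From |tau|^2 <= 2 |z|^2 + 2 |z - tau|^2 and |z - tau| >= d, the ratio (1 + |tau|^2) / |z - tau|^2
   is at most K. *)
pose K := d ^- 2 + 2 * cabs z ^+ 2 * d ^- 2 + 2.
have K0 : 0 <= K.
  by rewrite /K !addr_ge0// ?mulr_ge0 ?exprn_ge0 ?invr_ge0 ?cabs_ge0 ?ltW// exprn_gt0.
have b0 t : 0 < 1 + cabs (tau t) ^+ 2 by rewrite ltr_pwDl// sqr_ge0.
have h t : S t -> 0 <= m t / (1 + cabs (tau t) ^+ 2).
  by move=> St; rewrite divr_ge0 ?m_ge0// ltW.
apply: le_nnsummable (nnsummableZ K0 h ms) => t St.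
have dn := hd t St; rewrite /mass; set a := cabs (z - tau t) in dn *.
have a0 : 0 < a by exact: lt_le_trans dn.
have bn := b0 t.
rewrite -subr_ge0 (_ : _ - _ =
  m t * (K * a ^+ 2 - (1 + cabs (tau t) ^+ 2)) / (a ^+ 2 * (1 + cabs (tau t) ^+ 2))).
  rewrite divr_ge0//; last by rewrite mulr_ge0 ?sqr_ge0// ltW.
  rewrite mulr_ge0 ?m_ge0// subr_ge0.
  have g2 : cabs (tau t) ^+ 2 <= 2 * cabs z ^+ 2 + 2 * a ^+ 2.
    rewrite (_ : tau t = z + (- (z - tau t))); last by ring.
    by apply: le_trans (cabs_sqrD _ _) _; rewrite cabsN.
  have a2 : 1 <= d ^- 2 * a ^+ 2.
    by rewrite mulrC ler_pdivlMr ?exprn_gt0// mul1r lerXn2r// nnegrE ltW.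
  have := sqr_ge0 (cabs z); rewrite /K; nra.
by field; rewrite !gt_eqF.
Qed.

End Transform.

(** * Kernels at the level sets of phi *)

Section Frame.
Variables (R : realType) (C D : set R[i]) (kap k : R[i] -> R[i] -> R[i]).
Hypothesis F : herglotz_frame C D kap k.
Variables (I : countType) (gamma : I -> R[i]) (v : I -> R).
Hypothesis gamma_inj : injective gamma.
Hypothesis two_terms : exists i j : I, i != j.
Hypothesis v_gt0 : forall n, 0 < v n.
Hypothesis v_sum :
  (\esum_(n in [set: I]) (v n / (1 + cabs (gamma n) ^+ 2))%:E < +oo)%E.
Hypothesis gammaC : forall n, C (gamma n).

Let v_ge0 n : [set: I] n -> 0 <= v n. Proof. by move=> _; exact: ltW. Qed.
Let v_gt0S n : [set: I] n -> 0 < v n. Proof. by []. Qed.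
Let gammaCS n : [set: I] n -> C (gamma n). Proof. by []. Qed.

Local Notation phi := (transform k [set: I] gamma v).
Local Notation Lambda alpha := (level_set gamma v phi alpha).
Local Notation nk z := (normsq [set: I] v (kvec gamma z)).

Lemma star_admissible z : star gamma v z -> admissible [set: I] gamma v z.
Proof. by move=> [h1 h2]; split. Qed.

Lemma dist_star z d : 0 < d -> (forall n, d <= cabs (z - gamma n)) ->
  star gamma v z.
Proof.
by move=> d0 hd; have [h1 h2] := @dist_admissible _ _ [set: I] gamma v v_ge0 z d
  d0 (fun n _ => hd n) v_sum; split=> [n|]; [exact: h1|exact: h2].
Qed.

Lemma domain_star z : D z -> star gamma v z.
Proof. by move=> /(domain_dist F)[d d0 hd]; apply: (dist_star d0) => n; exact: hd. Qed.

Lemma nk_mass z : nk z = nnsum [set: I] (mass gamma v z).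
Proof. by apply: eq_nnsum => n _; rewrite normsq_kvecE. Qed.

Lemma base_point : exists2 z0, admissible [set: I] gamma v z0 &
  forall g, C g -> Re (k g z0) = 0.
Proof.
by have [z0 Dz0 h] := kernel_base F; exists z0 => //; exact/star_admissible/domain_star.
Qed.

Lemma phi_diff z w : star gamma v z -> star gamma v w ->
  phi w - conjc (phi z) =
  kap z w * l2dot [set: I] v (kvec gamma z) (kvec gamma w).
Proof.
move=> sz sw; rewrite (transform_diff F gammaCS v_ge0 base_point);
  try exact: star_admissible.
congr (_ * _); apply: eq_csum => n _; rewrite conjc_kvec /kvec invfM; ring.
Qed.

Lemma Im_phi z : star gamma v z -> 2 * Im (phi z) = Im (kap z z) * nk z.
Proof.
move=> sz; rewrite nk_mass (Im_transform F gammaCS v_ge0 base_point)//.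
exact: star_admissible.
Qed.

Lemma Im_phi_gt0 z : D z -> 0 < Im (phi z).
Proof.
move=> Dz; have := Im_phi (domain_star Dz) => h.
have : 0 < 2 * Im (phi z).
  rewrite h mulr_gt0 ?(kap_domain F)//.
  by apply: normsq_kvec_gt0 => //; exact: domain_star.
by rewrite pmulr_rgt0.
Qed.

Lemma phi_curve_real z : star gamma v z -> C z -> conjc (phi z) = phi z.
Proof.
move=> sz /(kap_diag F) k0; have := phi_diff sz sz.
by rewrite k0 mul0r => /eqP; rewrite subr_eq0 => /eqP <-.
Qed.

(** Where phi is real, [Im_phi] gives Im (kap z z) = 0, as the norm of e_z is positive. *)
Lemma level_curve alpha z : Lambda alpha z -> C z.
Proof.
move=> [sz pz]; apply/(kap_diag F); have := Im_phi sz.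
rewrite pz /= mulr0 => /esym/eqP; rewrite mulf_eq0 [nk z == 0]gt_eqF ?orbF; last first.
  exact: normsq_kvec_gt0.
by move=> /eqP h; rewrite (kap_imag F) h mulr0.
Qed.

Lemma level_sub_star alpha : Lambda alpha `<=` star gamma v.
Proof. by move=> z []. Qed.

Lemma kap_neq0 z w : C z -> z != w -> kap z w != 0.
Proof.
by move=> Cz zw; rewrite -cabs_eq0 (cabs_kap_curve F)// cabs_eq0 subr_eq0 eq_sym.
Qed.

Lemma level_orthogonal alpha : orthogonal_kernels gamma v (Lambda alpha).
Proof.
move=> z w Lz Lw zw; have [[sz pz] [sw pw]] := (Lz, Lw).
have := phi_diff sz sw; rewrite pz pw conjc_real subrr => /esym/eqP.
by rewrite mulf_eq0 (negbTE (kap_neq0 (level_curve Lz) zw)) => /eqP.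
Qed.

(* On the curve, orthogonality means that phi takes the same real value. *)
Lemma basis_level L : L `<=` star gamma v -> L `<=` C ->
  orthogonal_kernels gamma v L -> total_kernels gamma v L ->
  exists alpha, L = Lambda alpha.
Proof.
move=> Ls LC orth tot.
have [z0 [_ [Lz0 _ _]]] := total_two_points v_gt0 two_terms gamma_inj Ls tot.
have r0 := phi_curve_real (Ls _ Lz0) (LC _ Lz0).
exists (Re (phi z0)); apply/seteqP.
have p0 : phi z0 = (Re (phi z0))%:C by apply/real_complexP/conj_id_real.
have sub : L `<=` Lambda (Re (phi z0)).
  move=> z Lz; split; first exact: Ls.
  have [->//|zz] := eqVneq z z0.
  rewrite -p0; have := phi_diff (Ls _ Lz0) (Ls _ Lz).
  rewrite (orth _ _ Lz0 Lz) 1?eq_sym// mulr0 r0 => /eqP.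
  by rewrite subr_eq0 => /eqP.
split=> // z Lz; apply: contrapT => nLz.
have [i _] := two_terms; have [sz _] := Lz.
have /negP := kvec_neq0 i sz; apply; apply/eqP.
apply: (tot (kvec gamma z)) => //; first exact: l2_kvec.
move=> w Lw; apply: (level_orthogonal Lz (sub _ Lw)).
by apply/eqP => zw; apply: nLz; rewrite zw.
Qed.

(** The inclusion in the curve is assumed only for bases: three points of Gamma enforce it, while
    for two points the theorem imposes it on [Lambda]. *)
Lemma basis_levelP L : coefs_determined gamma v ->
  (rkernel_basis gamma v L -> L `<=` C) ->
  rkernel_basis gamma v L <->
  exists alpha, L = Lambda alpha /\ unitary_transform gamma v phi alpha.
Proof.
move=> cok LC; split=> [bL|[alpha [-> U]]]; last first.
  by apply/rkernel_basisP => //; split => //; exact: level_sub_star.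
have := bL => /rkernel_basisP-/(_ v_gt0 two_terms cok)[Ls U].
have := U => /(unitary_kernelsP v_gt0 two_terms Ls)[orth tot].
have [alpha LE] := basis_level Ls (LC bL) orth tot.
by exists alpha; split; rewrite ?/unitary_transform -?LE.
Qed.

Lemma inv_sub_neq0 (alpha : R) z : D z -> alpha%:C - phi z != 0.
Proof.
move=> /Im_phi_gt0 h; apply/eqP => /(congr1 (@complex.Im R)).
by rewrite ImD ImN /= add0r => /eqP; rewrite oppr_eq0 gt_eqF.
Qed.

Lemma Im_inv (z : R[i]) : z != 0 -> Im z^-1 = - Im z / cabs z ^+ 2.
Proof.
by rewrite cabs_sqr; case: z => a b _ /=; rewrite mulNr.
Qed.

Lemma Im_inv_phi (alpha : R) z : D z ->
  Im (alpha%:C - phi z)^-1 = Im (phi z) / cabs (alpha%:C - phi z) ^+ 2.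
Proof.
by move=> Dz; rewrite Im_inv ?inv_sub_neq0// ImD ImN /= add0r opprK.
Qed.

(** * Unitarity gives an atomic representation of the reciprocal *)

Section Forward.
Variable alpha : R.
Hypothesis U : unitary_transform gamma v phi alpha.
Let L := Lambda alpha.
Let w := weight gamma v.

Let Ls : L `<=` star gamma v. Proof. exact: level_sub_star. Qed.

Lemma weight_ge0 l : 0 <= w l.
Proof.
by rewrite invr_ge0; apply/fine_ge0/esum_ge0 => n _;
  rewrite lee_fin divr_ge0 ?sqr_ge0// ltW.
Qed.

Lemma ht_level z l : D z -> L l ->
  hilbert_transform gamma v (kvec gamma z) l = (alpha%:C - conjc (phi z)) / kap z l.
Proof.
move=> Dz [sl pl]; have sz := domain_star Dz.
rewrite hilbert_transformE -pl (phi_diff sz sl) mulrAC mulfV ?mul1r//.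
have Cl := level_curve (conj sl pl).
rewrite -cabs_eq0 (cabs_kapC F) cabs_eq0 kap_neq0//; apply/eqP => lz.
have := kap_domain F Dz; rewrite -lz.
by have := (kap_diag F l).1 Cl => ->; rewrite ltxx.
Qed.

Lemma domain_curve z l : D z -> C l -> z != l.
Proof.
move=> Dz Cl; apply/eqP => zl; have := kap_domain F Dz.
by rewrite zl ((kap_diag F l).1 Cl) ltxx.
Qed.

(** The transform of e_z at l has modulus |alpha - phi(z)| / |z - l|; since it lies in l^2 with
    weight w, the sum of w_l / |z - l|^2 is finite. *)
Lemma level_admissible z : D z -> admissible L id w z.
Proof.
move=> Dz; have sz := domain_star Dz; split.
  by move=> l Ll; apply: domain_curve => //; exact: level_curve Ll.
have [Ul2 _ _] := U; have := Ul2 _ (l2_kvec sz).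
pose q := cabs (alpha%:C - conjc (phi z)) ^+ 2.
have q0 : 0 < q.
  rewrite exprn_gt0// cabs_gt0 -conjc_eq0 conjcB conjcK conjc_real.
  exact: inv_sub_neq0.
have qV : 0 <= q^-1 by rewrite invr_ge0 ltW.
move=> /(nnsummableZ qV) => h; apply: eq_nnsummable (h _).
  move=> l Ll; rewrite ht_level// cabs_div (cabs_kapC F).
  rewrite (cabs_kap_curve F _ (level_curve Ll)) expr_div_n -/q /mass.
  by rewrite -mulrA mulKf ?gt_eqF// mulrC.
by move=> l _; rewrite mulr_ge0 ?sqr_ge0// weight_ge0.
Qed.

Lemma level_base : exists2 z0, admissible L id w z0 &
  forall g, C g -> Re (k g z0) = 0.
Proof.
by have [z0 Dz0 h] := kernel_base F; exists z0 => //; exact: level_admissible.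
Qed.

(* Parseval's identity for the kernels at z and u gives the difference
   quotients of both sides. *)
Lemma unitary_representation : exists b : R, forall z, D z ->
  (alpha%:C - phi z)^-1 = b%:C + transform k L id w z.
Proof.
have LC l : L l -> C (id l) by exact: level_curve.
have w0 l : L l -> 0 <= w l by move=> _; exact: weight_ge0.
pose psi z := (alpha%:C - phi z)^-1.
have key z u : D z -> D u ->
    psi u - conjc (psi z) = transform k L id w u - conjc (transform k L id w z).
  move=> Dz Du; have [sz su] := (domain_star Dz, domain_star Du).
  have [az au] := (level_admissible Dz, level_admissible Du).
  rewrite (transform_diff F LC w0 level_base az au).
  have [Ul2 Uiso _] := U.
  have parseval := Uiso _ _ (l2_kvec sz) (l2_kvec su).
  have nz : alpha%:C - conjc (phi z) != 0.
    by rewrite -conjc_eq0 conjcB conjcK conjc_real inv_sub_neq0.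
  have nu := inv_sub_neq0 alpha Du.
  have -> : tdot L id w z u = l2dot [set: I] v (kvec gamma z) (kvec gamma u) /
      ((alpha%:C - conjc (phi z)) * (alpha%:C - phi u)).
    rewrite -parseval; apply: (@mulIf _ ((alpha%:C - conjc (phi z)) * (alpha%:C - phi u))).
      by rewrite mulf_neq0.
    rewrite divfK ?mulf_neq0// -csumZr; last exact: tdot_summable.
    apply: eq_csum => l Ll; have Cl := level_curve Ll.
    rewrite !ht_level// conjcM conjcV (kap_conj F) conjcB conjcK conjc_real.
    have Ekap := kap_curve F z u Cl.
    have zl : z - l != 0 by rewrite subr_eq0 domain_curve.
    have ul : u - l != 0 by rewrite subr_eq0 domain_curve.
    have kz : kap z l != 0.
      by rewrite -cabs_eq0 (cabs_kapC F) (cabs_kap_curve F)// cabs_eq0.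
    have ku : kap l u != 0 by rewrite -cabs_eq0 (cabs_kap_curve F)// cabs_eq0.
    rewrite (_ : (u - id l) * conjc (z - id l) = - (kap z l * kap l u)); last first.
      by rewrite Ekap opprK.
    rewrite -/(w l); move: (conjc (phi z)) (kap z l) (kap l u) kz ku => p x y x0 y0.
    by field; rewrite x0 y0.
  have := phi_diff sz su; set X := l2dot _ _ _ _.
  rewrite /psi conjcV conjcB conjc_real => E.
  rewrite mulrA -E; move: nz nu; move: (conjc (phi z)) => p nz nu.
  by field; rewrite nz nu.
have [z0 Dz0 _] := kernel_base F.
pose c z := psi z - transform k L id w z.
(* Any two values of [c] on the domain are conjugate, also at the same point; so [c] is a real
   constant there. *)
have cJ z u : D z -> D u -> c u = conjc (c z).
  move=> Dz Du; apply/eqP; rewrite /c conjcB subr_eq addrAC -subr_eq opprK.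
  rewrite -subr_eq0 -[X in _ == X](subrr (psi u - conjc (psi z))) {2}(key _ _ Dz Du).
  by apply/eqP; ring.
have r0 : c z0 = (Re (c z0))%:C.
  by apply/real_complexP/conj_id_real; rewrite -(cJ z0 z0 Dz0 Dz0).
exists (Re (c z0)) => z Dz; rewrite -r0 (cJ z0 z0 Dz0 Dz0) -(cJ z0 z Dz0 Dz).
by rewrite /c subrK.
Qed.

End Forward.

(** A domination of y^2 / |z - gamma_n|^2, with y = |z - t|, by a constant times 1 / (1 +
    |gamma_n|^2), uniform as z approaches t. *)
Lemma approach_bound z t : C t -> cabs (z - t) < 1 ->
  (forall n, cabs (z - t) <= cabs (z - gamma n)) ->
  forall n, cabs (z - t) ^+ 2 * (1 + cabs (gamma n) ^+ 2) <=
    (3 + 2 * (cabs t + 1) ^+ 2) * cabs (z - gamma n) ^+ 2.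
Proof.
move=> Ct y1 hy n; have := hy n; have y0 := cabs_ge0 (z - t).
set y := cabs (z - t) in y1 y0 *; set a := cabs (z - gamma n) => ya.
have a0 : 0 <= a by exact: cabs_ge0.
have g2 : cabs (gamma n) ^+ 2 <= 2 * cabs z ^+ 2 + 2 * a ^+ 2.
  rewrite (_ : gamma n = z + (- (z - gamma n))); last by ring.
  by apply: le_trans (cabs_sqrD _ _) _; rewrite cabsN.
have zt : cabs z <= cabs t + 1.
  rewrite (_ : z = (z - t) + t); last by ring.
  by rewrite (le_trans (le_cabsD _ _))// addrC lerD2l ltW.
have z2 : cabs z ^+ 2 <= (cabs t + 1) ^+ 2.
  by rewrite lerXn2r// nnegrE ?cabs_ge0// addr_ge0// cabs_ge0.
have ya2 : y ^+ 2 <= a ^+ 2 by rewrite lerXn2r// nnegrE.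
have y2 : y ^+ 2 <= 1 by rewrite exprn_ile1// ltW.
have y20 : 0 <= y ^+ 2 by exact: sqr_ge0.
have z20 : 0 <= cabs z ^+ 2 by exact: sqr_ge0.
have h1 : y ^+ 2 * cabs (gamma n) ^+ 2 <= y ^+ 2 * (2 * cabs z ^+ 2 + 2 * a ^+ 2).
  exact: ler_wpM2l.
have h2 : y ^+ 2 * cabs z ^+ 2 <= a ^+ 2 * (cabs t + 1) ^+ 2 by exact: ler_pM.
have h3 : y ^+ 2 * a ^+ 2 <= a ^+ 2 by rewrite ler_piMl ?sqr_ge0.
nra.
Qed.

(* A coefficient sequence orthogonal to all kernels at points of D has a
   vanishing transform on D, whose residues at the points of Gamma are the
   [a k * v k]. *)
Lemma kernels_total a : l2 [set: I] v a ->
  (forall z, D z -> l2dot [set: I] v a (kvec gamma z) = 0) ->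
  forall n, a n = 0.
Proof.
move=> la ha i; apply/eqP; rewrite -cabs_eq0.
suff : cabs (a i) * v i <= 0.
  by rewrite pmulr_lle0// => h; rewrite eq_le h cabs_ge0.
pose Kc := 3 + 2 * (cabs (gamma i) + 1) ^+ 2.
have Kc0 : 0 <= Kc by rewrite addr_ge0// mulr_ge0// sqr_ge0.
pose q n := v n / (1 + cabs (gamma n) ^+ 2).
have b0 n : 0 < 1 + cabs (gamma n) ^+ 2 by rewrite ltr_pwDl// sqr_ge0.
have q0 n : [set: I] n -> 0 <= q n by move=> _; rewrite divr_ge0 ?ltW.
pose V := nnsum [set: I] q.
have V0 : 0 <= V by exact: nnsum_ge0.
pose f n := cabs (a n) ^+ 2 * v n.
have f0 n : [set: I] n -> 0 <= f n by exact: normsq_term_ge0.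
(* Two nested limits: [e] controls the l^2 tail of [a] outside a finite set [A], and y -> 0 then
   removes the contribution of [A]. *)
apply: (@le_of_small _ _ _ ((1 + Kc * V) / 2)) => e /andP[e0 e1].
have [A [fA _ tail]] := nnsum_tail f0 la (exprn_gt0 2 e0).
(* The 2 comes from |gamma_i - gamma_n| <= y + |z - gamma_n| <= 2 |z - gamma_n|. *)
pose d n := 2 * (cabs (a n) * v n / cabs (gamma i - gamma n)).
have d0 n : 0 <= d n.
  by rewrite mulr_ge0// divr_ge0 ?cabs_ge0// mulr_ge0 ?cabs_ge0// ltW.
rewrite add0r; apply: (@le_of_small _ _ _ (nnsum A d)) => y /andP[y0 y1].
have y01 : 0 < y < 1 by rewrite y0.
have [z [Dz zt hy _]] := approach F (gammaC i) y01.
have sz := domain_star Dz; have lz := l2_kvec sz.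
pose H n := a n * conjc (kvec gamma z n) * (v n)%:C.
have sH : csummable [set: I] H by exact: l2dot_summable.
pose H1 n := if n == i then H n else 0.
pose G n := if n == i then 0 else H n.
have sH1 : csummable [set: I] H1.
  by apply: (@csummable_single _ _ _ i) => n _ /negbTE; rewrite /H1 => ->.
have sG : csummable [set: I] G.
  by apply: le_nnsummable sH => n _; rewrite /G; case: ifP => // _; rewrite cabs0 cabs_ge0.
have cH n : cabs (H n) = cabs (a n) * v n / cabs (z - gamma n).
  rewrite /H !cabsM cabsJ cabs_kvec cabs_nneg; last exact: ltW.
  by rewrite mulrAC.
have HG : H i = - csum [set: I] G.
  apply/eqP; rewrite -addr_eq0 -(ha _ Dz); apply/eqP.
  transitivity (csum [set: I] H1 + csum [set: I] G).
    congr (_ + _); rewrite (@csum_single _ _ _ i) /H1 ?eqxx//.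
    by move=> n _ /negbTE ->.
  rewrite -csumD//; apply: eq_csum => n _; rewrite /H1 /G.
  by case: ifP => _; rewrite ?addr0 ?add0r.
have zi : z - gamma i != 0 by rewrite -cabs_gt0 zt.
rewrite (_ : cabs (a i) * v i = y * cabs (H i)); last first.
  by rewrite cH zt; field; rewrite gt_eqF.
rewrite HG cabsN.
have cG0 n : 0 <= cabs (G n) by exact: cabs_ge0.
apply: (@le_trans _ _ (nnsum [set: I] (fun n => y * cabs (G n)))).
  rewrite nnsumZ//; last exact: ltW.
  by rewrite ler_wpM2l ?(ltW y0)//; exact: le_cabs_csum.
have yG0 n : 0 <= y * cabs (G n) by rewrite mulr_ge0// ltW.
have syG : nnsummable [set: I] (fun n => y * cabs (G n)).
  by apply: nnsummableZ sG => //; exact: ltW.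
rewrite (nnsumID A)// addrC setTI; apply: lerD; last first.
  rewrite -nnsumZ//; [|exact: ltW|exact: nnsummable_fset].
  apply: le_nnsum; last by apply: nnsummable_fset => // n _; rewrite mulr_ge0 ?(ltW y0).
  move=> n _; rewrite yG0/= ler_wpM2l ?(ltW y0)// /G.
  have [_|ni] := eqVneq n i; first by rewrite cabs0 d0.
  rewrite cH /d mulrCA ler_wpM2l//; first by rewrite mulr_ge0 ?cabs_ge0 ?ltW.
  have r0 : 0 < cabs (z - gamma n) by apply: lt_le_trans (hy _ (gammaC n)).
  have g0 : 0 < cabs (gamma i - gamma n).
    by rewrite cabs_gt0 subr_eq0 (inj_eq gamma_inj) eq_sym.
  rewrite -[leLHS]mul1r ler_pdivrMr// mulrAC ler_pdivlMr// mul1r.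
  have := hy _ (gammaC n); have := le_cabs_dist (gamma i) (gamma n) z.
  by rewrite [cabs (gamma i - z)]cabsB zt; lra.
have zb := approach_bound (gammaC i).
(* The inequality of means with parameter [e], after [approach_bound]. Off [A] the sum of [f] is at
   most e^2, so the total there is at most e (1 + Kc V) / 2. *)
have bnd n : y * cabs (G n) <= (2 * e)^-1 * f n + e * Kc / 2 * q n.
  have r0 : 0 < cabs (z - gamma n) by apply: lt_le_trans (hy _ (gammaC n)).
  rewrite /G; have [_|ni] := eqVneq n i.
    rewrite cabs0 mulr0 addr_ge0// mulr_ge0 ?f0 ?q0//.
      by rewrite invr_ge0 mulr_ge0// ltW.
    by rewrite mulr_ge0// mulr_ge0// ltW.
  have := zb z _ _ n; rewrite zt => /(_ y1 (fun n => hy _ (gammaC n))).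
  rewrite -/Kc cH /f /q; have bn := b0 n.
  move: (cabs (a n)) (cabs (z - gamma n)) (1 + cabs (gamma n) ^+ 2) (v n)
    (v_gt0 n) r0 bn => x r b u u0 r0 bn hb.
  have s2 : (y / r) ^+ 2 <= Kc / b.
    by rewrite expr_div_n ler_pdivrMr ?exprn_gt0// mulrAC ler_pdivlMr.
  rewrite (_ : y * _ = u * (x * (y / r))); last by field; rewrite gt_eqF.
  rewrite (_ : _ + _ = u * (x ^+ 2 / e + e * (Kc / b)) / 2); last first.
    by field; rewrite !gt_eqF.
  rewrite -mulrA ler_pM2l//; apply: (@le_trans _ _ ((x ^+ 2 / e + e * (y / r) ^+ 2) / 2)).
    rewrite -subr_ge0 (_ : _ - _ = (x - e * (y / r)) ^+ 2 / (2 * e)).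
      by rewrite divr_ge0 ?sqr_ge0// mulr_ge0// ltW.
    by field; rewrite !gt_eqF.
  by rewrite ler_wpM2r ?invr_ge0// lerD2l ler_wpM2l// ltW.
have c1 : 0 <= (2 * e)^-1 by rewrite invr_ge0 mulr_ge0// ltW.
have c2 : 0 <= e * Kc / 2 by rewrite divr_ge0// mulr_ge0// ltW.
have sf : nnsummable ([set: I] `\` A) f by apply: nnsummable_sub la.
have sq : nnsummable ([set: I] `\` A) q by apply: nnsummable_sub v_sum.
have f0' n : ([set: I] `\` A) n -> 0 <= f n by move=> _; exact: f0.
have q0' n : ([set: I] `\` A) n -> 0 <= q n by move=> _; exact: q0.
apply: (@le_trans _ _ (nnsum ([set: I] `\` A)
    (fun n => (2 * e)^-1 * f n + e * Kc / 2 * q n))).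
  apply: le_nnsum => [n _|]; first by rewrite yG0 bnd.
  by apply: nnsummableD; try exact: nnsummableZ; move=> n ?; rewrite mulr_ge0 ?f0 ?q0.
rewrite nnsumD; first last.
- exact: nnsummableZ.
- exact: nnsummableZ.
- by move=> n ?; rewrite mulr_ge0 ?q0.
- by move=> n ?; rewrite mulr_ge0 ?f0.
rewrite !nnsumZ//.
have qV : nnsum ([set: I] `\` A) q <= V.
  rewrite /V (nnsumID A q0 v_sum) lerDr.
  by apply: nnsum_ge0 => n _; exact: q0.
apply: (@le_trans _ _ ((2 * e)^-1 * e ^+ 2 + e * Kc / 2 * V)).
  by apply: lerD; rewrite ler_wpM2l.
by rewrite le_eqVlt; apply/orP; left; apply/eqP; field; rewrite gt_eqF.
Qed.

(** For b > a one has b^2 - a^2 <= y (2 a + 1), and a^2 <= b^2 absorbs the remaining denominators.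
    This moves a term v_n / |z - gamma_n|^2 from z to a nearby boundary point. *)
Lemma le_inv_sqr_shift (a b y : R) : 0 < a -> 0 < b -> 0 < y < 1 -> b <= a + y ->
  a ^- 2 <= b ^- 2 + y * ((2 * a + 1) / a ^+ 4).
Proof.
move=> a0 b0 /andP[y0 y1] ba.
have [h|h] := leP b a.
  apply: (@le_trans _ _ (b ^- 2)).
    by rewrite lef_pV2 ?posrE ?exprn_gt0// lerXn2r// nnegrE ltW.
  rewrite lerDl mulr_ge0 ?(ltW y0)// divr_ge0 ?exprn_ge0 ?ltW//.
  by rewrite addr_gt0// mulr_gt0.
have ab : a ^+ 2 <= b ^+ 2 by rewrite lerXn2r ?nnegrE ?ltW.
rewrite -subr_ge0 (_ : _ - _ = (y * (2 * a + 1) * b ^+ 2 -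
  (b ^+ 2 - a ^+ 2) * a ^+ 2) / (a ^+ 4 * b ^+ 2)); last first.
  by field; rewrite !gt_eqF.
rewrite divr_ge0//; last by rewrite mulr_ge0// ?exprn_ge0 ?sqr_ge0 ?ltW.
have a20 : 0 <= a ^+ 2 by exact: sqr_ge0.
have d1 : b ^+ 2 - a ^+ 2 <= y * (2 * a + 1) by nra.
have d0 : 0 <= b ^+ 2 - a ^+ 2 by rewrite subr_ge0.
by rewrite subr_ge0 ler_pM.
Qed.

(** * An atomic representation of the reciprocal gives unitarity *)

Section Backward.
Variables (T : choiceType) (S : set T) (tau : T -> R[i]) (m : T -> R).
Variables (alpha b : R).
Hypothesis tauC : forall t, S t -> C (tau t).
Hypothesis m_gt0 : forall t, S t -> 0 < m t.
Hypothesis tau_inj : set_inj S tau.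
Hypothesis tau_adm : forall z, D z -> admissible S tau m z.
Hypothesis repr : forall z, D z ->
  (alpha%:C - phi z)^-1 = b%:C + transform k S tau m z.

Let m_ge0 t : S t -> 0 <= m t. Proof. by move=> /m_gt0/ltW. Qed.

Lemma atoms_base : exists2 z0, admissible S tau m z0 &
  forall g, C g -> Re (k g z0) = 0.
Proof. by have [z0 Dz0 h] := kernel_base F; exists z0 => //; exact: tau_adm. Qed.

(** The imaginary parts of the two sides of the representation, each of which contains the factor Im
    (kap z z). *)
Lemma nk_atoms z : D z ->
  nk z = nnsum S (mass tau m z) * cabs (alpha%:C - phi z) ^+ 2.
Proof.
move=> Dz; have sz := domain_star Dz.
have K0 : Im (kap z z) != 0 by rewrite gt_eqF// (kap_domain F).
have c0 : cabs (alpha%:C - phi z) ^+ 2 != 0.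
  by rewrite sqrf_eq0 cabs_eq0 inv_sub_neq0.
have h1 := Im_phi sz.
have := Im_transform F tauC m_ge0 atoms_base (tau_adm Dz).
have -> : Im (transform k S tau m z) = Im (alpha%:C - phi z)^-1.
  by rewrite repr// ImD /= add0r.
rewrite Im_inv_phi// mulrA h1 => h2; apply: (mulfI K0).
by rewrite mulrA -h2 divfK.
Qed.

Lemma cabs_atoms z : D z ->
  cabs (alpha%:C - phi z) * Im (kap z z) * nnsum S (mass tau m z) <= 2.
Proof.
move=> Dz; set c := cabs _.
have c0 : 0 < c by rewrite cabs_gt0 inv_sub_neq0.
have := Im_transform F tauC m_ge0 atoms_base (tau_adm Dz).
have -> : Im (transform k S tau m z) = Im (alpha%:C - phi z)^-1.
  by rewrite repr// ImD /= add0r.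
move=> h; rewrite -mulrA -h mulrC -ler_pdivlMr//.
rewrite ler_wpM2l// -cabsV.
by apply: le_trans (le_Im_cabs _); exact: ler_norm.
Qed.

(** Let M be the sum of the masses seen from z, K = Im (kap z z) and c = |alpha - phi(z)|, so that c
    K M <= 2. The atom alone gives M >= m / y^2, and K >= 2 y - y^2 gives K^2 M >= (2 - y)^2 m.
    Since |e_z|^2 = M c^2, the first bound is (c K M)^2 <= 4; the second follows from K >= y. *)
Lemma atom_estimate t y : S t -> 0 < y < 1 -> exists z, [/\ D z,
  cabs (z - tau t) = y, forall g, C g -> y <= cabs (z - g),
  nk z * (2 - y) ^+ 2 * m t <= 4 &
  cabs (alpha%:C - phi z) * m t <= 2 * y].
Proof.
move=> St y01; have [z [Dz zt hy Kz]] := approach F (tauC St) y01.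
exists z; split=> //.
all: have := cabs_atoms Dz; have := nk_atoms Dz.
all: have [_ sm] := tau_adm Dz.
all: have := nnsum_term (mass_ge0 tau m_ge0 z) sm St.
all: rewrite {1}/mass zt ler_pdivrMr; last by case/andP: y01 => y0 _; rewrite exprn_gt0.
all: have := cabs_ge0 (alpha%:C - phi z).
all: have := m_gt0 St; case/andP: y01 => y0 y1.
all: set c := cabs _; set M := nnsum _ _; set K := Im _ in Kz *; set mt := m t.
all: move=> m0 c0 Mm NE cKM.
  rewrite NE; have M0 : 0 <= M by apply: nnsum_ge0; exact: (mass_ge0 tau m_ge0 z).
  have K2 : (2 - y) ^+ 2 * mt <= K ^+ 2 * M.
    apply: (@le_trans _ _ ((2 - y) ^+ 2 * (M * y ^+ 2))).
      by rewrite ler_wpM2l// sqr_ge0.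
    rewrite (_ : _ * _ = (2 * y - y ^+ 2) ^+ 2 * M); last by ring.
    by rewrite ler_wpM2r// lerXn2r// nnegrE; nra.
  apply: (@le_trans _ _ ((c * K * M) ^+ 2)).
    rewrite (_ : (c * K * M) ^+ 2 = M * c ^+ 2 * (K ^+ 2 * M)); last by ring.
    by rewrite -mulrA ler_wpM2l// mulr_ge0// sqr_ge0.
  rewrite (_ : 4 = 2 ^+ 2); last by ring.
  by rewrite lerXn2r// nnegrE// !mulr_ge0//; nra.
have M0 : 0 <= M by apply: nnsum_ge0; exact: (mass_ge0 tau m_ge0 z).
have Ky : y <= K by nra.
rewrite -(ler_pM2r y0) -mulrA.
apply: (@le_trans _ _ (c * (K * (M * y ^+ 2)))).
  by rewrite ler_wpM2l// mulrC ler_pM// ltW.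
by rewrite (_ : c * _ = c * K * M * y ^+ 2); [nra|ring].
Qed.

(** At distance y from gamma_n the square norm of e_z is at least v_n / y^2, but near an atom it
    stays bounded. *)
Lemma atom_neq t n : S t -> tau t != gamma n.
Proof.
move=> St; apply/eqP => tg; suff : v n * m t <= 0.
  by rewrite leNgt mulr_gt0// m_gt0.
apply: (@le_of_small _ _ _ 4) => y y01; rewrite add0r.
have [z [Dz zt _ hN _]] := atom_estimate St y01.
have sz := domain_star Dz; case/andP: y01 => y0 y1.
have := nnsum_term (normsq_term_ge0 v_ge0 _) (l2_kvec sz) (Logic.I : [set: I] n).
rewrite normsq_kvecE -tg zt ler_pdivrMr ?exprn_gt0//.
rewrite -/(normsq _ _ _) => h; have m0 := m_gt0 St; have vn := v_gt0 n.
have N0 : 0 <= nk z by exact: normsq_ge0.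
move: (nk z) hN h N0 => N; move: (m t) m0 (v n) vn => mt m0 u u0 hN h N0.
have h1 : N * mt <= 4.
  apply: le_trans hN; rewrite -mulrA ler_wpM2l// ler_peMl ?ltW//; nra.
have : u * mt <= N * mt * y ^+ 2 by rewrite mulrAC ler_wpM2r// ltW.
move/le_trans; apply; nra.
Qed.

(** A Fatou argument: each finite partial sum at the atom is compared with the same sum at nearby z,
    which the norm of e_z bounds. *)
Lemma atom_star t : S t -> star gamma v (tau t) /\ nk (tau t) <= (m t)^-1.
Proof.
move=> St; have m0 := m_gt0 St.
have tn n : 0 < cabs (tau t - gamma n) by rewrite cabs_gt0 subr_eq0 atom_neq.
have h : forall A : set I, finite_set A -> A `<=` [set: I] ->
    \sum_(n \in A) v n / cabs (tau t - gamma n) ^+ 2 <= (m t)^-1.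
  move=> A fA _.
  pose c n := v n * ((2 * cabs (tau t - gamma n) + 1) / cabs (tau t - gamma n) ^+ 4).
  (* The 3 comes from 4 / (2 - y)^2 <= 1 + 3 y on the unit interval. *)
  apply: (@le_of_small _ _ _ (3 / m t + \sum_(n \in A) c n)) => y y01.
  have [z [Dz zt hy hN _]] := atom_estimate St y01; have sz := domain_star Dz.
  have N0 : 0 <= nk z by exact: normsq_ge0.
  have hA : \sum_(n \in A) v n / cabs (z - gamma n) ^+ 2 <= nk z.
    rewrite nk_mass; apply: nnsum_fin => // [n _|].
      by rewrite divr_ge0 ?sqr_ge0// ltW.
    by case: sz.
  apply: (@le_trans _ _ (nk z + y * \sum_(n \in A) c n)).
    apply: (@le_trans _ _ (\sum_(n \in A)
        (v n / cabs (z - gamma n) ^+ 2 + y * c n))).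
      rewrite !fsbig_finite//=; apply: ler_sum => n _.
      rewrite /c mulrCA -mulrDr ler_pM2l//.
      apply: le_inv_sqr_shift => //.
        by case/andP: y01 => y0 _; exact: lt_le_trans (hy _ (gammaC n)).
      by rewrite [leRHS]addrC -zt le_cabs_dist.
    by rewrite fsbig_split//= lerD// mulr_fsumr.
  rewrite mulrDr addrA lerD2r; case/andP: y01 => y0 y1.
  rewrite -(ler_pM2r m0) mulrDl mulVf ?gt_eqF// mulrA divfK ?gt_eqF//.
  move: (nk z) N0 hN => N N0; rewrite mulrAC => hN.
  have NM : 0 <= N * m t by rewrite mulr_ge0// ltW.
  move: (N * m t) NM hN => X X0 hX; have : 0 <= y * (1 - y) by nra.
  have : 1 <= (2 - y) ^+ 2 by nra.
  nra.
split; last first.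
  by rewrite nk_mass; apply: nnsum_le => // n _; rewrite divr_ge0 ?sqr_ge0// ltW.
split; first by move=> n; exact: atom_neq.
by apply: le_lt_trans (nnsummable_bound h) _; exact: ltry.
Qed.

(** Both |alpha - phi(z)| and |phi(z) - phi(tau t)^*| are at most 2 y / m. The second equals y
    |<e_t, e_z>| by [phi_diff], and Cauchy-Schwarz applies with square norms at most 1 / m and 4 /
    m. *)
Lemma atom_level t : S t -> Lambda alpha (tau t).
Proof.
move=> St; have [st nt] := atom_star St; split=> //.
suff h : cabs (alpha%:C - conjc (phi (tau t))) <= 0.
  have : alpha%:C - conjc (phi (tau t)) = 0.
    by apply/eqP; rewrite -cabs_eq0 eq_le h cabs_ge0.
  by move=> /eqP; rewrite subr_eq0 => /eqP e; rewrite -[LHS]conjcK -e conjc_real.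
have m0 := m_gt0 St.
apply: (@le_of_small _ _ _ (4 / m t)) => y y01; rewrite add0r.
have [z [Dz zt hy hN hc]] := atom_estimate St y01; have sz := domain_star Dz.
case/andP: y01 => y0 y1.
have N0 : 0 <= nk z by exact: normsq_ge0.
have N4 : nk z <= 4 / m t.
  rewrite ler_pdivlMr//; apply: le_trans hN.
  by rewrite -mulrA ler_wpM2l// ler_peMl ?ltW//; nra.
have d1 : cabs (phi z - conjc (phi (tau t))) <= y * (2 / m t).
  rewrite (phi_diff st sz) cabsM (cabs_kap_curve F _ (tauC St)) zt ler_wpM2l ?(ltW y0)//.
  rewrite -(@ler_pXn2r _ 2)// ?nnegrE ?cabs_ge0 ?divr_ge0 ?(ltW m0)//.
  apply: le_trans (cauchy_schwarz v_ge0 (l2_kvec st) (l2_kvec sz)) _.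
  rewrite (_ : (2 / m t) ^+ 2 = (m t)^-1 * (4 / m t)); last by field; rewrite gt_eqF.
  by apply: ler_pM => //; exact: normsq_ge0.
have d2 : cabs (alpha%:C - phi z) <= y * (2 / m t).
  by rewrite mulrA ler_pdivlMr// [y * 2]mulrC.
apply: le_trans (le_cabs_dist _ _ (phi z)) _; apply: le_trans (lerD d2 d1) _.
by rewrite -mulrDr -mulrDl -natrD.
Qed.

Lemma atoms_unitary : unitary_transform gamma v phi alpha.
Proof.
apply/(unitary_kernelsP v_gt0 two_terms (@level_sub_star alpha)).
split; first exact: level_orthogonal.
move=> a la ha n _; apply: (kernels_total la) => z Dz; have sz := domain_star Dz.
pose e t := kvec gamma (tau t).
have le2 t : S t -> l2 [set: I] v (e t).
  by move=> /atom_star[st _]; exact: l2_kvec.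
have egt0 t : S t -> 0 < normsq [set: I] v (e t).
  by move=> /atom_star[st _]; exact: normsq_kvec_gt0.
have orth : pairwise_orthogonal [set: I] v S e.
  move=> s t Ss St st; apply: level_orthogonal (atom_level Ss) (atom_level St) _.
  by apply: contra st => /eqP h; apply/eqP; apply: tau_inj; rewrite ?inE.
apply: (orthogonal_of_parseval v_gt0S le2 egt0 orth la (l2_kvec sz)); last first.
  by move=> t St; apply: ha; exact: atom_level.
rewrite nk_atoms// mulrC -nnsumZ ?sqr_ge0//; first last.
- by have [] := tau_adm Dz.
- exact: (mass_ge0 tau m_ge0 z).
(* Since phi is alpha at the atom, |alpha - phi(z)| = |z - tau t| |<e_z, e_t>|. So the comparison is
   term by term and reduces to m t <= wt. *)
apply: le_nnsum; last exact: (l2_coefs v_gt0S le2 egt0 orth (l2_kvec sz)).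
move=> t St; rewrite mulr_ge0 ?sqr_ge0 ?(mass_ge0 tau m_ge0 z St)//=.
have [st nt] := atom_star St; have [_ pt] := atom_level St.
have zt : z != tau t by apply: domain_curve => //; exact: tauC.
have z0 : 0 < cabs (z - tau t) by rewrite cabs_gt0 subr_eq0.
have -> : cabs (alpha%:C - phi z) ^+ 2 = cabs (coefs [set: I] v e (kvec gamma z) t) ^+ 2 *
    cabs (z - tau t) ^+ 2.
  rewrite -exprMn -(cabs_kap_curve F z (tauC St)) (cabs_kapC F) mulrC -cabsM.
  rewrite /coefs -(phi_diff sz st) pt; congr (_ ^+ 2).
  by rewrite -cabsJ conjcB conjc_real.
rewrite /mass -mulrA ler_wpM2l ?sqr_ge0// mulrCA mulfV ?mulr1; last first.
  by rewrite gt_eqF// exprn_gt0.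
by rewrite /wt -[m t]invrK lef_pV2 ?posrE ?invr_gt0 ?egt0 ?m_gt0.
Qed.

End Backward.

(** Termwise differentiation: the error of each difference quotient is h T_n / ((z - gamma_n)(z + h
    - gamma_n)). For |h| < d / 2 the denominator is at least d^2 / 2, whence the constant 2 /
    d^2. *)
Lemma hilbert_transform_derivable a (z : R[i]) d : 0 < d ->
  (forall n, d <= cabs (z - gamma n)) -> l2 [set: I] v a ->
  derivable (hilbert_transform gamma v a :
    (R[i] : numFieldType) -> (R[i] : numFieldType)) z 1.
Proof.
move=> d0 hd la; have sz := dist_star d0 hd.
have d20 : 0 < d / 2 by rewrite divr_gt0.
pose T z n := a n * (v n)%:C / (z - gamma n).
have sT w : star gamma v w -> csummable [set: I] (T w).
  move=> sw; apply: eq_csummable (l2dot_summable v_ge0 la (l2_kvec sw)) => n _.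
  by rewrite conjc_kvec /T mulrAC.
pose Q n := T z n / (z - gamma n).
have sQ : csummable [set: I] Q.
  have dV : 0 <= d^-1 by rewrite invr_ge0 ltW.
  have := nnsummableZ dV (fun n _ => cabs_ge0 (T z n)) (sT _ sz).
  apply: le_csummable => n _; rewrite /Q cabs_div mulrC ler_wpM2r ?cabs_ge0//.
  by rewrite lef_pV2// posrE// (lt_le_trans d0).
apply: (@derivable_of_bound _ _ _ (- csum [set: I] Q)
  (2 / d ^+ 2 * nnsum [set: I] (fun n => cabs (T z n))) (d / 2)) => // h h0 hr.
have hd2 n : d / 2 <= cabs (h + z - gamma n).
  have := hd n; have := le_cabs_dist z (gamma n) (h + z).
  rewrite (_ : z - (h + z) = - h) ?cabsN; last by ring.
  by move: hr; move: (cabs h) (cabs _) (cabs _) => x y w; lra.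
have szh := dist_star d20 hd2.
pose E n := h^-1 * (T (h + z) n - T z n) + Q n.
have EE n : E n = h * (T z n / ((z - gamma n) * (h + z - gamma n))).
  have n1 : z - gamma n != 0 by rewrite -cabs_gt0 (lt_le_trans d0).
  have n2 : h + z - gamma n != 0 by rewrite -cabs_gt0 (lt_le_trans d20).
  by rewrite /E /Q /T; field; rewrite h0 n1 n2.
have sB : csummable [set: I] (fun n => T (h + z) n - T z n).
  by apply: csummableD; [exact: sT|apply: csummableN; exact: sT].
have -> : h^-1 * (hilbert_transform gamma v a (h + z) -
    hilbert_transform gamma v a z) - - csum [set: I] Q = csum [set: I] E.
  rewrite opprK /hilbert_transform -/(T (h + z)) -/(T z) -csumB; [|exact: sT|exact: sT].
  rewrite -csumZ// -csumD//; exact: csummableZ.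
have sE : csummable [set: I] E.
  by apply: csummableD => //; exact: csummableZ.
apply: le_trans (le_cabs_csum sE) _.
have c0 : 0 <= 2 / d ^+ 2 * cabs h.
  by rewrite mulr_ge0 ?cabs_ge0// divr_ge0// ?sqr_ge0.
rewrite mulrAC -nnsumZ//; [|by move=> n _; exact: cabs_ge0|exact: sT].
apply: le_nnsum => [n _|]; last first.
  by apply: nnsummableZ => //; [move=> n _; exact: cabs_ge0|exact: sT].
rewrite cabs_ge0/= EE; move: (T z n) => t; rewrite cabsM cabs_div cabsM.
have p1 : 0 < cabs (z - gamma n) by exact: lt_le_trans (hd n).
have p2 : 0 < cabs (h + z - gamma n) by exact: lt_le_trans (hd2 n).
have -> : 2 / d ^+ 2 * cabs h * cabs t =
    cabs h * (cabs t * (d * (d / 2))^-1) by field; rewrite gt_eqF.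
rewrite ler_wpM2l ?cabs_ge0// ler_wpM2l ?cabs_ge0//.
rewrite lef_pV2 ?posrE ?mulr_gt0//.
by apply: ler_pM => //; exact: ltW.
Qed.

(** With z0 fixed, [phi_diff] and [kap_affine] write phi as a constant plus an affine function times
    the Hilbert transform of the kernel vector at z0. *)
Lemma phi_holomorphic z : D z ->
  derivable (phi : (R[i] : numFieldType) -> (R[i] : numFieldType)) z 1.
Proof.
move=> Dz; have [d d0 hd] := domain_dist F Dz.
have [z0 Dz0 _] := kernel_base F; have sz0 := domain_star Dz0.
have [A [B kE]] := kap_affine F z0.
pose G := hilbert_transform gamma v (kvec gamma z0).
have dG : derivable (G : (R[i] : numFieldType) -> (R[i] : numFieldType)) z 1.
  apply: (hilbert_transform_derivable d0) => [n|]; first exact: hd.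
  exact: l2_kvec.
pose g (w : (R[i] : numFieldType)) : (R[i] : numFieldType) :=
  conjc (phi z0) + (A + B * w) * G w.
apply: (@near_eq_derivable _ _ _ g).
  have e0 : 0 < (d / 2)%:C by rewrite ltcR divr_gt0.
  exists (d / 2)%:C => //= w /=; rewrite normc_cabs ltcR => hw.
  have d20 : 0 < d / 2 by rewrite divr_gt0.
  have sw : star gamma v w.
    apply: (dist_star d20) => n; have := hd _ (gammaC n).
    have := le_cabs_dist z (gamma n) w.
    by move: hw; move: (cabs _) (cabs _) (cabs _) => x y t; lra.
  have := phi_diff sz0 sw; rewrite kE /g /G hilbert_transformE /coefs => <-.
  by rewrite addrC subrK.
pose K : numFieldType := R[i].
pose f1 : K -> K := fun w => A + B * w.
have d1 : derivable f1 z 1.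
  apply: (@derivableD K K K (cst (A : K)) (cst (B : K) * id) z 1).
    exact: derivable_cst.
  apply: (@derivableM K K (cst (B : K)) id z 1); first exact: derivable_cst.
  exact: derivable_id.
apply: (@derivableD K K K (cst (conjc (phi z0) : K)) (f1 * (G : K -> K)) z 1).
  exact: derivable_cst.
exact: (@derivableM K K f1 G z 1 d1 dG).
Qed.

Lemma herglotz_inv (alpha : R) : herglotz D (fun z => (alpha%:C - phi z)^-1).
Proof.
split=> z Dz; last first.
  rewrite Im_inv_phi// divr_gt0 ?Im_phi_gt0// exprn_gt0// cabs_gt0.
  exact: inv_sub_neq0.
pose K : numFieldType := R[i].
apply: (@derivableV K K (fun w => (alpha%:C : K) - phi w) z 1).
  exact: inv_sub_neq0.
apply: (@derivableB K K K (cst (alpha%:C : K)) (phi : K -> K) z 1).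
  exact: derivable_cst.
exact: phi_holomorphic.
Qed.

End Frame.

(** * Integration against purely atomic measures *)

Section AtomicMeasure.
Variable R : realType.
Local Notation TR := (measurableTypeR R).
Implicit Types (mu : {measure set TR -> \bar R}) (D : set TR).

Lemma integral_atom mu (t : R) (f : TR -> \bar R) :
  (\int[mu]_(x in [set t]) f x = f t * mu [set t])%E.
Proof.
transitivity (\int[mu]_(x in [set t]) cst (f t) x)%E.
  by apply: eq_integral => x; rewrite inE => ->.
by rewrite integral_cst//; exact: measurable_set1.
Qed.

Lemma ge0_integral_atomic mu D (f : TR -> \bar R) :
  measurable D -> purely_atomic mu D ->
  countable [set t | D t /\ mu [set t] != 0%E] -> (forall t, 0 <= f t)%E ->
  measurable_fun D f ->
  (\int[mu]_(t in D) f t = \esum_(t in D) (f t * mu [set t]))%E.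
Proof.
move=> mD aD cN f0 mf; set N := [set t | _] in cN.
have mN : measurable N.
  by apply: countable_measurable => // t; exact: measurable_set1.
have ND : N `<=` D by move=> t [].
have mDN : measurable (D `\` N) by exact: measurableD.
have DE : N `|` (D `\` N) = D by exact: setDUK.
have fm0 t : (0 <= f t * mu [set t])%E by rewrite mule_ge0.
have off t : D t -> ~ N t -> mu [set t] = 0%E.
  by move=> Dt; apply: contra_notP => /eqP h; split.
have disjN : [disjoint N & D `\` N].
  by apply/disj_setPLR => t Nt []; exact.
have mu0 : mu (D `\` N) = 0%E.
  by rewrite aD// esum1// => t [Dt Nt]; exact: off.
rewrite -[in LHS]DE ge0_integral_setU ?DE//.
rewrite [X in (_ + X)%E]null_set_integral ?adde0//; last first.
  by apply: measurable_funS mf => // t [].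
rewrite [RHS](esumID N)// (setIidr ND) [X in (_ + X)%E]esum1 ?adde0; last first.
  by move=> t [Dt Nt]; rewrite off// mule0.
have /countable_injP[g ginj] := cN.
(* Fibres of an injection of the atoms into the naturals: each is empty or a singleton, so countable
   additivity applies. *)
pose E k : set TR := [set t | N t /\ g t = k].
have NE : N = \bigcup_k E k.
  by apply/seteqP; split=> [t Nt|t [k _ []]//]; exists (g t).
have tE : trivIset setT E.
  by move=> i j _ _ [t [[_ <-] [_ <-]]].
have ES k : E k = set0 \/ exists t, E k = [set t].
  have [[t Et]|nE] := pselect (exists t, E k t); last first.
    by left; apply/seteqP; split => // t Et; apply: nE; exists t.
  right; exists t; apply/seteqP; split => [s [Ns gs]|s ->//].
  by apply: ginj; rewrite ?inE//; have [] := Et => // _ ->.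
have mE k : measurable (E k).
  by have [->|[t ->]] := ES k; [exact: measurable0|exact: measurable_set1].
rewrite NE ge0_integral_bigcup//; last first.
  by rewrite -NE; apply: measurable_funS mf.
rewrite nneseries_sum_bigcup//; apply: eq_eseriesr => k _.
have [->|[t ->]] := ES k; first by rewrite integral_set0 esum_set0.
by rewrite integral_atom esum_set1.
Qed.

(** Both sides are [fine] of the same difference of positive and negative parts, so they agree even
    when these diverge. *)
Lemma Rintegral_atomic mu D (f : TR -> R) :
  measurable D -> purely_atomic mu D ->
  countable [set t | D t /\ mu [set t] != 0%E] ->
  (forall t, D t -> mu [set t] < +oo)%E -> measurable_fun D f ->
  Rintegral mu D f = rsum D (fun t : R => f t * fine (mu [set t])).
Proof.
move=> mD aD cN fin mf; have mF : measurable_fun D (EFin \o f).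
  exact/measurable_EFinP.
rewrite /Rintegral integralE /rsum !ge0_integral_atomic//; first last.
- exact: measurable_funepos.
- exact: measurable_funeneg.
have fmu t : D t -> mu [set t] = (fine (mu [set t]))%:E.
  by move=> Dt; rewrite fineK// ge0_fin_numE// fin.
have fmu0 t : 0 <= fine (mu [set t]) by exact: fine_ge0.
congr (fine (_ - _)%E); apply: eq_esum => t Dt.
  rewrite fmu// !funeposE -!EFin_max -EFinM /=; congr (_%:E).
  by rewrite maxr_pMl// mul0r.
rewrite fmu// !funenegE /= -!EFin_max -EFinM; congr (_%:E).
by rewrite maxr_pMl// mul0r mulNr.
Qed.

Lemma cintegral_atomic mu D (f : TR -> R[i]) :
  measurable D -> purely_atomic mu D ->
  countable [set t | D t /\ mu [set t] != 0%E] ->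
  (forall t, D t -> mu [set t] < +oo)%E ->
  measurable_fun D (fun t => Re (f t)) -> measurable_fun D (fun t => Im (f t)) ->
  cintegral mu D f = csum D (fun t : R => (fine (mu [set t]))%:C * f t).
Proof.
move=> mD aD cN fin mR mI; rewrite /cintegral /csum !Rintegral_atomic//.
by congr (_ +i* _); apply: eq_rsum => t _; rewrite ?Re_realM ?Im_realM mulrC.
Qed.

(** Only finite sets of points are compared, so this is available before the atoms are known to be
    countable; [summable_atoms] derives countability from it on the line. *)
Lemma esum_atoms_le_integral mu D (f : TR -> \bar R) :
  measurable D -> purely_atomic mu D -> (forall t, 0 <= f t)%E ->
  measurable_fun D f ->
  (\esum_(t in D) (f t * mu [set t]) <= \int[mu]_(t in D) f t)%E.
Proof.
move=> mD aD f0 mf; apply: ge_ereal_sup => _ [A [fA AD] <-].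
have cA : countable A by exact: finite_set_countable.
have mA : measurable (A : set TR).
  by apply: countable_measurable => // t; exact: measurable_set1.
rewrite -esum_fset//; last by move=> t _; rewrite mule_ge0.
rewrite -(@ge0_integral_atomic mu A f)//.
- exact: ge0_subset_integral.
- by move=> B mB BA; apply: aD => // t /BA/AD.
- by apply: sub_countable cA; apply: subset_card_le => t [].
- exact: measurable_funS mf.
Qed.

(** The absolute value makes this a measure for every [w], so that the instance carries no sign
    condition. *)
Definition atomic_measure (w : R -> R) (A : set TR) : \bar R :=
  \esum_(t in A) (`|w t|)%:E.

Section AtomicMeasureInstance.
Variable w : R -> R.

Let atomic0 : atomic_measure w set0 = 0%E.
Proof. exact: esum_set0. Qed.

Let atomic_ge0 A : (0 <= atomic_measure w A)%E.
Proof. by apply: esum_ge0 => t _; rewrite lee_fin. Qed.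

Let atomic_sigma_additive : semi_sigma_additive (atomic_measure w).
Proof.
move=> F mF tF mUF; rewrite /atomic_measure nneseries_sum_bigcup//.
by apply: is_cvg_ereal_nneg_natsum => k _; apply: esum_ge0 => t _; rewrite lee_fin.
Qed.

HB.instance Definition _ := isMeasure.Build _ _ _ (atomic_measure w)
  atomic0 atomic_ge0 atomic_sigma_additive.

End AtomicMeasureInstance.

Lemma atomic_measure_set1 w (t : R) : atomic_measure w [set t] = (`|w t|)%:E.
Proof. by rewrite /atomic_measure esum_set1// lee_fin. Qed.

Lemma atomic_measure_purely_atomic w D : purely_atomic (atomic_measure w) D.
Proof. by move=> A mA AD; apply: eq_esum => t _; exact/esym/atomic_measure_set1. Qed.

End AtomicMeasure.

(** * Measures on the curve as mass functions of a real parameter *)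

Section Parametrization.
Variables (R : realType) (C D : set R[i]) (kap k : R[i] -> R[i] -> R[i]).
Hypothesis F : herglotz_frame C D kap k.
Variables (I : countType) (gamma : I -> R[i]) (v : I -> R).
Hypothesis gamma_inj : injective gamma.
Hypothesis two_terms : exists i j : I, i != j.
Hypothesis v_gt0 : forall n, 0 < v n.
Hypothesis v_sum :
  (\esum_(n in [set: I]) (v n / (1 + cabs (gamma n) ^+ 2))%:E < +oo)%E.
Hypothesis gammaC : forall n, C (gamma n).
Variables (P : set R) (tau : R -> R[i]).
Hypothesis tau_inj : set_inj P tau.
Hypothesis tau_curve : tau @` P = C.

Local Notation phi := (transform k [set: I] gamma v).

Let tauC t : P t -> C (tau t).
Proof. by move=> Pt; rewrite -tau_curve; exists t. Qed.

Lemma unitary_of_masses (alpha b : R) (m : R -> R) :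
  (forall t, P t -> 0 <= m t) ->
  nnsummable P (fun t => m t / (1 + cabs (tau t) ^+ 2)) ->
  (forall z, D z ->
    (alpha%:C - phi z)^-1 = b%:C + csum P (fun t => (m t)%:C * k (tau t) z)) ->
  unitary_transform gamma v phi alpha.
Proof.
move=> m0 ms repr; pose S := [set t | P t /\ m t != 0].
have SP : S `<=` P by move=> t [].
apply: (@atoms_unitary _ _ _ _ _ F _ _ _ gamma_inj two_terms v_gt0 v_sum gammaC
  _ S tau m alpha b).
- by move=> t /SP; exact: tauC.
- by move=> t [Pt mt]; rewrite lt_neqAle eq_sym mt m0.
- by move=> s t; rewrite !inE => /SP Ps /SP Pt; apply: tau_inj; rewrite inE.
- move=> z Dz; have [d d0 hd] := domain_dist F Dz.
  apply: (@dist_admissible _ _ S tau m _ z d) => //.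
  + by move=> t /SP; exact: m0.
  + by move=> t /SP Pt; apply/hd/tauC.
  + apply: nnsummable_sub ms => // t Pt; rewrite divr_ge0 ?m0//.
    by rewrite addr_ge0// sqr_ge0.
- move=> z Dz; rewrite repr//; congr (_ + _); apply: csum_restrict => // t Pt nSt.
  have -> : m t = 0 by apply: contra_notP nSt => /eqP mt; split.
  by rewrite mul0r.
Qed.

(** The masses are the weights of Lambda(alpha), pulled back to the parameter and extended by 0. *)
Lemma masses_of_unitary (alpha : R) : unitary_transform gamma v phi alpha ->
  exists (b : R) (m : R -> R), [/\ forall t, 0 <= m t,
    countable [set t | P t /\ m t != 0],
    forall z, D z -> nnsummable P (fun t => m t / cabs (z - tau t) ^+ 2) &
    forall z, D z ->
      (alpha%:C - phi z)^-1 = b%:C + csum P (fun t => (m t)%:C * k (tau t) z)].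
Proof.
move=> U; have [b repr] := unitary_representation F two_terms v_gt0 v_sum gammaC U.
pose L := level_set gamma v phi alpha; pose S := P `&` tau @^-1` L.
pose m t : R := if t \in S then weight gamma v (tau t) else 0.
have SP : S `<=` P by move=> t [].
have Sinj : set_inj S tau.
  by move=> s t; rewrite !inE => /SP Ps /SP Pt; apply: tau_inj; rewrite inE.
have LS : tau @` S = L.
  apply/seteqP; split=> [_ [t [Pt Lt] <-]//|z Lz].
  have : C z by exact: (level_curve F two_terms v_gt0 v_sum gammaC Lz).
  by rewrite -tau_curve => -[t Pt tz]; exists t => //; split=> //; rewrite /= tz.
have m0 t : 0 <= m t.
  by rewrite /m; case: ifP => // _; exact: weight_ge0.
have mS t : ~ S t -> m t = 0 by move=> nSt; rewrite /m memNset.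
have mE t : S t -> m t = weight gamma v (tau t) by move=> St; rewrite /m mem_set.
exists b, m; split=> //.
- apply: (@sub_countable _ _ _ S).
    apply: subset_card_le => t [_ /eqP mt]; apply: contrapT => nSt.
    exact/mt/mS.
  rewrite -(eq_countable (inj_card_eq Sinj)) LS.
  apply: (orthogonal_countable v_gt0 two_terms (@level_sub_star _ _ _ _ _ _)).
  exact: (level_orthogonal F two_terms v_gt0 v_sum gammaC).
- move=> z Dz; have [_] := level_admissible F two_terms v_gt0 v_sum gammaC U Dz.
  rewrite -/L -LS nnsummable_image// => h.
  rewrite /nnsummable (nnsum_restrict _ SP).
  + by apply: eq_nnsummable h => t St; rewrite mE.
  + by move=> t _; rewrite divr_ge0 ?sqr_ge0.
  + by move=> t _ nSt; rewrite mS// mul0r.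
- move=> z Dz; rewrite repr//; congr (_ + _).
  rewrite /transform -/L -LS csum_image// (@csum_restrict _ _ P S)//.
    by apply: eq_csum => t St; rewrite mE.
  by move=> t _ nSt; rewrite mS// mul0r.
Qed.

End Parametrization.

(** * Angles parametrize the unit circle *)

Section UnitCircle.
Variable R : realType.
Implicit Types s t : R.

Lemma cabs_expi t : cabs (expi t) = 1.
Proof. by rewrite /= cos2Dsin2 sqrtr1. Qed.

Lemma expi_inj : set_inj (angles R) (@expi R).
Proof.
(* The cosine is injective on [0, pi]; beyond pi a shift by pi shows that cos d = 1 would force d =
   2 pi. *)
have key d : 0 <= d < 2 * pi -> cos d = 1 -> d = 0 :> R.
  move=> /andP[d0 d2] cd; have [dp|dp] := leP d pi.
    by apply: cos_inj; rewrite ?in_itv/= ?d0 ?dp ?lexx ?pi_ge0// cos0.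
  have : d - pi = pi :> R.
    apply: cos_inj; rewrite ?in_itv/= ?pi_ge0 ?lexx//.
      by rewrite subr_ge0 (ltW dp) lerBlDr -mulr2n -mulr_natl ltW.
    by rewrite cospi -[LHS]opprK -cosDpi subrK cd.
  by lra.
suff le s t : angles R s -> angles R t -> s <= t -> expi s = expi t -> s = t.
  move=> s t; rewrite !inE => As At st; have [h|/ltW h] := leP s t.
    exact: le.
  by apply/esym; exact: le.
rewrite /angles /= !in_itv/= => /andP[s0 s2] /andP[t0 t2] st [ec es].
suff : t - s = 0 by lra.
apply: key; first by rewrite subr_ge0 st; lra.
by rewrite cosB ec es -!expr2 cos2Dsin2.
Qed.

Lemma expi_image : @expi R @` angles R = unit_circle R.
Proof.
apply/seteqP; split => [_ [t _ <-]|[x y] /= xy]; first exact: cabs_expi.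
have xy1 : x ^+ 2 + y ^+ 2 = 1.
  by have := cabs_sqr (x +i* y); rewrite (xy : cabs _ = 1) expr1n => <-.
have x1 : -1 <= x <= 1.
  by rewrite -ler_norml -(@ler_pXn2r _ 2)// ?nnegrE// expr1n real_normK ?num_real//;
    have := sqr_ge0 y; lra.
have sa : sin (acos x) = `|y|.
  by rewrite sin_acos// -xy1 addrAC subrr add0r sqrtr_sqr.
have ca : cos (acos x) = x by rewrite acosK.
have a0 := acos_ge0 x1; have ap := acos_lepi x1; have p0 := pi_gt0 R.
have [y0|y0] := leP 0 y.
  exists (acos x); first by rewrite /angles /= in_itv/= a0; lra.
  by rewrite /expi ca sa ger0_norm.
(* This is 2 pi - acos x, the angle on the lower half circle; acos x > 0 keeps it below 2 pi. *)
exists (pi - acos x + pi); last first.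
  rewrite /expi cosDpi sinDpi cosB sinB cospi sinpi ca sa ltr0_norm//.
  by congr (_ +i* _); ring.
have an : acos x != 0.
  by apply/eqP => h; move: sa; rewrite h sin0 => /esym/eqP; rewrite normr_eq0 lt_eqF.
have : 0 < acos x by rewrite lt_neqAle eq_sym an.
by rewrite /angles /= in_itv/=; lra.
Qed.

End UnitCircle.

(** * The line and the circle as Herglotz frames *)

Section Frames.
Variable R : realType.

Definition kap_line (z w : R[i]) := w - conjc z.
Definition k_line (g z : R[i]) := (g - z)^-1 - g / (1 + g ^+ 2).

Definition kap_circle (z w : R[i]) := 'i%C * (1 - conjc z * w).
(** Half the kernel of the Herglotz representation in the disk, so masses for [k_circle] are twice
    those of the representing measure. *)
Definition k_circle (g z : R[i]) := 'i%C / 2 * ((g + z) / (g - z)).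

Lemma one_add_sqr_neq0 (x : R) : 1 + x ^+ 2 != 0.
Proof. by rewrite gt_eqF// ltr_pwDl// sqr_ge0. Qed.

Lemma line_frame :
  herglotz_frame (real_line R) (upper_half_plane R) kap_line k_line.
Proof.
split.
- by move=> z w; rewrite /kap_line conjcB conjcK opprB.
- move=> [a b]; rewrite /real_line /kap_line /=; split=> [->|].
    by apply: eq_complexP; rewrite /= ?subrr ?opprK ?addr0.
  by move=> /(congr1 (@complex.Im R)) /=; lra.
- by move=> [a b]; rewrite /upper_half_plane /kap_line /=; lra.
- move=> l z w rl; have lJ : conjc l = l by rewrite (real_complexP rl) conjc_real.
  by rewrite /kap_line conjcB lJ; ring.
- by move=> z; exists (- conjc z), 1 => w; rewrite /kap_line mul1r addrC.
- move=> g z w rg zg wg; have gJ : conjc g = g by rewrite (real_complexP rg) conjc_real.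
  have zJ : conjc z - g != 0 by rewrite -{1}gJ -conjcB conjc_eq0 subr_eq0.
  have wg0 : w - g != 0 by rewrite subr_eq0.
  rewrite /k_line /kap_line !conjcB conjcV conjcB conjcM conjcV conjcD conjcM conjc1 gJ.
  have -> : (g - w)^-1 = - (w - g)^-1 by rewrite -invrN opprB.
  have -> : (g - conjc z)^-1 = - (conjc z - g)^-1 by rewrite -invrN opprB.
  by rewrite opprB addrA subrK; field; rewrite zJ wg0.
(* At z = i and real x, the kernel is 1 / (x - i) - x / (1 + x^2) = i / (1 + x^2). *)
- exists 'i%C; first by rewrite /upper_half_plane /=.
  move=> [x y]; rewrite /real_line /= => ->; rewrite /k_line.
  rewrite (_ : (x - 0) ^+ 2 + (0 - 1) ^+ 2 = 1 + x ^+ 2); last by ring.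
  rewrite (_ : 1 + (x * x - 0 * 0) = 1 + x ^+ 2); last by ring.
  rewrite (_ : 0 + (x * 0 + 0 * x) = 0); last by ring.
  move: (one_add_sqr_neq0 x) => n0; rewrite expr0n addr0.
  by field; rewrite n0.
- move=> z Dz; exists (Im z) => // g rg; apply: le_trans (le_Im_cabs _).
  by rewrite ImD ImN rg subr0 ler_norm.
- move=> t y Ct /andP[y0 y1]; exists (t + 0 +i* y); split.
  + by rewrite /upper_half_plane /= ImD Ct add0r.
  + by rewrite addrC addKr /= expr0n /= add0r sqrtr_sqr gtr0_norm.
  + move=> g rg; apply: le_trans (le_Im_cabs _).
    by rewrite ImD ImN ImD Ct rg subr0 add0r ler_norm.
  + by rewrite /kap_line ImD ImN ImJ opprK ImD Ct /=; have := sqr_ge0 y; lra.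
Qed.

Lemma circle_frame :
  herglotz_frame (unit_circle R) (unit_disk R) kap_circle k_circle.
Proof.
have iJ : conjc ('i%C : R[i]) = - 'i%C by apply: eq_complexP; rewrite /= ?oppr0.
have i2 : 'i%C * 'i%C = -1 :> R[i] by rewrite -expr2 sqr_i.
have kd z : kap_circle z z = 'i%C * (1 - cabs z ^+ 2)%:C.
  by rewrite /kap_circle mulJc real_complexB.
have Imi (x : R) : Im ('i%C * x%:C) = x by rewrite ImM /= mul0r mul1r add0r.
split.
- by move=> z w; rewrite /kap_circle conjcM iJ conjcB conjc1 conjcM conjcK; ring.
- move=> z; rewrite kd /unit_circle /=; split=> [->|].
    by rewrite expr1n subrr mulr0.
  move=> /(congr1 (@complex.Im R)); rewrite Imi /= => /eqP.
  rewrite subr_eq0 eq_sym sqrf_eq1 => /orP[/eqP//|/eqP h].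
  by have := cabs_ge0 z; rewrite h ler0N1.
- move=> z; rewrite kd Imi /unit_disk /= => z1.
  by rewrite subr_gt0 expr_lt1// cabs_ge0.
- move=> l z w Cl; have lJ : l * conjc l = 1 by rewrite mulcJ Cl expr1n.
  rewrite /kap_circle conjcB.
  rewrite (_ : _ * _ = 'i%C * 'i%C * (1 - conjc z * l - conjc l * w +
    conjc z * w * (l * conjc l))); last by ring.
  rewrite lJ i2.
  rewrite (_ : (w - l) * _ = w * conjc z - w * conjc l - l * conjc z + l * conjc l).
    by rewrite lJ; ring.
  by ring.
- by move=> z; exists 'i%C, (- ('i%C * conjc z)) => w; rewrite /kap_circle; ring.
- move=> g z w Cg zg wg; have gJ : g * conjc g = 1 by rewrite mulcJ Cg expr1n.
  have zJ : conjc z - conjc g != 0 by rewrite -conjcB conjc_eq0 subr_eq0.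
  have wg0 : w - g != 0 by rewrite subr_eq0.
  have gz : conjc g - conjc z != 0 by rewrite subr_eq0 eq_sym -subr_eq0.
  have gw : g - w != 0 by rewrite subr_eq0 eq_sym.
  have c2 : conjc (2 : R[i]) = 2 by exact: conjc_nat.
  have -> : conjc (k_circle g z) =
      - 'i%C / 2 * ((conjc g + conjc z) / (conjc g - conjc z)).
    rewrite /k_circle conjcM [conjc ('i%C / 2)]conjcM iJ conjcV c2 conjcM conjcV.
    by rewrite conjcD conjcB.
  rewrite /k_circle /kap_circle conjcB.
  rewrite (_ : _ - _ = 'i%C / 2 * ((g * conjc g) *+ 2 - 2 * (conjc z * w)) /
    ((g - w) * (conjc g - conjc z))).
    by rewrite gJ; field; rewrite gw gz zJ wg0.
  by field; rewrite gw gz.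
- exists 0; first by rewrite /unit_disk -[_ 0]/(is_true (cabs 0 < 1)) cabs0 ltr01.
  move=> g Cg; have g0 : g != 0 by rewrite -cabs_gt0 Cg.
  by rewrite /k_circle addr0 subr0 divff// mulr1 ReM /=; ring.
- move=> z Dz; exists (1 - cabs z); first by rewrite subr_gt0.
  move=> g Cg; rewrite lerBlDr -[1]Cg cabsB.
  by rewrite (le_trans _ (le_cabsD _ _))// subrK.
- move=> t y Ct /andP[y0 y1]; have y10 : 0 <= 1 - y by rewrite subr_ge0 ltW.
  have cz : cabs ((1 - y)%:C * t) = 1 - y by rewrite cabsM Ct mulr1 cabs_nneg.
  exists ((1 - y)%:C * t); split.
  + by rewrite /unit_disk /= cz gtrBl.
  + rewrite (_ : _ - t = (- y)%:C * t); last first.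
      rewrite (_ : (- y)%:C = - y%:C); last exact: rmorphN.
    by rewrite real_complexB; ring.
    by rewrite cabsM Ct mulr1 cabs_real normrN gtr0_norm.
  + move=> g Cg; rewrite cabsB; have := le_cabsD (g - (1 - y)%:C * t) ((1 - y)%:C * t).
    by rewrite subrK Cg cz; lra.
  (* Here 1 - (1 - y)^2 = 2 y - y^2: the circle attains the lower bound required in [approach], and
     the line has 2 y. *)
  + by rewrite kd Imi cz; lra.
Qed.

End Frames.

(** * Moving constants through sums that may diverge *)

Section ScalarSums.
Variables (R : realType) (T : choiceType) (S : set T).

(* The junk value [fine +oo = 0] of a divergent part is compatible with scaling. *)
Lemma rsum_half (f : T -> R) : rsum S (fun t => f t / 2) = rsum S f / 2.
Proof.
pose g t := f t / 2.
have D (h : R -> R) : (forall x, 0 <= h x) -> (forall x, h x = h (x / 2) + h (x / 2)) ->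
    (\esum_(t in S) (h (f t))%:E =
     \esum_(t in S) (h (g t))%:E + \esum_(t in S) (h (g t))%:E)%E.
  move=> h0 hD; rewrite -esumD => [|t _|t _]; rewrite ?lee_fin//.
  by apply: eq_esum => t _; rewrite hD EFinD.
have half (x : R) : Num.max x 0 = Num.max (x / 2) 0 + Num.max (x / 2) 0.
  by case: (leP x 0) => h; case: (leP (x / 2) 0) => h'; lra.
have P := D (fun x => Num.max x 0) (fun x => _) half.
have N := D (fun x => Num.max (- x) 0) (fun x => _) _.
rewrite /rsum.
have posE (u : T -> R) : (EFin \o u)^\+%E = fun t => (Num.max (u t) 0)%:E.
  by apply/funext => t; rewrite funeposE EFin_max.
have negE (u : T -> R) : (EFin \o u)^\-%E = fun t => (Num.max (- u t) 0)%:E.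
  by apply/funext => t; rewrite funenegE EFin_max EFinN.
rewrite !posE !negE -/(g _) P; last by move=> x; rewrite le_max lexx orbT.
rewrite N; first last.
- by move=> x; rewrite half mulNr.
- by move=> x; rewrite le_max lexx orbT.
set a := \esum_(_ in S) _; set b := \esum_(_ in S) _.
have a0 : (0 <= a)%E by apply: esum_ge0 => t _; rewrite lee_fin le_max lexx orbT.
have b0 : (0 <= b)%E by apply: esum_ge0 => t _; rewrite lee_fin le_max lexx orbT.
case: a a0 => [a| |] //; case: b b0 => [b| |] //= _ _; rewrite ?mul0r//.
by field.
Qed.

Lemma csum_half (G : T -> R[i]) : csum S (fun t => G t / 2) = csum S G / 2.
Proof.
have h (z : R[i]) : z / 2 = (Re z / 2) +i* (Im z / 2).
  apply: (@mulIf _ 2) => //; rewrite divfK//; case: z => x y /=.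
  by rewrite mulr_natr mulr2n; apply: eq_complexP => /=; lra.
by rewrite h /csum /= -!rsum_half; congr (_ +i* _); apply: eq_rsum => t _; rewrite h.
Qed.

Lemma csum_mulI (G : T -> R[i]) : csum S (fun t => 'i%C * G t) = 'i%C * csum S G.
Proof.
rewrite /csum; apply: eq_complexP; rewrite ?ReM ?ImM /=.
  rewrite mul0r mul1r sub0r -rsumN; apply: eq_rsum => t _.
  by rewrite ReM /= mul0r mul1r sub0r.
rewrite mul0r mul1r add0r; apply: eq_rsum => t _.
by rewrite ImM /= mul0r mul1r add0r.
Qed.

End ScalarSums.

(** An equality of total functions, so the factor i / 2 must pass through [csum] also where the
    series diverges. *)
Lemma phi_circleE (R : realType) (I : countType) (gamma : I -> R[i]) (v : I -> R) :
  phi_circle gamma v = transform (@k_circle R) [set: I] gamma v.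
Proof.
apply/funext => z; rewrite /phi_circle /transform -mulrA [2^-1 * _]mulrC.
rewrite -csum_half -csum_mulI; apply: eq_csum => n _.
by rewrite /k_circle; ring.
Qed.

(** * Measurability of the Herglotz kernels in the parameter *)

Section Measurability.
Variable R : realType.
Local Notation TR := (measurableTypeR R).

Lemma measurable_div (f g : R -> R) : continuous f -> continuous g ->
  (forall t, g t != 0) -> measurable_fun [set: TR] (fun t : TR => f t / g t : R).
Proof.
move=> cf cg g0; apply: continuous_measurable_fun => t.
by apply: cvgM; [exact: cf|apply: cvgV; [exact: g0|exact: cg]].
Qed.

Lemma measurable_complex_div (f g : R -> R[i]) :
  continuous (fun t => Re (f t)) -> continuous (fun t => Im (f t)) ->
  continuous (fun t => Re (g t)) -> continuous (fun t => Im (g t)) ->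
  (forall t, g t != 0) ->
  measurable_fun [set: TR] (fun t : TR => Re (f t / g t)) /\
  measurable_fun [set: TR] (fun t : TR => Im (f t / g t)).
Proof.
move=> cRf cIf cRg cIg g0.
have n0 t : Re (g t) ^+ 2 + Im (g t) ^+ 2 != 0.
  by rewrite -cabs_sqr sqrf_eq0 cabs_eq0.
have cn : continuous (fun t => Re (g t) ^+ 2 + Im (g t) ^+ 2).
  by move=> t; apply: cvgD; apply: cvgM; first [exact: cRg|exact: cIg].
have E z w : z / w = (((Re z * Re w + Im z * Im w) / (Re w ^+ 2 + Im w ^+ 2)) +i*
    ((Im z * Re w - Re z * Im w) / (Re w ^+ 2 + Im w ^+ 2))) :> R[i].
  case: z w => [a b] [c d]; apply: eq_complexP => /=; ring.
split.
  rewrite (_ : (fun t : TR => _) = fun t : TR =>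
    (Re (f t) * Re (g t) + Im (f t) * Im (g t)) / (Re (g t) ^+ 2 + Im (g t) ^+ 2)).
    apply: measurable_div => // t; apply: cvgD; apply: cvgM;
      first [exact: cRf|exact: cIf|exact: cRg|exact: cIg].
  by apply/funext => t; rewrite E.
rewrite (_ : (fun t : TR => _) = fun t : TR =>
  (Im (f t) * Re (g t) - Re (f t) * Im (g t)) / (Re (g t) ^+ 2 + Im (g t) ^+ 2)).
  apply: measurable_div => // t; apply: cvgB; apply: cvgM;
    first [exact: cRf|exact: cIf|exact: cRg|exact: cIg].
by apply/funext => t; rewrite E.
Qed.

Lemma measurable_k_line z : upper_half_plane R z ->
  measurable_fun [set: TR] (fun t : TR => Re (k_line t%:C z)) /\
  measurable_fun [set: TR] (fun t : TR => Im (k_line t%:C z)).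
Proof.
move=> Dz; have [] := @measurable_complex_div (fun=> 1) (fun t => t%:C - z).
- by move=> t; exact: cvg_cst.
- by move=> t; exact: cvg_cst.
- rewrite (_ : (fun t => _) = fun t => t - Re z).
    by move=> t; apply: cvgB; [exact: cvg_id|exact: cvg_cst].
  by apply/funext => t; rewrite ReD ReN.
- rewrite (_ : (fun t => _) = fun t => - Im z); first by move=> t; exact: cvg_cst.
  by apply/funext => t; rewrite ImD ImN /= add0r.
- move=> t; apply/eqP => /(congr1 (@complex.Im R)); rewrite ImD ImN /= add0r.
  by move=> /eqP; rewrite oppr_eq0 gt_eqF.
move=> mR mI.
have kE t : k_line t%:C z = 1 / (t%:C - z) - (t / (1 + t ^+ 2))%:C.
  by rewrite /k_line mul1r real_complexM real_complexV real_complexD real_complexX.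
split.
  rewrite (_ : (fun t : TR => _) = fun t : TR =>
    Re (1 / (t%:C - z)) - t / (1 + t ^+ 2)).
    apply: measurable_funB => //; apply: measurable_div => [t|t|t].
    + exact: cvg_id.
    + by apply: cvgD; [exact: cvg_cst|apply: cvgM; exact: cvg_id].
    + exact: one_add_sqr_neq0.
  by apply/funext => t; rewrite kE ReD ReN.
rewrite (_ : (fun t : TR => _) = fun t : TR => Im (1 / (t%:C - z)))//.
by apply/funext => t; rewrite kE ImD ImN /= subr0.
Qed.

Lemma measurable_circle_kernel z : unit_disk R z ->
  measurable_fun [set: TR] (fun t : TR => Re ((expi t + z) / (expi t - z))) /\
  measurable_fun [set: TR] (fun t : TR => Im ((expi t + z) / (expi t - z))).
Proof.
move=> Dz; apply: measurable_complex_div.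
- rewrite (_ : (fun t => _) = fun t => cos t + Re z).
    by move=> t; apply: cvgD; [exact: continuous_cos|exact: cvg_cst].
  by apply/funext => t; rewrite ReD.
- rewrite (_ : (fun t => _) = fun t => sin t + Im z).
    by move=> t; apply: cvgD; [exact: continuous_sin|exact: cvg_cst].
  by apply/funext => t; rewrite ImD.
- rewrite (_ : (fun t => _) = fun t => cos t - Re z).
    by move=> t; apply: cvgB; [exact: continuous_cos|exact: cvg_cst].
  by apply/funext => t; rewrite ReD ReN.
- rewrite (_ : (fun t => _) = fun t => sin t - Im z).
    by move=> t; apply: cvgB; [exact: continuous_sin|exact: cvg_cst].
  by apply/funext => t; rewrite ImD ImN.
- move=> t; apply/eqP => /eqP; rewrite subr_eq0 => /eqP tz.
  by have := Dz; rewrite /unit_disk /= -tz cabs_expi ltxx.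
Qed.

Lemma measurable_angles : measurable (angles R : set TR).
Proof. exact: measurable_itv. Qed.

End Measurability.

(** * Unitarity and purely atomic Herglotz functions *)

Section PurelyAtomic.
Variables (R : realType) (I : countType) (gamma : I -> R[i]) (v : I -> R).
Hypothesis gamma_inj : injective gamma.
Hypothesis two_terms : exists i j : I, i != j.
Hypothesis v_gt0 : forall n, 0 < v n.
Hypothesis v_sum :
  (\esum_(n in [set: I]) (v n / (1 + cabs (gamma n) ^+ 2))%:E < +oo)%E.
Local Notation TR := (measurableTypeR R).

(** A positive weight f rules out atoms of infinite mass and makes the atoms countable; it is 1 / (1
    + t^2) on the line and 1 on the circle. *)
Lemma summable_atoms (mu : {measure set TR -> \bar R}) (P : set TR) (f : R -> R) :
  (forall t, P t -> 0 < f t) ->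
  (\esum_(t in P) ((f t)%:E * mu [set t]) < +oo)%E ->
  [/\ forall t, P t -> (mu [set t] < +oo)%E,
    nnsummable P (fun t => fine (mu [set t]) * f t) &
    countable [set t | P t /\ mu [set t] != 0%E]].
Proof.
move=> f0 sf.
have fmu0 t : P t -> (0 <= (f t)%:E * mu [set t])%E.
  by move=> Pt; rewrite mule_ge0// lee_fin ltW// f0.
have fin t : P t -> (mu [set t] < +oo)%E.
  move=> Pt; rewrite ltey; apply/eqP => muy.
  have : ((f t)%:E * mu [set t] < +oo)%E.
    apply: le_lt_trans sf; rewrite -(@esum_set1 R _ t (fun s => (f s)%:E * mu [set s])%E).
      by rewrite [leRHS](esumID [set t])// setI1 mem_set// leeDl// esum_ge0// => s [/fmu0].
    exact: fmu0.
  by rewrite muy gt0_muley ?ltxx// lte_fin f0.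
have fineE t : P t -> mu [set t] = (fine (mu [set t]))%:E.
  by move=> Pt; rewrite fineK// ge0_fin_numE// fin.
have sm : nnsummable P (fun t => fine (mu [set t]) * f t).
  apply: le_lt_trans sf; apply: le_esum => t Pt.
  by rewrite [in leRHS]fineE// -EFinM lee_fin mulrC.
split=> //.
have m0 t : P t -> 0 <= fine (mu [set t]) * f t.
  by move=> Pt; rewrite mulr_ge0 ?fine_ge0// ltW// f0.
apply: sub_countable (nnsummable_countable m0 sm).
apply: subset_card_le => t [Pt mt]; split=> //.
rewrite mulf_neq0//; last by rewrite gt_eqF// f0.
by apply: contra mt; rewrite fineE// eqe.
Qed.

Lemma real_line_image : (fun t : R => t%:C) @` [set: R] = real_line R.
Proof.
apply/seteqP; split=> [_ [t _ <-]//|z rz]; exists (Re z) => //.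
by rewrite -real_complexP.
Qed.

Lemma real_complex_set_inj : set_inj [set: R] (fun t : R => t%:C).
Proof. by move=> s t _ _ /complexI. Qed.

Lemma cabs_sub_i (t : R) : cabs ('i%C - t%:C) ^+ 2 = 1 + t ^+ 2.
Proof. by rewrite cabs_sqr /=; ring. Qed.

Lemma measurable_base :
  measurable_fun [set: TR] (fun t : TR => ((1 + t ^+ 2)^-1)%:E : \bar R).
Proof.
rewrite (_ : (fun t : TR => _) = EFin \o (fun t : TR => 1 / (1 + t ^+ 2))).
  apply/measurable_EFinP; apply: measurable_div => [t|t|t].
  + exact: cvg_cst.
  + by apply: cvgD; [exact: cvg_cst|apply: cvgM; exact: cvg_id].
  + exact: one_add_sqr_neq0.
by apply/funext => t /=; rewrite mul1r.
Qed.

Lemma base_gt0 (t : R) : 0 < (1 + t ^+ 2)^-1.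
Proof. by rewrite invr_gt0 ltr_pwDl// sqr_ge0. Qed.

Lemma unitary_line_herglotz (alpha : R) : (forall n, real_line R (gamma n)) ->
  unitary_transform gamma v (phi_line gamma v) alpha ->
  purely_atomic_herglotz_line (fun z => (alpha%:C - phi_line gamma v z)^-1).
Proof.
move=> gR U; have F := line_frame R.
split; first exact: (herglotz_inv F two_terms v_gt0 v_sum gR).
have [b [m [m0 cm sm repr]]] := masses_of_unitary F two_terms v_gt0 v_sum gR
  real_complex_set_inj real_line_image U.
pose mu : {measure set TR -> \bar R} := atomic_measure m.
have muE t : mu [set t] = (m t)%:E.
  by rewrite /mu /= atomic_measure_set1 ger0_norm.
have cmu : countable [set t | [set: TR] t /\ mu [set t] != 0%E].
  by apply: sub_countable cm; apply: subset_card_le => t [_]; rewrite muE eqe.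
have amu : purely_atomic mu [set: TR] by exact: atomic_measure_purely_atomic.
exists b, 0, mu; split=> //; split=> //.
  rewrite (@ge0_integral_atomic _ mu [set: TR]
    (fun t : TR => ((1 + t ^+ 2)^-1)%:E))//.
  (* Since |i - t|^2 = 1 + t^2, summability of the masses seen from i is the integrability condition
     of the representation. *)
  - have Di : upper_half_plane R 'i%C by rewrite /upper_half_plane /=.
    apply: le_lt_trans (sm _ Di); apply: le_esum => t _.
    by rewrite muE -EFinM lee_fin cabs_sub_i mulrC.
  - by move=> t; rewrite lee_fin ltW// base_gt0.
  - exact: measurable_base.
move=> z Dz; rewrite mul0r addr0 repr//; congr (_ + _).
have [mR mI] := measurable_k_line Dz.
have kE t : (t%:C - z)^-1 - (t / (1 + t ^+ 2))%:C = k_line t%:C z.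
  by rewrite /k_line real_complexM real_complexV real_complexD real_complexX.
rewrite (_ : (fun t => _) = fun t : R => k_line t%:C z); last first.
  by apply/funext => t; rewrite kE.
rewrite (@cintegral_atomic _ mu [set: TR] (fun t : TR => k_line t%:C z))//.
  by apply: eq_csum => t _; rewrite muE.
by move=> t _; rewrite muE ltry.
Qed.

Lemma herglotz_line_unitary (alpha : R) : (forall n, real_line R (gamma n)) ->
  purely_atomic_herglotz_line (fun z => (alpha%:C - phi_line gamma v z)^-1) ->
  unitary_transform gamma v (phi_line gamma v) alpha.
Proof.
move=> gR [_ [b [c [mu [[_ int repr] c0 amu]]]]]; have F := line_frame R.
have b0 (t : TR) : (0 <= ((1 + t ^+ 2)^-1)%:E)%E by rewrite lee_fin ltW// base_gt0.
have [] := @summable_atoms mu [set: TR] (fun t => (1 + t ^+ 2)^-1).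
- by move=> t _; exact: base_gt0.
- apply: le_lt_trans int.
  by apply: (@esum_atoms_le_integral _ mu [set: TR]
    (fun t : TR => ((1 + t ^+ 2)^-1)%:E) _ _ _ measurable_base).
move=> fin sm cN.
apply: (@unitary_of_masses _ _ _ _ _ F _ _ _ gamma_inj two_terms v_gt0 v_sum gR
  _ _ real_complex_set_inj real_line_image alpha b (fun t => fine (mu [set t]))).
- by move=> t _; exact: fine_ge0.
- apply: eq_nnsummable sm => t _; congr (_ / (1 + _)).
  by rewrite cabs_real real_normK// num_real.
move=> z Dz; rewrite [LHS]repr// c0 mul0r addr0; congr (_ + _).
have [mR mI] := measurable_k_line Dz.
have kE t : (t%:C - z)^-1 - (t / (1 + t ^+ 2))%:C = k_line t%:C z.
  by rewrite /k_line real_complexM real_complexV real_complexD real_complexX.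
rewrite (_ : (fun t => _) = fun t : R => k_line t%:C z); last first.
  by apply/funext => t; rewrite kE.
by rewrite (@cintegral_atomic _ mu [set: TR] (fun t : TR => k_line t%:C z)).
Qed.

Lemma unitary_circle_herglotz (alpha : R) : (forall n, unit_circle R (gamma n)) ->
  unitary_transform gamma v (phi_circle gamma v) alpha ->
  purely_atomic_herglotz_disk (fun z => (alpha%:C - phi_circle gamma v z)^-1).
Proof.
move=> gC; rewrite phi_circleE => U; have F := circle_frame R.
split; first exact: (herglotz_inv F two_terms v_gt0 v_sum gC).
have [b [m [m0 cm sm repr]]] := masses_of_unitary F two_terms v_gt0 v_sum gC
  (@expi_inj R) (@expi_image R) U.
have h0 t : 0 <= m t / 2 by rewrite divr_ge0.
(* The halving accounts for the factor 1 / 2 in [k_circle]. *)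
pose mu : {measure set TR -> \bar R} := atomic_measure (fun t => m t / 2).
have muE t : mu [set t] = (m t / 2)%:E.
  by rewrite /mu /= atomic_measure_set1 ger0_norm.
have cmu : countable [set t | angles R t /\ mu [set t] != 0%E].
  apply: sub_countable cm; apply: subset_card_le => t [At]; rewrite muE eqe => mt.
  by split=> //; apply: contra mt => /eqP ->; rewrite mul0r.
have amu : purely_atomic mu (angles R) by exact: atomic_measure_purely_atomic.
exists b, mu; split=> //; split.
  (* All points of the circle are at distance 1 from 0, so summability seen from 0 bounds the total
     mass. *)
  have D0 : unit_disk R 0.
    by rewrite /unit_disk -[_ 0]/(is_true (cabs 0 < 1)) cabs0 ltr01.
  apply: le_lt_trans (sm _ D0); apply: le_esum => t _.
  rewrite lee_fin ger0_norm// sub0r cabsN cabs_expi expr1n divr1.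
  by rewrite ler_pdivrMr// ler_peMr// ler1n.
move=> z Dz; rewrite repr//; congr (_ + _).
have [mR mI] := measurable_circle_kernel Dz.
have sT : (angles R : set TR) `<=` [set: TR] by [].
rewrite (@cintegral_atomic _ mu (angles R))//.
- rewrite -csum_mulI; apply: eq_csum => t _; rewrite muE /= /k_circle.
  by rewrite real_complexM real_complexV real_complex_nat; ring.
- exact: measurable_angles.
- by move=> t _; rewrite muE ltry.
- exact: measurable_funS mR.
- exact: measurable_funS mI.
Qed.

Lemma herglotz_circle_unitary (alpha : R) : (forall n, unit_circle R (gamma n)) ->
  purely_atomic_herglotz_disk (fun z => (alpha%:C - phi_circle gamma v z)^-1) ->
  unitary_transform gamma v (phi_circle gamma v) alpha.
Proof.
move=> gC; rewrite phi_circleE => -[_ [b [mu [[int repr] amu]]]].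
have F := circle_frame R; have mA := @measurable_angles R.
have [] := @summable_atoms mu (angles R) (fun=> 1) (fun _ _ => ltr01).
  rewrite (eq_esum (_ : forall t, angles R t -> _ = mu [set t])).
    by rewrite -amu.
  by move=> t _; rewrite mul1e.
move=> fin sm cN.
apply: (@unitary_of_masses _ _ _ _ _ F _ _ _ gamma_inj two_terms v_gt0 v_sum gC
  _ _ (@expi_inj R) (@expi_image R) alpha b (fun t => 2 * fine (mu [set t]))).
- by move=> t _; rewrite mulr_ge0// fine_ge0.
- apply: eq_nnsummable sm => t _; rewrite cabs_expi expr1n mulr1.
  by rewrite -[1 + 1]/(2 : R) mulrAC divff// mul1r.
move=> z Dz; rewrite [LHS]repr//; congr (_ + _).
have [mR mI] := measurable_circle_kernel Dz.
rewrite (@cintegral_atomic _ mu (angles R))//.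
- rewrite -csum_mulI; apply: eq_csum => t _; rewrite /k_circle.
  rewrite real_complexM real_complex_nat.
  by move: (_ / (expi t - z)) => q; field.
- exact: measurable_funS mR.
- exact: measurable_funS mI.
Qed.

End PurelyAtomic.

(** * Position of Gamma and Lambda on a line or circle *)

Section BasisGeometry.
Variables (R : realType) (I : countType) (gamma : I -> R[i]) (v : I -> R).
Hypothesis gamma_inj : injective gamma.
Hypothesis two_terms : exists i j : I, i != j.
Hypothesis v_gt0 : forall n, 0 < v n.
Hypothesis coefs_ok : coefs_determined gamma v.

Lemma basis_concyclic Lambda w : rkernel_basis gamma v Lambda -> Lambda w ->
  exists z c, [/\ z != w, cabs c = 1 & forall n, concyclic_with z w c (gamma n)].
Proof.
move=> /rkernel_basisP-/(_ v_gt0 two_terms coefs_ok)[Ls U] Lw.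
have [orth tot] := (unitary_kernelsP v_gt0 two_terms Ls).1 U.
have [x [y [Lx Ly xy]]] := total_two_points v_gt0 two_terms gamma_inj Ls tot.
have [z [Lz zw]] : exists z, Lambda z /\ z != w.
  have [xw|xw] := eqVneq x w; last by exists x.
  by exists y; split=> //; rewrite -xw eq_sym.
have [c [c1 hc]] := kernel_ratio v_gt0 two_terms Ls orth tot Lz Lw zw.
by exists z, c.
Qed.

Lemma basis_nonempty Lambda : rkernel_basis gamma v Lambda ->
  exists w, Lambda w.
Proof.
move=> /rkernel_basisP-/(_ v_gt0 two_terms coefs_ok)[Ls U].
have [_ tot] := (unitary_kernelsP v_gt0 two_terms Ls).1 U.
by have [w [_ [Lw _ _]]] := total_two_points v_gt0 two_terms gamma_inj Ls tot; exists w.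
Qed.

Lemma basis_line_or_circle Lambda : rkernel_basis gamma v Lambda ->
  (exists p d : R[i], d != 0 /\ forall n, straight_line p d (gamma n)) \/
  (exists (c : R[i]) (r : R), 0 < r /\ forall n, circle c r (gamma n)).
Proof.
move=> bL; have [w Lw] := basis_nonempty bL.
have [z [c [zw c1 hc]]] := basis_concyclic bL Lw.
have [[p [d [d0 h]]]|[p h]] := concyclic_line_or_circle zw c1.
  by left; exists p, d; split=> // n; exact: h.
have [i [j ij]] := two_terms.
(* Radius 0 would put two distinct points of Gamma at the centre p. *)
right; exists p, (cabs (gamma i - p)); split; last by move=> n; exact: h.
rewrite cabs_gt0 subr_eq0; apply: contra ij => /eqP gi.
have /eqP := h _ _ (hc j) (hc i).
by rewrite gi subrr cabs0 cabs_eq0 subr_eq0 => /eqP gj; apply/eqP/gamma_inj; rewrite gi gj.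
Qed.

Lemma basis_on_line Lambda : (forall n, real_line R (gamma n)) ->
  three_terms I -> rkernel_basis gamma v Lambda -> Lambda `<=` real_line R.
Proof.
move=> gR /(three_terms_injective gamma_inj)[i [j [k [ij ik jk]]]] bL w Lw.
have [z [c [zw c1 hc]]] := basis_concyclic bL Lw.
exact: (concyclic_real zw ij ik jk (hc i) (hc j) (hc k)).
Qed.

Lemma basis_on_circle Lambda : (forall n, unit_circle R (gamma n)) ->
  three_terms I -> rkernel_basis gamma v Lambda -> Lambda `<=` unit_circle R.
Proof.
move=> gC /(three_terms_injective gamma_inj)[i [j [k [ij ik jk]]]] bL w Lw.
have [z [c [zw c1 hc]]] := basis_concyclic bL Lw.
exact: (concyclic_unit zw c1 ij ik jk (hc i) (hc j) (hc k)).
Qed.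

End BasisGeometry.

Theorem mainTheorem3 (R : realType) (I : countType)
    (gamma : I -> R[i]) (v : I -> R)
    (gamma_inj : injective gamma)
    (two_terms : exists i j : I, i != j)
    (v_gt0 : forall n, 0 < v n)
    (v_sum : (\esum_(n in [set: I]) (v n / (1 + cabs (gamma n) ^+ 2))%:E
                < +oo)%E)
    (star_neq0 : star gamma v !=set0)
    (coefs_ok : coefs_determined gamma v) :
  [/\ (* (1) *)
      (exists Lambda, rkernel_basis gamma v Lambda) ->
        (exists p d : R[i], d != 0 /\ forall n, straight_line p d (gamma n)) \/
        (exists (c : R[i]) (r : R), 0 < r /\ forall n, circle c r (gamma n)),
      (* (2) *)
      (forall n, real_line R (gamma n)) ->
        (forall Lambda : set R[i],
           three_terms I \/ Lambda `<=` real_line R ->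
           rkernel_basis gamma v Lambda <->
           exists alpha : R,
             Lambda = level_set gamma v (phi_line gamma v) alpha /\
             unitary_transform gamma v (phi_line gamma v) alpha) /\
        (forall alpha : R,
           unitary_transform gamma v (phi_line gamma v) alpha <->
           purely_atomic_herglotz_line
             (fun z => (alpha%:C - phi_line gamma v z)^-1)) &
      (* (3) *)
      (forall n, unit_circle R (gamma n)) ->
        (forall Lambda : set R[i],
           three_terms I \/ Lambda `<=` unit_circle R ->
           rkernel_basis gamma v Lambda <->
           exists alpha : R,
             Lambda = level_set gamma v (phi_circle gamma v) alpha /\
             unitary_transform gamma v (phi_circle gamma v) alpha) /\
        (forall alpha : R,
           unitary_transform gamma v (phi_circle gamma v) alpha <->
           purely_atomic_herglotz_disk
             (fun z => (alpha%:C - phi_circle gamma v z)^-1))].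
Proof.
split.
- by move=> [Lambda]; exact: basis_line_or_circle.
- move=> gR; split=> [Lambda LC|alpha].
    apply: (basis_levelP (line_frame R)) => // bL.
    by case: LC => // h3; exact: (basis_on_line gamma_inj two_terms v_gt0 coefs_ok).
  split; first exact: unitary_line_herglotz.
  exact: herglotz_line_unitary.
- move=> gC; split=> [Lambda LC|alpha].
    rewrite phi_circleE; apply: (basis_levelP (circle_frame R)) => // bL.
    by case: LC => // h3; exact: (basis_on_circle gamma_inj two_terms v_gt0 coefs_ok).
  split; first exact: unitary_circle_herglotz.
  exact: herglotz_circle_unitary.
Qed.
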